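(* Let $b\in\mathbb{R}$ and let $(\omega,c)$ be admissible. Then $H^1(\mathbb{R})$ is decomposed as the orthogonal direct sum $$H^1(\mathbb{R})=\mathcal{N}_{\omega,c}\oplus\mathcal{Z}_{\omega,c}\oplus\mathcal{P}_{\omega,c}.$$ Here $\mathcal{N}_{\omega,c}$ is the negative subspace of $L_{\omega,c}$, spanned by the eigenvector $\chi_{\omega,c}$ corresponding to the simple negative eigenvalue $\lambda_{\omega,c}$; $\mathcal{Z}_{\omega,c}$ is the kernel of $L_{\omega,c}$, spanned by $i\phi_{\omega,c}$ and $\phi_{\omega,c}'$; and $\mathcal{P}_{\omega,c}$ is the positive subspace of $L_{\omega,c}$, such that: (i) if $-2\sqrt\omega<c<2\sqrt\omega$, then there exists a constant $k>0$ such that $\langle L_{\omega,c}p,p\rangle\ge k\|p\|_{H^1}^2$ for all $p\in\mathcal{P}_{\omega,c}$; (ii) if $c=2\sqrt\omega$, then $\langle L_{\omega,c}p,p\rangle>0$ for all $p\in\mathcal{P}_{\omega,c}\setminus\{0\}$.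
   Context: Functions are complex-valued on $\mathbb{R}$; $L^2(\mathbb{R})$ is regarded as a real Hilbert space with inner product $(v,w)_{L^2}=\mathrm{Re}\int_{\mathbb{R}}v\overline w\,dx$; orthogonality is with respect to this inner product, spans are real, and $\langle\cdot,\cdot\rangle$ is the $H^{-1}$–$H^1$ duality pairing extending it. Let $\gamma=1+\frac{16}{3}b$. A pair $(\omega,c)$, $\omega>0$, is admissible if $-2\sqrt\omega<c\le2\sqrt\omega$ when $b>-3/16$, and $-2\sqrt\omega<c<-2\kappa_*\sqrt\omega$ with $\kappa_*=\sqrt{\frac{-\gamma}{1-\gamma}}$ when $b\le-3/16$. For admissible $(\omega,c)$ let $$\Phi_{\omega,c}(x)=\left(\frac{2(4\omega-c^2)}{\sqrt{c^2+\gamma(4\omega-c^2)}\cosh(\sqrt{4\omega-c^2}\,x)-c}\right)^{1/2}\ (|c|<2\sqrt\omega),\qquad \Phi_{\omega,c}(x)=\left(\frac{4c}{(cx)^2+\gamma}\right)^{1/2}\ (c=2\sqrt\omega),$$ $$\phi_{\omega,c}(x)=\Phi_{\omega,c}(x)\exp\Big(i\frac c2x-\frac i4\int_{-\infty}^x\Phi_{\omega,c}(y)^2\,dy\Big).$$ The function $\phi=\phi_{\omega,c}$ solves $-\phi''+\omega\phi+ci\phi'-i|\phi|^2\phi'-b|\phi|^4\phi=0$. The operator $L_{\omega,c}$ is $$L_{\omega,c}v=-v_{xx}+\omega v+civ_x-i|\phi_{\omega,c}|^2v_x-2i\,\mathrm{Re}(\phi_{\omega,c}\overline v)\phi_{\omega,c}'-b|\phi_{\omega,c}|^4v-4b|\phi_{\omega,c}|^2\mathrm{Re}(\phi_{\omega,c}\overline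 v)\phi_{\omega,c},$$ acting from $H^1(\mathbb{R})$ to $H^{-1}(\mathbb{R})$ (equivalently a self-adjoint operator on the real Hilbert space $L^2(\mathbb{R})$ with domain $H^2(\mathbb{R})$). *)

(* Defs.v *)
(* MathComp / MathComp-Analysis; complex numbers are [R[i]] (real-closed). *)
From HB Require Import structures.
From mathcomp Require Import all_boot all_order all_algebra.
From mathcomp Require Import all_classical all_reals all_analysis.
From mathcomp Require Import complex.

Set Implicit Arguments.
Unset Strict Implicit.
Unset Printing Implicit Defensive.

Import Order.TTheory GRing.Theory Num.Theory.
Import numFieldNormedType.Exports.

Local Open Scope classical_set_scope.
Local Open Scope ring_scope.
Local Open Scope complex_scope.

Section SobolevSpace.
Context {R : realType}.
Local Notation mu := (@lebesgue_measure R).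
Implicit Types (u v w f g : R -> R[i]) (N Z P : set (R -> R[i])).

Definition cintegral f : R[i] :=
  (\int[mu]_x complex.Re (f x)) +i* (\int[mu]_x complex.Im (f x)).

Definition inner v w : R := complex.Re (cintegral (fun x => v x * (w x)^*)).

Definition ae_equal v w : Prop := {ae mu, forall x, v x = w x}.

Definition L2 f : Prop :=
  ((fun x => complex.Re (f x)) \in Lfun mu 2%:E) /\
  ((fun x => complex.Im (f x)) \in Lfun mu 2%:E).

Definition test_function (t : R -> R) : Prop :=
  [/\ forall x, derivable t x 1,
      continuous (derive1 t) &
      exists M : R, forall x, M <= `|x| -> t x = 0].

(* Real C^1_c test functions, as in Brezis' definition of W^{1,p} on an
   interval; complex test functions add nothing, by linearity. *)
Definition weak_derivative u g : Prop :=
  forall t : R -> R, test_function t ->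
    cintegral (fun x => u x * (derive1 t x)%:C) =
    - cintegral (fun x => g x * (t x)%:C).

(* Elements of H^1 are represented by Borel functions; equality in H^1 is
   [ae_equal]. *)
Definition H1 : set (R -> R[i]) :=
  [set u | L2 u /\ exists g, L2 g /\ weak_derivative u g].

(* Some L^2 weak derivative of u in H^1 (unique almost everywhere);
   the value is junk (zero) when u is not in H^1. *)
Definition Dx u : R -> R[i] :=
  xget (fun=> 0) [set g | L2 g /\ weak_derivative u g].

Definition H1norm u : R := Num.sqrt (inner u u + inner (Dx u) (Dx u)).

(* The intersection with H^1 matters: the sigma-algebra is Borel, hence a
   function equal a.e. to a measurable one need not be measurable. *)
Definition rspan (s : seq (R -> R[i])) : set (R -> R[i]) :=
  [set v | H1 v /\ exists a : nat -> R,
    ae_equal v (fun x =>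
      \sum_(j < size s) (a j)%:C * nth (fun=> 0) s j x)].

Definition H1_subspace P : Prop :=
  [/\ P `<=` H1,
      P (fun=> 0),
      forall (a : R) u v, P u -> P v -> P (fun x => a%:C * u x + v x) &
      forall u v, P u -> H1 v -> ae_equal u v -> P v].

Definition orthogonal_spaces N P : Prop :=
  forall v w, N v -> P w -> inner v w = 0.

(* Directness of the sum follows from the orthogonality of the summands. *)
Definition H1_orthogonal_direct_sum N Z P : Prop :=
  [/\ H1_subspace N, H1_subspace Z & H1_subspace P] /\
  [/\ orthogonal_spaces N Z, orthogonal_spaces N P & orthogonal_spaces Z P] /\
  (forall v, H1 v -> exists n z p, [/\ N n, Z z, P p &
     ae_equal v (fun x => n x + z x + p x)]).

Definition cderiv f (x : R) : R[i] :=
  derive1 (fun y => complex.Re (f y)) x +i*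
  derive1 (fun y => complex.Im (f y)) x.

(* [A v] is read as the functional w |-> <A v, w> on H^1, i.e. as an element
   of H^{-1}; an equality in H^{-1} is tested on H^1. *)
Definition weak_eigenspace (A : (R -> R[i]) -> (R -> R[i]) -> R) (lam : R) :
    set (R -> R[i]) :=
  [set v | H1 v /\ forall w, H1 w -> A v w = lam * inner v w].

Definition weak_kernel (A : (R -> R[i]) -> (R -> R[i]) -> R) : set (R -> R[i]) :=
  [set v | H1 v /\ forall w, H1 w -> A v w = 0].

Definition weak_eigenvector A (lam : R) v : Prop :=
  weak_eigenspace A lam v /\ ~ ae_equal v (fun=> 0).

Definition weak_eigenvalue A (lam : R) : Prop := exists v, weak_eigenvector A lam v.

End SobolevSpace.

Section Soliton.
Context {R : realType}.
Variables b omega c : R.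
Local Notation mu := (@lebesgue_measure R).

Definition gamma : R := 1 + 16 / 3 * b.

Definition kappa_star : R := Num.sqrt (- gamma / (1 - gamma)).

Definition admissible : Prop :=
  0 < omega /\
  (- 3 / 16 < b ->
     - 2 * Num.sqrt omega < c /\ c <= 2 * Num.sqrt omega) /\
  (b <= - 3 / 16 ->
     - 2 * Num.sqrt omega < c /\ c < - 2 * kappa_star * Num.sqrt omega).

Definition cosh (x : R) : R := (expR x + expR (- x)) / 2.

(* The second branch is meant for c = 2 sqrt(omega). *)
Definition Phi (x : R) : R :=
  if `|c| < 2 * Num.sqrt omega then
    Num.sqrt (2 * (4 * omega - c ^+ 2) /
      (Num.sqrt (c ^+ 2 + gamma * (4 * omega - c ^+ 2)) *
         cosh (Num.sqrt (4 * omega - c ^+ 2) * x) - c))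
  else Num.sqrt (4 * c / ((c * x) ^+ 2 + gamma)).

Definition phase (x : R) : R :=
  c / 2 * x - 1 / 4 * \int[mu]_(y in `]-oo, x]) (Phi y ^+ 2).

Definition phi (x : R) : R[i] :=
  (Phi x)%:C * (cos (phase x) +i* sin (phase x)).

(* L v without the term - v_xx *)
Definition Lrest (v : R -> R[i]) (x : R) : R[i] :=
  let m2 := ComplexField.Normc.normc (phi x) ^+ 2 in
  let r := complex.Re (phi x * (v x)^*) in
  omega%:C * v x + c%:C * 'i * Dx v x - 'i * m2%:C * Dx v x
  - 2 * 'i * r%:C * cderiv phi x - b%:C * (m2 ^+ 2)%:C * v x
  - 4 * b%:C * m2%:C * r%:C * phi x.

(* <L v, w>, the H^{-1}-H^1 pairing: - v_xx in H^{-1} acts on w as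
   Re \int v_x (w_x)^*. *)
Definition Lop (v w : R -> R[i]) : R :=
  inner (Dx v) (Dx w) + inner (Lrest v) w.

End Soliton.

(* Main.v *)
Require Import Defs.
From HB Require Import structures.
From mathcomp Require Import all_boot all_order all_algebra.
From mathcomp Require Import all_classical all_reals all_analysis.
From mathcomp Require Import complex.
From mathcomp Require Import measurable_realfun ring lra.

Set Implicit Arguments.
Unset Strict Implicit.
Unset Printing Implicit Defensive.

Import Order.TTheory GRing.Theory Num.Theory.
Import numFieldNormedType.Exports.

Local Open Scope classical_set_scope.
Local Open Scope ring_scope.
Local Open Scope complex_scope.


(** The soliton is written as [phi = P e^{i th}] with [P = D^{-1/2}] and
    [th' = c / 2 - P^2 / 4]. In all admissible cases [D] solves a linear equation
    [D'' = k2 D + c / 2] with [k2 = 4 omega - c^2] ([soliton_profile]), so that the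
    logarithmic derivatives of [P] and [P'] and the potentials below are explicit, and the
    exponential and the algebraic soliton are treated together.

    For [v = e^{i th} (f + i g)] the form splits, up to integrals of total derivatives, as
    [<L v, v> = int (f'^2 + Vp f^2) + int (g' - q0 g + P^2 f / 2)^2] with [Vp = P''' / P'] and
    [q0 = P' / P] ([Lop_polar]). The function [P'] vanishes only at the origin, so the
    argument of Jacobi gives [int (f'^2 + Vp f^2) = int (f' - q f)^2 >= 0], [q = P'' / P'],
    whenever [f 0 = 0] ([jacobi_ge0]). Thus the form is nonnegative on the
    hyperplane [f 0 = 0], and has at most one negative direction. Its null vectors in the
    hyperplane are combinations of [i phi], [phi'] and the truncation [nplus] of
    [phi' - i th'(0) phi] to the right half-line ([Lop_null]). As
    [<L nplus, w> = - P''(0) f_w(0)] with [P''(0) < 0], where [f_w] is the first component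
    of [w], the kernel is spanned by [i phi] and [phi'] ([Lop_kernel]), and the form is
    negative at [phi + t nplus] for some [t] ([Lop_negative]).

    Existence of minimizers comes from one fact about a nonnegative form on a complete space
    that is coercive on a subspace of finite codimension: it is coercive or has a null vector
    ([null_vector_or_coercive]). Applied to the form minus the infimum of its Rayleigh
    quotient, with the hyperplane [f 0 = 0], it gives the negative eigenvector; the
    hyperplane then yields simplicity, uniqueness of the negative eigenvalue and
    nonnegativity on the orthogonal complement of [chi]. On this complement a null vector
    is in the kernel, by Cauchy-Schwarz, which proves (ii). For (i) the same alternative is
    used with the values on a fine finite grid as functionals: when [c^2 < 4 omega] the form
    is coercive up to terms weighted by [P^2], and these are small for functions
    vanishing on the grid ([gap_on_grid]).

    The remaining lemmas supply the space H1 on the line: continuous representatives with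
    square integrable derivatives, the du Bois-Reymond lemma that produces them from weak
    derivatives, the product rule and completeness. *)

(** * Semidefinite forms on a complete space *)

Section Forms.
Context {R : realType} {T : lmodType R}.
Implicit Types (V : set T) (B N : T -> T -> R) (l : T -> R) (u v w : T).

Definition subspace V := V 0 /\ forall a u v, V u -> V v -> V (a *: u + v).

Definition linear_on V l :=
  forall a u v, V u -> V v -> l (a *: u + v) = a * l u + l v.

Definition symform V B :=
  (forall u v, V u -> V v -> B u v = B v u) /\
  (forall w, V w -> linear_on V (B^~ w)).

Definition psd V B := forall v, V v -> 0 <= B v v.

Definition coercive V N B := exists2 k : R, 0 < k & forall v, V v -> k * N v v <= B v v.

Definition seq_cvg N (u : nat -> T) v :=
  forall e : R, 0 < e -> exists n0, forall n, (n0 <= n)%N -> N (u n - v) (u n - v) <= e.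

Definition complete_for V N := forall u : nat -> T, (forall n, V (u n)) ->
  (forall e : R, 0 < e -> exists n0, forall m n, (n0 <= m)%N -> (n0 <= n)%N ->
     N (u m - u n) (u m - u n) <= e) ->
  exists2 v, V v & seq_cvg N u v.

Lemma subspaceD V u v : subspace V -> V u -> V v -> V (u + v).
Proof. by move=> [_ h] Vu Vv; have := h 1 u v Vu Vv; rewrite scale1r. Qed.

Lemma subspaceZ V a u : subspace V -> V u -> V (a *: u).
Proof. by move=> [h0 h] Vu; have := h a u 0 Vu h0; rewrite addr0. Qed.

Lemma subspaceB V u v : subspace V -> V u -> V v -> V (u - v).
Proof.
by move=> sV Vu Vv; have [_ h] := sV; have := h (-1) v u Vv Vu; rewrite scaleN1r addrC.
Qed.

Lemma linear_onB V l u v : linear_on V l -> V u -> V v -> l (u - v) = l u - l v.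
Proof.
by move=> ll Vu Vv; rewrite addrC -scaleN1r ll// mulN1r addrC.
Qed.

Lemma linear_onZ V l a u : subspace V -> linear_on V l -> V u -> l (a *: u) = a * l u.
Proof.
move=> sV ll Vu; have [V0 _] := sV.
have l0 : l 0 = 0 by have := ll 1 0 0 V0 V0; rewrite scale1r addr0 mul1r => e; lra.
by have := ll a u 0 Vu V0; rewrite l0 !addr0.
Qed.

Lemma symform_sq V B a u v : subspace V -> symform V B -> V u -> V v ->
  B (a *: u + v) (a *: u + v) = a ^+ 2 * B u u + 2 * a * B u v + B v v.
Proof.
move=> sV [sB lB] Vu Vv; have Vw : V (a *: u + v) by apply: (sV.2).
rewrite (lB _ Vw)// (sB u)// (sB v)// !lB// (sB v u)//; ring.
Qed.

Lemma symformr0 V B u : subspace V -> symform V B -> V u -> B u 0 = 0.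
Proof.
move=> sV sB Vu; have V0 := sV.1; rewrite sB.1//.
by have := linear_onZ 0 sV (sB.2 _ Vu) V0; rewrite scale0r mul0r.
Qed.

Lemma symformZ V B a u : subspace V -> symform V B -> V u ->
  B (a *: u) (a *: u) = a ^+ 2 * B u u.
Proof.
move=> sV sB Vu; have V0 := sV.1; have := symform_sq a sV sB Vu V0.
by rewrite addr0 !(symformr0 sV sB)// mulr0 !addr0.
Qed.

Lemma symform_sqB V B u v : subspace V -> symform V B -> V u -> V v ->
  B (u - v) (u - v) = B u u - 2 * B u v + B v v.
Proof.
move=> sV sB Vu Vv; rewrite addrC -scaleN1r (symform_sq _ sV)// (sB.1 v u)//; ring.
Qed.

Lemma psd_cauchy_schwarz V B u v : subspace V -> symform V B -> psd V B ->
  V u -> V v -> B u v ^+ 2 <= B u u * B v v.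
Proof.
move=> sV sB pB Vu Vv.
have q a : 0 <= a ^+ 2 * B u u + 2 * a * B u v + B v v.
  by rewrite -(symform_sq _ sV)//; apply: pB; apply: (sV.2).
have := pB u Vu; rewrite le_eqVlt => /orP[/eqP u0|u0]; last first.
  have := q (- B u v / B u u).
  have -> : (- B u v / B u u) ^+ 2 * B u u + 2 * (- B u v / B u u) * B u v + B v v
     = (B u u * B v v - B u v ^+ 2) / B u u by field; rewrite gt_eqF.
  by rewrite pmulr_lge0 ?invr_gt0// subr_ge0.
have [->|nz] := eqVneq (B u v) 0; first by rewrite expr0n/= -u0 mul0r.
have := q (- (B v v + 1) / (2 * B u v)); rewrite -u0 mulr0 add0r.
have -> : 2 * (- (B v v + 1) / (2 * B u v)) * B u v = - (B v v + 1).
  by field; rewrite nz.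
by move=> h; exfalso; lra.
Qed.

Lemma psd_sqB_le V B u v : subspace V -> symform V B -> psd V B -> V u -> V v ->
  B (u - v) (u - v) <= 2 * B u u + 2 * B v v.
Proof.
move=> sV sB pB Vu Vv; rewrite (symform_sqB sV)//.
have := pB (1 *: u + v); rewrite (symform_sq _ sV)// => /(_ (sV.2 _ _ _ Vu Vv)); lra.
Qed.

(** On the complement [e + ker l] of a hyperplane, a form that is coercive on
    the hyperplane has a minimizing sequence that is automatically Cauchy,
    because differences of its terms lie in the hyperplane. Its limit is a null
    vector if the infimum is zero; a positive infimum gives coercivity. *)
Lemma null_vector_or_coercive_hyperplane V N B l M C :
  subspace V -> symform V N -> psd V N -> symform V B -> psd V B ->
  complete_for V N -> (forall v, V v -> B v v <= M * N v v) ->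
  linear_on V l -> (forall v, V v -> l v ^+ 2 <= C * N v v) ->
  coercive (V `&` [set v | l v = 0]) N B ->
  coercive V N B \/ exists v, [/\ V v, 0 < N v v & B v v = 0].
Proof.
move=> sV sN pN sB pB cV BM ll lC [k k0 hk].
have [h|] := pselect (forall v, V v -> l v = 0).
  by left; exists k => // v Vv; apply: hk; split => //; exact: h.
move=> /existsNP[e0] /not_implyP[Ve0 /eqP le0].
pose e := (l e0)^-1 *: e0.
have Ve : V e by exact: subspaceZ.
have le1 : l e = 1 by rewrite (linear_onZ _ sV ll)// mulVf.
pose S := [set r | exists v, [/\ V v, l v = 1 & r = B v v]].
have S0 : S !=set0 by exists (B e e), e.
have Slb : lbound S 0 by move=> _ [v [Vv _ ->]]; exact: pB.
have Sinf : has_inf S by split => //; exists 0.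
have m0 : 0 <= inf S by exact: lb_le_inf.
move: m0; rewrite le_eqVlt => /orP[/eqP m0|m0].
  right.
  have /choice[u hu] : forall n : nat, exists v, [/\ V v, l v = 1 & B v v < n.+1%:R^-1].
    move=> n; have [|_ [v [Vv lv ->]]] := @inf_adherent _ S n.+1%:R^-1 _ Sinf.
      by rewrite invr_gt0.
    by rewrite -m0 add0r => h; exists v.
  have BuB m n : B (u m - u n) (u m - u n) <= 2 * m.+1%:R^-1 + 2 * n.+1%:R^-1.
    have [Vm _ hm] := hu m; have [Vn _ hn] := hu n.
    apply: le_trans (psd_sqB_le sV sB pB Vm Vn) _.
    by rewrite lerD// ler_pM2l// ltW.
  have invle (eps : R) (n : nat) : 0 < eps -> (Num.truncn eps^-1 <= n)%N -> n.+1%:R^-1 <= eps.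
    move=> eps0 hn; have n1 : 0 < n.+1%:R :> R by rewrite ltr0n.
    rewrite invf_ple ?posrE//.
    have /andP[_ /ltW h] := @truncn_itv R eps^-1 (ltac:(rewrite invr_ge0; exact: ltW)).
    by apply: le_trans h _; rewrite ler_nat.
  have [||v Vv uv] := cV u; first by move=> n; have [] := hu n.
    move=> eps eps0.
    have ke : 0 < k * eps / 4 by rewrite !mulr_gt0.
    exists (Num.truncn (k * eps / 4)^-1) => m n hm hn.
    have [Vm lm _] := hu m; have [Vn ln _] := hu n.
    have Vmn : V (u m - u n) by exact: subspaceB.
    have : k * N (u m - u n) (u m - u n) <= B (u m - u n) (u m - u n).
      by apply: hk; split => //=; rewrite (linear_onB ll)// lm ln subrr.
    have := BuB m n; have := invle _ _ ke hm; have := invle _ _ ke hn => h1 h2 h3 h4.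
    rewrite -(ler_pM2l k0); move: h1 h2 h3 h4; clear.
    move: (m.+1%:R^-1 : R) (n.+1%:R^-1 : R) => p q; lra.
  have M0 : 0 <= `|M| by [].
  have lv : l v = 1.
    apply/eqP; rewrite -subr_eq0 -sqrf_eq0 eq_le sqr_ge0 andbT.
    apply/ler_addgt0Pr => eps eps0; rewrite add0r.
    have C1 : 0 < `|C| + 1 by rewrite ltr_wpDl.
    have [n0 /(_ n0 (leqnn _)) h] := uv (eps / (`|C| + 1)) (divr_gt0 eps0 C1).
    have [Vn ln _] := hu n0.
    have Vnv : V (u n0 - v) by exact: subspaceB.
    have := lC _ Vnv; rewrite (linear_onB ll)// ln -sqrrN opprB => /le_trans; apply.
    rewrite ler_pdivlMr// in h; apply: le_trans h.
    rewrite [leRHS]mulrC ler_wpM2r ?pN// (le_trans (ler_norm _))// lerDl ler01 //.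
  have Nv : 0 < N v v.
    have := lC _ Vv; rewrite lv expr1n => h.
    rewrite lt_neqAle pN// andbT; apply/eqP => e1; move: h; rewrite -e1; lra.
  exists v; split => //; apply/eqP; rewrite eq_le pB// andbT.
  apply/ler_addgt0Pr => eps eps0; rewrite add0r.
  have M1 : 0 < 4 * (`|M| + 1) by rewrite mulr_gt0// ltr_wpDl.
  have [n0 hn0] := uv _ (divr_gt0 eps0 M1).
  have e4 : 0 < eps / 4 by rewrite divr_gt0.
  pose n := maxn n0 (Num.truncn (eps / 4)^-1).
  have h1 := invle (eps / 4) n e4 (leq_maxr _ _).
  have h2 := hn0 n (leq_maxl _ _); have [Vn ln hn] := hu n.
  have Vnv : V (u n - v) by exact: subspaceB.
  have := psd_sqB_le sV sB pB Vn Vnv; rewrite opprB addrCA subrr addr0.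
  move=> /le_trans; apply.
  have h3 := BM _ Vnv.
  have h4 : M * N (u n - v) (u n - v) <= (`|M| + 1) * N (u n - v) (u n - v).
    by rewrite ler_wpM2r ?pN// (le_trans (ler_norm _))// lerDl ler01.
  have h5 : 4 * (`|M| + 1) * N (u n - v) (u n - v) <= eps.
    by rewrite mulrC -ler_pdivlMr.
  have := lt_le_trans hn h1; clear -h3 h4 h5; lra.
left; set m := inf S in m0.
have Bm v : V v -> m * l v ^+ 2 <= B v v.
  move=> Vv; have [->|lv] := eqVneq (l v) 0; first by rewrite expr0n/= mulr0 pB.
  have : m <= B ((l v)^-1 *: v) ((l v)^-1 *: v).
    apply: ge_inf; first by exists 0.
    by exists ((l v)^-1 *: v); split => //; [exact: subspaceZ|rewrite (linear_onZ _ sV ll)// mulVf].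
  rewrite (symformZ _ sV)//.
  by rewrite exprVn mulrC ler_pdivlMr// exprn_even_gt0.
have Be := pB _ Ve; have Ne := pN _ Ve.
pose K : R := 4 / k + (4 * B e e / k + 2 * N e e) / m.
have K0 : 0 < K by rewrite ltr_wpDr ?divr_gt0// divr_ge0 ?(ltW m0)// addr_ge0 ?divr_ge0 ?mulr_ge0// ltW.
exists K^-1; first by rewrite invr_gt0.
move=> v Vv; rewrite mulrC ler_pdivrMr//.
pose w := v - l v *: e.
have Vle : V (l v *: e) by exact: subspaceZ.
have Vw : V w by exact: subspaceB.
have lw : l w = 0 by rewrite (linear_onB ll)// (linear_onZ _ sV ll)// le1 mulr1 subrr.
have h1 : k * N w w <= B w w by apply: hk.
have h2 := psd_sqB_le sV sB pB Vv Vle; rewrite (symformZ _ sV)// -/w in h2.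
have h3 : N v v <= 2 * N w w + 2 * (l v ^+ 2 * N e e).
  rewrite -(symformZ _ sV)//.
  have Vme : V (- (l v *: e)) by rewrite -scaleN1r; exact: subspaceZ.
  have h := psd_sqB_le sV sN pN Vw Vme; rewrite opprK subrK in h.
  apply: le_trans h _.
  by rewrite -scaleN1r (symformZ (-1) sV)// sqrrN expr1n mul1r.
have h4 := Bm _ Vv.
have h5 : N w w <= B w w / k by rewrite ler_pdivlMr// mulrC.
have h6 : l v ^+ 2 <= B v v / m by rewrite ler_pdivlMr// mulrC.
have h7 : B w w / k <= (2 * B v v + 2 * (l v ^+ 2 * B e e)) / k.
  by rewrite ler_pM2r// invr_gt0.
have X0 : 0 <= 4 * B e e / k + 2 * N e e.
  by rewrite addr_ge0 ?mulr_ge0// invr_ge0 ltW.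
have h8 := ler_wpM2r X0 h6.
apply: le_trans h3 _; rewrite /K.
have -> : B v v * (4 / k + (4 * B e e / k + 2 * N e e) / m)
  = 4 * B v v / k + B v v / m * (4 * B e e / k + 2 * N e e) by ring.
apply: (@le_trans _ _ (2 * ((2 * B v v + 2 * (l v ^+ 2 * B e e)) / k)
   + 2 * (l v ^+ 2 * N e e))); first by lra.
apply: (@le_trans _ _ (4 * B v v / k + l v ^+ 2 * (4 * B e e / k + 2 * N e e))); last by rewrite lerD2l.
by rewrite le_eqVlt; apply/orP; left; apply/eqP; ring.
Qed.

(** Finite codimension follows from codimension one: either the form is
    coercive on the next smaller hyperplane, or a null vector is already found
    there. *)
Lemma null_vector_or_coercive (ls : seq (T -> R)) V N B M C :
  subspace V -> symform V N -> psd V N -> symform V B -> psd V B ->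
  complete_for V N -> (forall v, V v -> B v v <= M * N v v) ->
  (forall j, (j < size ls)%N -> linear_on V (nth (fun=> 0) ls j) /\
     forall v, V v -> nth (fun=> 0) ls j v ^+ 2 <= C * N v v) ->
  coercive (V `&` [set v | forall j, (j < size ls)%N -> nth (fun=> 0) ls j v = 0]) N B ->
  coercive V N B \/ exists v, [/\ V v, 0 < N v v & B v v = 0].
Proof.
elim: ls V => [|l ls IH] V sV sN pN sB pB cV BM hl hc.
  by left; case: hc => k k0 hk; exists k => // v Vv; apply: hk; split.
have [ll lC] := hl 0%N isT; rewrite /= in ll lC.
pose V0 := V `&` [set v | l v = 0].
have sV0 : subspace V0.
  split; first split; first exact: sV.1.
    by rewrite /=; have := linear_onZ 0 sV ll sV.1; rewrite scale0r mul0r.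
  move=> a u v [Vu lu] [Vv lv]; split; first exact: sV.2.
  by rewrite /= ll// lu lv mulr0 addr0.
have sub A : symform V A -> symform V0 A.
  move=> [h1 h2]; split; first by move=> u v [Vu _] [Vv _]; exact: h1.
  by move=> w [Vw _] a u v [Vu _] [Vv _]; exact: h2.
have cV0 : complete_for V0 N.
  move=> u hu cu; have [|v Vv uv] := cV u _ cu; first by move=> n; have [] := hu n.
  exists v => //; split => //=; apply/eqP; rewrite -sqrf_eq0 eq_le sqr_ge0 andbT.
  apply/ler_addgt0Pr => eps eps0; rewrite add0r.
  have C1 : 0 < `|C| + 1 by rewrite ltr_wpDl.
  have [n0 /(_ n0 (leqnn _)) h] := uv (eps / (`|C| + 1)) (divr_gt0 eps0 C1).
  have [Vn ln] := hu n0; rewrite /= in ln.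
  have Vnv : V (u n0 - v) by exact: subspaceB.
  have := lC _ Vnv; rewrite (linear_onB ll)// ln add0r sqrrN => /le_trans; apply.
  rewrite ler_pdivlMr// in h; apply: le_trans h.
  by rewrite [leRHS]mulrC ler_wpM2r ?pN// (le_trans (ler_norm _))// lerDl ler01.
have pN0 : psd V0 N by move=> v [Vv _]; exact: pN.
have pB0 : psd V0 B by move=> v [Vv _]; exact: pB.
have BM0 v : V0 v -> B v v <= M * N v v by move=> [Vv _]; exact: BM.
have hl0 j : (j < size ls)%N -> linear_on V0 (nth (fun=> 0) ls j) /\
    forall v, V0 v -> nth (fun=> 0) ls j v ^+ 2 <= C * N v v.
  move=> jl; have [h1 h2] := hl j.+1 jl.
  by split => [a u v [Vu _] [Vv _]|v [Vv _]]; [exact: h1|exact: h2].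
have hc0 : coercive
    (V0 `&` [set v | forall j, (j < size ls)%N -> nth (fun=> 0) ls j v = 0]) N B.
  case: hc => k k0 hk; exists k => // v [[Vv lv] hv]; apply: hk; split => //= -[|j] //=.
  by rewrite ltnS; exact: hv.
have [cN|[v [[Vv _] Nv Bv]]] := IH V0 sV0 (sub _ sN) pN0 (sub _ sB) pB0 cV0 BM0 hl0 hc0.
  exact: null_vector_or_coercive_hyperplane cV BM ll lC cN.
by right; exists v.
Qed.

End Forms.

(** * Integrable and square integrable functions on the line *)

Section RealL2.
Context {R : realType}.
Local Notation mu := (@lebesgue_measure R).
Local Notation RT := (measurableTypeR R).
Implicit Types (f g h u w d e : R -> R) (D E : set RT) (a b x y z : R).

Definition L1on D f := mu.-integrable D (EFin \o f).

Definition L2on D f := measurable_fun D f /\ L1on D (fun x => f x ^+ 2).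

Lemma aeS (P Q : RT -> Prop) : (forall x, P x -> Q x) ->
  {ae mu, forall x, P x} -> {ae mu, forall x, Q x}.
Proof. by move=> PQ; apply: filterS => //; exact: ae_filter_ringOfSetsType. Qed.

Lemma aeI (P Q : RT -> Prop) : {ae mu, forall x, P x} -> {ae mu, forall x, Q x} ->
  {ae mu, forall x, P x /\ Q x}.
Proof. by move=> hP hQ; apply: (@filterI _ _ (ae_filter_ringOfSetsType mu)). Qed.

Lemma L1on_measurable D f : L1on D f -> measurable_fun D f.
Proof. by move=> /(measurable_int mu) /measurable_EFinP. Qed.

Lemma L1on_le D f g : measurable D -> measurable_fun D f ->
  (forall x, D x -> `|f x| <= g x) -> L1on D g -> L1on D f.
Proof.
move=> mD mf fg; apply: le_integrable => //; first exact/measurable_EFinP.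
by move=> x Dx /=; rewrite lee_fin (le_trans (fg x Dx))// ler_norm.
Qed.

Lemma L1on_eq D f g : (forall x, D x -> f x = g x) -> L1on D f -> L1on D g.
Proof.
move=> fg /integrableP[mf hf]; apply/integrableP; split.
  by apply: eq_measurable_fun mf => x xD /=; rewrite fg//; exact: set_mem.
move: hf; congr (_ < _)%E; apply: eq_integral => x xD /=.
by rewrite fg//; exact: set_mem.
Qed.

Lemma L1on_sub D E f : measurable D -> measurable E -> E `<=` D -> L1on D f -> L1on E f.
Proof. by move=> mD mE ED; exact: integrableS. Qed.

Lemma L1onD D f g : measurable D -> L1on D f -> L1on D g -> L1on D (fun x => f x + g x).
Proof. by move=> mD hf hg; exact: (integrableD mD hf hg). Qed.

Lemma L1onZ D k f : measurable D -> L1on D f -> L1on D (fun x => k * f x).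
Proof. by move=> mD hf; exact: (integrableZl mD k hf). Qed.

Lemma L1onN D f : measurable D -> L1on D f -> L1on D (fun x => - f x).
Proof.
by move=> mD hf; apply: L1on_eq (L1onZ (-1) mD hf) => x _; rewrite mulN1r.
Qed.

Lemma L1onB D f g : measurable D -> L1on D f -> L1on D g -> L1on D (fun x => f x - g x).
Proof. by move=> mD hf hg; apply: L1onD => //; exact: L1onN. Qed.

Lemma L1on_norm D f : L1on D f -> L1on D (fun x => `|f x|).
Proof. exact: integrable_norm. Qed.

Lemma L1on0 D : measurable D -> L1on D (fun=> 0).
Proof. by move=> mD; exact: integrable0. Qed.

Lemma L1onM_bounded D M f g : measurable D -> measurable_fun D f ->
  (forall x, D x -> `|f x| <= M) -> L1on D g -> L1on D (fun x => f x * g x).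
Proof.
move=> mD mf fM hg; apply: (L1on_le mD _ _ (L1onZ M mD (L1on_norm hg))).
  by apply: measurable_funM => //; exact: L1on_measurable.
by move=> x Dx; rewrite normrM ler_wpM2r// fM.
Qed.

Lemma L2onM D f g : measurable D -> L2on D f -> L2on D g -> L1on D (fun x => f x * g x).
Proof.
move=> mD [mf hf] [mg hg]; apply: (L1on_le mD _ _ (L1onD mD hf hg)).
  exact: measurable_funM.
move=> x _; rewrite normrM -(normr_id (f x)) -(real_normK (num_real (f x))).
rewrite -(real_normK (num_real (g x))) normr_id.
have := sqr_ge0 (`|f x| - `|g x|); have := normr_ge0 (f x); have := normr_ge0 (g x); nra.
Qed.

Lemma L2on_le D f g : measurable D -> measurable_fun D f ->
  (forall x, D x -> `|f x| <= `|g x|) -> L2on D g -> L2on D f.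
Proof.
move=> mD mf fg [mg hg]; split => //; apply: (L1on_le mD _ _ hg).
  exact: measurable_funX.
move=> x Dx; rewrite ger0_norm ?sqr_ge0//.
rewrite -(real_normK (num_real (f x))) -(real_normK (num_real (g x))).
by rewrite lerXn2r ?nnegrE// fg.
Qed.

Lemma L2on_eq D f g : (forall x, D x -> f x = g x) -> L2on D f -> L2on D g.
Proof.
move=> fg [mf hf]; split.
  by apply: eq_measurable_fun mf => x xD; apply: fg; exact: set_mem.
by apply: L1on_eq hf => x Dx; rewrite fg.
Qed.

Lemma L2on_sub D E f : measurable D -> measurable E -> E `<=` D -> L2on D f -> L2on E f.
Proof.
by move=> mD mE ED [mf hf]; split; [exact: measurable_funS mf|exact: L1on_sub hf].
Qed.

Lemma L2onD D f g : measurable D -> L2on D f -> L2on D g -> L2on D (fun x => f x + g x).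
Proof.
move=> mD hf hg; have [mf hf2] := hf; have [mg hg2] := hg.
split; first exact: measurable_funD.
have := L1onD mD (L1onD mD hf2 hg2) (L1onZ 2 mD (L2onM mD hf hg)).
by apply: L1on_eq => x _; ring.
Qed.

Lemma L2onM_bounded D M f g : measurable D -> measurable_fun D f ->
  (forall x, D x -> `|f x| <= M) -> L2on D g -> L2on D (fun x => f x * g x).
Proof.
move=> mD mf fM [mg hg]; split; first exact: measurable_funM.
apply: L1on_eq (_ : L1on D (fun x => f x ^+ 2 * g x ^+ 2)).
  by move=> x _; rewrite exprMn.
apply: (@L1onM_bounded _ (M ^+ 2)) => //; first exact: measurable_funX.
by move=> x Dx; rewrite normrX lerXn2r ?nnegrE// ?fM// (le_trans _ (fM x Dx)).
Qed.

Lemma L2onZ D k f : measurable D -> L2on D f -> L2on D (fun x => k * f x).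
Proof. by move=> mD hf; apply: (@L2onM_bounded _ `|k|). Qed.

Lemma L2onN D f : measurable D -> L2on D f -> L2on D (fun x => - f x).
Proof.
by move=> mD hf; apply: L2on_eq (L2onZ (-1) mD hf) => x _; rewrite mulN1r.
Qed.

Lemma L2onB D f g : measurable D -> L2on D f -> L2on D g -> L2on D (fun x => f x - g x).
Proof. by move=> mD hf hg; apply: L2onD => //; exact: L2onN. Qed.

Lemma L2on0 D : measurable D -> L2on D (fun=> 0).
Proof.
move=> mD; split => //; apply: L1on_eq (L1on0 mD) => x _; by rewrite expr0n.
Qed.

Lemma L2on_bounded_itv M f x y : measurable_fun (`[x, y] : set RT) f ->
  (forall t, t \in `[x, y] -> `|f t| <= M) -> L2on `[x, y] f.
Proof.
move=> mf fM; split => //.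
apply: (L1on_le (g := fun=> M ^+ 2)) => //; first exact: measurable_funX.
  move=> t xy; rewrite normrX lerXn2r ?nnegrE// ?fM// (le_trans _ (fM t xy))//.
apply: measurable_bounded_integrable => //.
  by rewrite /= lebesgue_measure_itv/=; case: ifPn => // _; rewrite -EFinD ltry.
exists `|M ^+ 2|; split; first exact: num_real.
by move=> r Mr t _ /=; exact: ltW.
Qed.

Lemma L2on_L1on_itv f x y : L2on `[x, y] f -> L1on `[x, y] f.
Proof.
move=> hf; have h1 : L2on `[x, y] (fun=> 1 : R).
  by apply: (@L2on_bounded_itv 1) => // t _; rewrite normr1.
by apply: L1on_eq (L2onM _ h1 hf) => // t _; rewrite mul1r.
Qed.

Lemma L2on_LfunP f : f \in Lfun mu 2%:E <-> L2on setT f.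
Proof.
split=> [hf|[mf hf]].
  split; last exact: Lfun2_integrable_sqr.
  by move: hf; rewrite inE => /andP[]; rewrite inE.
rewrite inE; apply/andP; split; rewrite inE//=.
rewrite /finite_norm unlock; apply: poweR_lty.
have /integrableP[_] := hf; congr (_ < _)%E.
apply: eq_integral => x _ /=.
by rewrite ger0_norm ?sqr_ge0// powR_mulrn// real_normK ?num_real.
Qed.

Lemma ae_integral_eq f g : measurable_fun [set: RT] f -> measurable_fun [set: RT] g ->
  {ae mu, forall x, f x = g x} -> \int[mu]_x f x = \int[mu]_x g x.
Proof.
move=> mf mg fg; congr fine; apply: ae_eq_integral => //; try exact/measurable_EFinP.
by apply: aeS fg => x /= -> _.
Qed.

Lemma L1on_ae f g : measurable_fun [set: RT] g -> {ae mu, forall x, f x = g x} ->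
  L1on setT f -> L1on setT g.
Proof.
move=> mg fg /integrableP[mf hf]; apply/integrableP; split; first exact/measurable_EFinP.
move: hf; congr (_ < _)%E; apply: ae_eq_integral => //.
- exact: measurableT_comp.
- by apply: measurableT_comp => //; exact/measurable_EFinP.
- by apply: aeS fg => x /= -> _.
Qed.

Lemma L2on_ae f g : measurable_fun [set: RT] g -> {ae mu, forall x, f x = g x} ->
  L2on setT f -> L2on setT g.
Proof.
move=> mg fg [mf hf]; split => //; apply: L1on_ae hf; first exact: measurable_funX.
by apply: aeS fg => x ->.
Qed.

Lemma Rintegral_ge0_eq0 D f : measurable D -> L1on D f -> (forall x, D x -> 0 <= f x) ->
  \int[mu]_(x in D) f x = 0 -> {ae mu, forall x, D x -> f x = 0}.
Proof.
move=> mD hf f0 I0.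
have /(ae_eq_integral_abs mu mD)[h _] : measurable_fun D (EFin \o f).
  exact: (measurable_int mu).
have /h : (\int[mu]_(x in D) `|(EFin \o f) x| = 0)%E.
  transitivity (\int[mu]_(x in D) (f x)%:E)%E.
    by apply: eq_integral => x xD /=; rewrite ger0_norm// f0//; exact: set_mem.
  by rewrite -(fineK (integrable_fin_num mD hf)) -/(Rintegral mu D f) I0.
by apply: aeS => x /= fx Dx; have [] := fx Dx.
Qed.

Lemma Rintegral_cauchy_schwarz D f g : measurable D -> L2on D f -> L2on D g ->
  (\int[mu]_(x in D) (f x * g x)) ^+ 2 <=
  (\int[mu]_(x in D) (f x ^+ 2)) * (\int[mu]_(x in D) (g x ^+ 2)).
Proof.
move=> mD hf hg.
pose T : lmodType R := R -> R^o.
pose V : set T := [set f | L2on D f].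
pose B (f g : T) : R := \int[mu]_(x in D) (f x * g x).
have sV : subspace V.
  split; first exact: L2on0.
  by move=> a u v Vu Vv; apply: L2onD => //; exact: L2onZ.
have sB : symform V B.
  split=> [u v _ _|w Vw a u v Vu Vv].
    by apply: eq_Rintegral => x _; rewrite mulrC.
  rewrite /B -RintegralZl//; last exact: L2onM.
  rewrite -RintegralD//; last 2 first.
  - by apply: L1onZ => //; exact: L2onM.
  - exact: L2onM.
  by apply: eq_Rintegral => x _; rewrite mulrA -mulrDl.
have pB : psd V B.
  by move=> v _; apply: Rintegral_ge0 => x _; rewrite -expr2 sqr_ge0.
by have := psd_cauchy_schwarz sV sB pB hf hg.
Qed.

Lemma Rintegral_itv_split f x y z : x <= y -> y <= z -> L1on `[x, z] f ->
  \int[mu]_(t in `[x, z]) f t = \int[mu]_(t in `[x, y]) f t + \int[mu]_(t in `[y, z]) f t.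
Proof.
move=> xy yz hf.
have := @Rintegral_itvB R f (BLeft x) (BRight z) y hf.
rewrite !bnd_simp => /(_ xy yz).
rewrite Rintegral_itv_obnd_cbnd; first by move=> <-; rewrite addrCA subrr addr0.
apply: L1on_sub hf => // t /=; rewrite !in_itv/= => /andP[yt ->].
by rewrite (le_trans xy (ltW yt)).
Qed.

Lemma Rintegral_itv_cst k x y : x <= y -> \int[mu]_(t in `[x, y]) k = k * (y - x).
Proof.
move=> xy; rewrite Rintegral_cst//= lebesgue_measure_itv/= lte_fin.
move: xy; rewrite le_eqVlt => /orP[/eqP ->|-> //].
by rewrite ltxx subrr mulr0.
Qed.

End RealL2.

(** * Absolutely continuous functions with square integrable derivative *)

Section AbsolutelyContinuous.
Context {R : realType}.
Local Notation mu := (@lebesgue_measure R).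
Local Notation RT := (measurableTypeR R).
Implicit Types (f g h u w d e : R -> R) (a b x y z : R).

(** [d] is a square integrable derivative of [u] on [a, b]. Square
    integrability, rather than integrability, makes [u] 1/2-Hoelder, which is
    what the elementary proof of the product rule below exploits. *)
Definition AC a b u d := L2on `[a, b] d /\
  forall x y, a <= x -> x <= y -> y <= b -> u y - u x = \int[mu]_(t in `[x, y]) d t.

Definition ACR u d := forall a b, AC a b u d.

Lemma AC_sub a b x y u d : a <= x -> y <= b -> AC a b u d -> AC x y u d.
Proof.
move=> ax yb [hd hu]; split.
  apply: L2on_sub hd => // t /=; rewrite !in_itv/= => /andP[xt ty].
  by rewrite (le_trans ax xt) (le_trans ty yb).
by move=> s t xs st ty; apply: hu => //; [exact: le_trans xs|exact: le_trans yb].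
Qed.

Lemma AC_L2 a b u d x y : AC a b u d -> a <= x -> y <= b -> L2on `[x, y] d.
Proof. by move=> hu ax yb; have [] := AC_sub ax yb hu. Qed.

Lemma AC_L1 a b u d x y : AC a b u d -> a <= x -> y <= b -> L1on `[x, y] d.
Proof. by move=> hu ax yb; apply: L2on_L1on_itv; exact: AC_L2 hu ax yb. Qed.

Lemma integral_norm_sqr_le x y d : x <= y -> L2on `[x, y] d ->
  (\int[mu]_(t in `[x, y]) `|d t|) ^+ 2 <= (y - x) * \int[mu]_(t in `[x, y]) (d t ^+ 2).
Proof.
move=> xy hd.
have h1 : L2on `[x, y] (fun=> 1 : R).
  by apply: (@L2on_bounded_itv _ 1) => // t _; rewrite normr1.
have nd : L2on `[x, y] (fun t => `|d t|).
  apply: (L2on_le _ _ _ hd) => //; last by move=> t _; rewrite normr_id.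
  by apply: measurableT_comp => //; case: hd.
have := Rintegral_cauchy_schwarz (ltac:(done) : measurable (`[x, y]%classic : set RT)) h1 nd.
under eq_Rintegral do rewrite mul1r.
under [X in _ <= X * _ -> _]eq_Rintegral do rewrite expr1n.
rewrite Rintegral_itv_cst// mul1r.
by under [X in _ <= _ * X -> _]eq_Rintegral do rewrite real_normK ?num_real//.
Qed.

Lemma AC_norm a b u d x y : AC a b u d -> a <= x -> x <= y -> y <= b ->
  `|u y - u x| <= \int[mu]_(t in `[x, y]) `|d t|.
Proof.
move=> hu ax xy yb; rewrite hu.2//; apply: le_normr_Rintegral => //.
exact: AC_L1 hu ax yb.
Qed.

Lemma AC_holder a b u d x y : AC a b u d -> a <= x -> x <= y -> y <= b ->
  (u y - u x) ^+ 2 <= (y - x) * \int[mu]_(t in `[x, y]) (d t ^+ 2).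
Proof.
move=> hu ax xy yb; apply: le_trans (integral_norm_sqr_le xy (AC_L2 hu ax yb)).
rewrite -[leLHS]real_normK ?num_real// lerXn2r ?nnegrE//.
  by apply: Rintegral_ge0.
exact: AC_norm hu ax xy yb.
Qed.

Lemma Rintegral_sqr_mono a b d x y : L2on `[a, b] d -> a <= x -> y <= b ->
  \int[mu]_(t in `[x, y]) (d t ^+ 2) <= \int[mu]_(t in `[a, b]) (d t ^+ 2).
Proof.
move=> [md hd] ax yb; rewrite fine_le//.
- apply: integrable_fin_num => //; apply: L1on_sub hd => // t /=.
  by rewrite !in_itv/= => /andP[xt ty]; rewrite (le_trans ax xt) (le_trans ty yb).
- exact: integrable_fin_num.
- apply: ge0_subset_integral => //.
  + exact/measurable_EFinP/measurable_funX.
  + by move=> t _; rewrite lee_fin sqr_ge0.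
  + by move=> t /=; rewrite !in_itv/= => /andP[xt ty]; rewrite (le_trans ax xt) (le_trans ty yb).
Qed.

Lemma AC_holder_ab a b u d x y : AC a b u d -> a <= x -> x <= y -> y <= b ->
  (u y - u x) ^+ 2 <= (y - x) * \int[mu]_(t in `[a, b]) (d t ^+ 2).
Proof.
move=> hu ax xy yb; apply: le_trans (AC_holder hu ax xy yb) _.
by rewrite ler_wpM2l ?subr_ge0//; apply: Rintegral_sqr_mono => //; case: hu.
Qed.

Lemma AC_bounded a b u d : AC a b u d -> exists M, forall t, a <= t -> t <= b -> `|u t| <= M.
Proof.
move=> hu; exists (`|u a| + \int[mu]_(t in `[a, b]) `|d t|) => t at_ tb.
have h := AC_norm hu (lexx a) at_ tb.
have -> : u t = u a + (u t - u a) by rewrite addrCA subrr addr0.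
apply: le_trans (ler_normD _ _) _; rewrite lerD2l; apply: le_trans h _.
rewrite (@Rintegral_itv_split _ _ a t b)//; last first.
  by apply: L1on_norm; exact: AC_L1 hu _ _.
by rewrite lerDl; apply: Rintegral_ge0.
Qed.

Lemma AC_continuous a b u d : AC a b u d -> {within `[a, b], continuous u}.
Proof.
move=> hu; have [ab|ba] := leP a b; last first.
  rewrite set_itv_ge ?bnd_simp -?ltNge//; exact: continuous_subspace0.
have hd : L1on `[a, b] d by exact: AC_L1 hu _ _.
have := parameterized_integral_continuous ab hd.
have hua t : t \in `[a, b] -> u t = u a + parameterized_integral mu a t d.
  rewrite in_itv/= => /andP[at_ tb].
  by rewrite /parameterized_integral -hu.2// addrCA subrr addr0.
move=> hc; have hc2 : {within `[a, b], continuous (fun t => u a + parameterized_integral mu a t d)}.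
  by move=> t; apply: cvgD; [exact: cvg_cst|exact: hc].
apply: (subspace_eq_continuous (f := fun t => u a + parameterized_integral mu a t d)) => // t.
by rewrite inE /= => ht; exact: (esym (hua t ht)).
Qed.

Lemma AC_measurable a b u d : AC a b u d -> measurable_fun (`[a, b] : set RT) u.
Proof. by move=> hu; apply: subspace_continuous_measurable_fun => //; exact: AC_continuous hu. Qed.

Lemma AC_L2u a b u d : AC a b u d -> L2on `[a, b] u.
Proof.
move=> hu; have [M hM] := AC_bounded hu.
apply: (L2on_bounded_itv (M := M)); first exact: AC_measurable hu.
by move=> t; rewrite in_itv/= => /andP[]; exact: hM.
Qed.

Lemma AC_lin a b k u d w e : AC a b u d -> AC a b w e ->
  AC a b (fun t => k * u t + w t) (fun t => k * d t + e t).
Proof.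
move=> hu hw; split.
  by apply: L2onD => //; [apply: L2onZ => //; case: hu|case: hw].
move=> x y ax xy yb; rewrite RintegralD//; last 2 first.
- by apply: L1onZ => //; exact: AC_L1 hu ax yb.
- exact: AC_L1 hw ax yb.
rewrite RintegralZl//; last exact: AC_L1 hu ax yb.
rewrite -hu.2// -hw.2//; ring.
Qed.

Lemma ACD a b u d w e : AC a b u d -> AC a b w e ->
  AC a b (fun t => u t + w t) (fun t => d t + e t).
Proof.
move=> hu hw; have := AC_lin 1 hu hw.
by congr (AC _ _ _ _); apply/funext => t; rewrite mul1r.
Qed.

Lemma ACB a b u d w e : AC a b u d -> AC a b w e ->
  AC a b (fun t => u t - w t) (fun t => d t - e t).
Proof.
move=> hu hw; have := AC_lin (-1) hw hu.
by congr (AC _ _ _ _); apply/funext => t; rewrite mulN1r addrC.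
Qed.

Lemma AC_cst a b k : AC a b (fun=> k) (fun=> 0).
Proof.
split; first exact: L2on0.
by move=> x y _ xy _; rewrite Rintegral_itv_cst// mul0r subrr.
Qed.

Lemma AC_eqd a b u d e : (forall t, a <= t -> t <= b -> d t = e t) -> AC a b u d -> AC a b u e.
Proof.
move=> de [hd hu]; split.
  by apply: L2on_eq hd => t /=; rewrite in_itv/= => /andP[]; exact: de.
move=> x y ax xy yb; rewrite hu//; apply: eq_Rintegral => t; rewrite inE/= in_itv/=.
by move=> /andP[xt ty]; rewrite de//; [exact: le_trans xt|exact: le_trans yb].
Qed.

Lemma AC_equ a b u w d : (forall t, a <= t -> t <= b -> u t = w t) -> AC a b u d -> AC a b w d.
Proof.
move=> uw [hd hu]; split => // x y ax xy yb.
by rewrite -!uw ?hu// ?(le_trans _ xy)// (le_trans xy).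
Qed.

(** An additive interval function bounded by length times a measure is
    smaller than any of its dyadic refinements, hence zero. *)
Lemma additive_interval_zero (E m : R -> R -> R) a b :
  (forall x y z, a <= x -> x <= y -> y <= z -> z <= b -> E x z = E x y + E y z) ->
  (forall x y z, a <= x -> x <= y -> y <= z -> z <= b -> m x z = m x y + m y z) ->
  (forall x y, a <= x -> x <= y -> y <= b -> `|E x y| <= (y - x) * m x y) ->
  forall x y, a <= x -> x <= y -> y <= b -> E x y = 0.
Proof.
move=> addE addm Em.
have key k : forall x y, a <= x -> x <= y -> y <= b -> `|E x y| <= (y - x) * m x y / 2 ^+ k.
  elim: k => [|k IH] x y ax xy yb; first by rewrite expr0 divr1; exact: Em.
  pose z := (x + y) / 2.
  have xz : x <= z by rewrite /z; lra.
  have zy : z <= y by rewrite /z; lra.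
  rewrite (addE x z y)// (le_trans (ler_normD _ _))//.
  have h1 := IH x z ax xz (le_trans zy yb).
  have h2 := IH z y (le_trans ax xz) zy yb.
  apply: (le_trans (lerD h1 h2)).
  rewrite (addm x z y)// exprS le_eqVlt; apply/orP; left; apply/eqP.
  rewrite /z; field; by rewrite expf_neq0.
move=> x y ax xy yb; apply/eqP; rewrite -normr_le0; apply/ler_addgt0Pr => eps eps0.
rewrite add0r; pose C := (y - x) * m x y.
have C0 : 0 <= C by exact: le_trans (Em x y ax xy yb).
have [k hk] : exists k : nat, C / eps <= 2 ^+ k.
  exists (Num.truncn (C / eps)).+1; apply: le_trans (ltW _) (_ : (Num.truncn (C / eps)).+1%:R <= _).
    by have /andP[] := truncn_itv (ltac:(exact: divr_ge0 C0 (ltW eps0)) : 0 <= C / eps).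
  by rewrite -natrX ler_nat ltnW// ltn_expl.
apply: le_trans (key k x y ax xy yb) _; rewrite -/C ler_pdivrMr ?exprn_gt0//.
by rewrite mulrC -ler_pdivrMr.
Qed.

(** The error of the product formula on [x, y] is at most
    [2 * int |u'| * int |w'|], which by Cauchy-Schwarz is at most
    [(y - x) * int (u'^2 + w'^2)]; additivity then forces it to vanish. *)
Lemma ACM a b u d w e : AC a b u d -> AC a b w e ->
  AC a b (fun t => u t * w t) (fun t => d t * w t + u t * e t).
Proof.
move=> hu hw.
have [Mu hMu] := AC_bounded hu; have [Mw hMw] := AC_bounded hw.
have L2p : L2on `[a, b] (fun t => d t * w t + u t * e t).
  apply: L2onD => //; last first.
    apply: (L2onM_bounded (M := Mu)) => //; [exact: AC_measurable hu| |by case: hw].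
    by move=> t /=; rewrite in_itv/= => /andP[]; exact: hMu.
  apply: L2on_eq (_ : L2on _ (fun t => w t * d t)); first by move=> t _; rewrite mulrC.
  apply: (L2onM_bounded (M := Mw)) => //; [exact: AC_measurable hw| |by case: hu].
  by move=> t /=; rewrite in_itv/= => /andP[]; exact: hMw.
have L1p x y : a <= x -> y <= b -> L1on `[x, y] (fun t => d t * w t + u t * e t).
  move=> ax yb; apply: L2on_L1on_itv; apply: L2on_sub L2p => // t /=.
  by rewrite !in_itv/= => /andP[xt ty]; rewrite (le_trans ax xt) (le_trans ty yb).
split => //.
pose E x y := u y * w y - u x * w x - \int[mu]_(t in `[x, y]) (d t * w t + u t * e t).
pose m x y := \int[mu]_(t in `[x, y]) (d t ^+ 2) + \int[mu]_(t in `[x, y]) (e t ^+ 2).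
suff E0 : forall x y, a <= x -> x <= y -> y <= b -> E x y = 0.
  by move=> x y ax xy yb; apply/eqP; rewrite -subr_eq0; apply/eqP; exact: E0.
apply: (@additive_interval_zero E m).
- move=> x y z ax xy yz zb; rewrite /E (@Rintegral_itv_split _ _ x y z)//.
    by ring.
  exact: L1p.
- move=> x y z ax xy yz zb; rewrite /m.
  rewrite (@Rintegral_itv_split _ (fun t => d t ^+ 2) x y z)//; last by case: (AC_L2 hu ax zb).
  rewrite (@Rintegral_itv_split _ (fun t => e t ^+ 2) x y z)//; last by case: (AC_L2 hw ax zb).
  by ring.
move=> x y ax xy yb.
have L1d := AC_L1 hu ax yb; have L1e := AC_L1 hw ax yb.
have L2d := AC_L2 hu ax yb; have L2e := AC_L2 hw ax yb.
set A := \int[mu]_(t in `[x, y]) `|d t|; set B := \int[mu]_(t in `[x, y]) `|e t|.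
have mxy : measurable (`[x, y]%classic : set RT) by [].
have A0 : 0 <= A by apply: Rintegral_ge0.
have B0 : 0 <= B by apply: Rintegral_ge0.
have hsub t : t \in `[x, y] -> [/\ a <= t, x <= t, t <= y & t <= b].
  by rewrite in_itv/= => /andP[xt ty]; split => //; [exact: le_trans xt|exact: le_trans yb].
have uA t : t \in `[x, y] -> `|u x - u t| <= A.
  move=> /hsub[at_ xt ty tb]; rewrite distrC; apply: le_trans (AC_norm hu ax xt tb) _.
  rewrite /A (@Rintegral_itv_split _ _ x t y)//; last exact: L1on_norm.
  by rewrite lerDl; apply: Rintegral_ge0.
have wB t : t \in `[x, y] -> `|w y - w t| <= B.
  move=> /hsub[at_ xt ty tb]; apply: le_trans (AC_norm hw at_ ty yb) _.
  rewrite /B (@Rintegral_itv_split _ _ x t y)//; last exact: L1on_norm.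
  by rewrite lerDr; apply: Rintegral_ge0.
have mu_ : measurable_fun (`[x, y] : set RT) u by exact: AC_measurable (AC_sub ax yb hu).
have mw_ : measurable_fun (`[x, y] : set RT) w by exact: AC_measurable (AC_sub ax yb hw).
have i1 : L1on `[x, y] (fun t => (w y - w t) * d t).
  by apply: (L1onM_bounded (M := B)) => //; exact: measurable_funB.
have i2 : L1on `[x, y] (fun t => (u x - u t) * e t).
  by apply: (L1onM_bounded (M := A)) => //; exact: measurable_funB.
have -> : E x y = \int[mu]_(t in `[x, y]) ((w y - w t) * d t + (u x - u t) * e t).
  rewrite /E; transitivity (w y * (u y - u x) + u x * (w y - w x)
     - \int[mu]_(t in `[x, y]) (d t * w t + u t * e t)); first by ring.
  rewrite hu.2// hw.2// -!RintegralZl// -RintegralD//; last 2 first.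
  - exact: L1onZ.
  - exact: L1onZ.
  rewrite -RintegralB//; last 2 first.
  - by apply: L1onD => //; exact: L1onZ.
  - exact: L1p.
  by apply: eq_Rintegral => t _; ring.
apply: le_trans (le_normr_Rintegral mxy (L1onD mxy i1 i2)) _.
apply: (@le_trans _ _ (\int[mu]_(t in `[x, y]) (B * `|d t| + A * `|e t|))).
  apply: le_Rintegral => //.
  - exact: (L1on_norm (L1onD mxy i1 i2)).
  - by apply: L1onD => //; apply: L1onZ => //; exact: L1on_norm.
  move=> t ht; apply: le_trans (ler_normD _ _) _.
  by rewrite !normrM lerD// ler_wpM2r// ?wB// uA.
rewrite RintegralD//; last 2 first.
- by apply: L1onZ => //; exact: L1on_norm.
- by apply: L1onZ => //; exact: L1on_norm.
rewrite !RintegralZl//; last 2 first.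
- exact: L1on_norm.
- exact: L1on_norm.
rewrite -/A -/B /m mulrDr.
have hA := integral_norm_sqr_le xy L2d; have hB := integral_norm_sqr_le xy L2e.
apply: le_trans (lerD hA hB); rewrite -/A -/B.
by have := sqr_ge0 (A - B); nra.
Qed.

Lemma continuous_L2 f a b : (forall t, a <= t -> t <= b -> {for t, continuous f}) ->
  L2on `[a, b] f.
Proof.
move=> cf; have cf' : {within `[a, b], continuous f}.
  by apply: continuous_in_subspaceT => t; rewrite inE/= in_itv/= => /andP[]; exact: cf.
have cab := @segment_compact R a b.
have hf := continuous_compact_integrable cab cf'.
split; first exact: L1on_measurable.
apply: L1on_eq (_ : L1on _ (fun t => f t * f t)); first by move=> t _; rewrite expr2.
by apply: (continuous_compact_integrable cab) => t; apply: cvgM; exact: cf'.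
Qed.

Lemma C1_AC u d a b :
  (forall t, a <= t -> t <= b -> is_derive t 1 u (d t)) ->
  (forall t, a <= t -> t <= b -> {for t, continuous d}) -> AC a b u d.
Proof.
move=> du cd; split; first exact: continuous_L2.
move=> x y ax; rewrite le_eqVlt => /orP[/eqP <- _|xy yb].
  by rewrite subrr set_itv1 Rintegral_set1.
have cu t : a <= t -> t <= b -> {for t, continuous u}.
  move=> at_ tb; apply/differentiable_continuous/derivable1_diffP.
  by have := du t at_ tb; case.
rewrite /Rintegral (@continuous_FTC2 R d u x y)//.
- apply: continuous_in_subspaceT => t; rewrite inE/= in_itv/= => /andP[xt ty].
  by apply: cd; [exact: le_trans xt|exact: le_trans yb].
- split.
  + move=> t; rewrite in_itv/= => /andP[xt ty].
    by case: (du t (le_trans ax (ltW xt)) (le_trans (ltW ty) yb)).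
  + by apply: cvg_at_right_filter; apply: cu => //; exact: le_trans (ltW xy) yb.
  + by apply: cvg_at_left_filter; apply: cu => //; exact: le_trans ax (ltW xy).
- move=> t; rewrite in_itv/= => /andP[xt ty]; rewrite derive1E.
  by have := du t (le_trans ax (ltW xt)) (le_trans (ltW ty) yb); case.
Qed.

End AbsolutelyContinuous.

(** * Decay at infinity and integrals of derivatives *)

Section SobolevReal.
Context {R : realType}.
Local Notation mu := (@lebesgue_measure R).
Local Notation RT := (measurableTypeR R).
Implicit Types (f g h u w d e : R -> R) (D : set RT) (a b x y z : R).

Lemma Rintegral_exhaust (A : nat -> set RT) D f : measurable D ->
  (forall n, measurable (A n)) -> (forall n, A n `<=` D) ->
  (forall x, D x -> exists N, forall n, (N <= n)%N -> A n x) -> L1on D f ->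
  (fun n => \int[mu]_(x in A n) f x) @ \oo --> \int[mu]_(x in D) f x.
Proof.
move=> mD mA AD exA hf.
have mf : measurable_fun D f by exact: L1on_measurable.
have [] := @dominated_convergence _ _ _ mu D mD (fun n x => ((f \_ (A n)) x)%:E)
    (EFin \o f) (EFin \o (Num.norm \o f)).
- move=> n; apply/measurable_EFinP; apply/(measurable_restrict _ (mA n) mD).
  by apply: measurable_funS mf => // x [].
- exact/measurable_EFinP.
- apply: aeW => x Dx; have [N hN] := exA x Dx.
  apply: cvg_near_cst; exists N => // n /= Nn.
  by rewrite patchE mem_set//; exact: hN.
- exact: L1on_norm.
- apply: aeW => x n Dx /=; rewrite lee_fin patchE.
  by case: ifPn => //; rewrite normr0.
move=> _ _ h.
have e n : \int[mu]_(x in A n) f x = fine (\int[mu]_(x in D) ((f \_ (A n)) x)%:E).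
  have := Rintegral_mkcondr mu D (A n) f; rewrite setIC.
  by rewrite (setIidl (AD n)).
under eq_fun do rewrite e.
by apply: fine_cvg; rewrite /Rintegral fineK//; exact: integrable_fin_num.
Qed.

Lemma ACR_continuous u d : ACR u d -> continuous u.
Proof.
move=> hu x; have xx : x - 1 < x + 1 by lra.
have /(continuous_within_itvP _ xx)[h _ _] := AC_continuous (hu (x - 1) (x + 1)).
by apply: h; rewrite in_itv/=; apply/andP; split; lra.
Qed.

Lemma measurable_funTP f : measurable_fun [set: RT] f <->
  forall a b, measurable_fun (`[a, b] : set RT) f.
Proof.
split=> [mf a b|mf]; first exact: measurable_funS mf.
have -> : [set: RT] = \bigcup_n (`[- n%:R, n%:R]%classic : set RT).
  apply/seteqP; split => // x _; exists (Num.truncn `|x|).+1 => //=.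
  rewrite in_itv/= -ler_norml ltW//.
  by have /andP[] := truncn_itv (normr_ge0 x).
by apply/measurable_fun_bigcup => // n; exact: mf.
Qed.

Lemma ACR_measurabled u d : ACR u d -> measurable_fun [set: RT] d.
Proof. by move=> hu; apply/measurable_funTP => a b; case: (hu a b) => -[]. Qed.

Lemma continuous_measurable f : continuous f -> measurable_fun [set: RT] f.
Proof. exact: continuous_measurable_fun. Qed.

(** The continuous representative of a real H1 function, with a derivative. *)
Definition rH1 u d := [/\ L2on setT u, L2on setT d & ACR u d].

Lemma Rintegral_subset_le D (E : set RT) f : measurable D -> measurable E -> E `<=` D ->
  L1on D f -> (forall x, 0 <= f x) ->
  \int[mu]_(x in E) f x <= \int[mu]_(x in D) f x.
Proof.
move=> mD mE ED hf f0; rewrite fine_le//.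
- by apply: integrable_fin_num => //; exact: (L1on_sub mD).
- exact: integrable_fin_num.
- apply: ge0_subset_integral => //; first exact: (measurable_int mu).
  by move=> x _; rewrite lee_fin.
Qed.

(** On a unit interval the value at one point is controlled by averaging the
    increments from that point. *)
Lemma AC_point_bound x u d t : AC x (x + 1) u d -> x <= t -> t <= x + 1 ->
  u t ^+ 2 <= 2 * \int[mu]_(s in `[x, x + 1]) (u s ^+ 2)
            + 2 * \int[mu]_(s in `[x, x + 1]) (d s ^+ 2).
Proof.
move=> hu xt t1.
set I := \int[mu]_(s in `[x, x + 1]) (d s ^+ 2).
have x1 : x <= x + 1 by lra.
have I0 : 0 <= I by apply: Rintegral_ge0 => s _; exact: sqr_ge0.
have ptw s : s \in `[x, x + 1] -> u t ^+ 2 <= 2 * u s ^+ 2 + 2 * I.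
  rewrite in_itv/= => /andP[xs s1].
  have h : (u t - u s) ^+ 2 <= I.
    have [ts|/ltW st] := leP t s.
      have := AC_holder_ab hu xt ts s1; rewrite -/I -sqrrN opprB => /le_trans; apply.
      by rewrite -[leRHS]mul1r ler_wpM2r//; lra.
    have := AC_holder_ab hu xs st t1; rewrite -/I => /le_trans; apply.
    by rewrite -[leRHS]mul1r ler_wpM2r//; lra.
  have := sqr_ge0 (u s - (u t - u s)); nra.
have [mu2 iu2] := AC_L2u hu.
have : \int[mu]_(s in `[x, x + 1]) (u t ^+ 2) <= \int[mu]_(s in `[x, x + 1]) (2 * u s ^+ 2 + 2 * I).
  apply: le_Rintegral => //.
  - by apply: L2on_L1on_itv; apply: (L2on_bounded_itv (M := `|u t ^+ 2|)).
  - apply: L1onD => //; first exact: L1onZ.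
    by apply: L2on_L1on_itv; apply: (L2on_bounded_itv (M := `|2 * I|)).
rewrite RintegralD//; last 2 first.
- exact: L1onZ.
- by apply: L2on_L1on_itv; apply: (L2on_bounded_itv (M := `|2 * I|)).
rewrite [X in _ <= X + _ -> _]RintegralZl//.
rewrite !Rintegral_itv_cst//; have -> : x + 1 - x = 1 by ring.
by rewrite !mulr1.
Qed.

Lemma rH1_point_bound u d x : rH1 u d ->
  u x ^+ 2 <= 2 * \int[mu]_s (u s ^+ 2) + 2 * \int[mu]_s (d s ^+ 2).
Proof.
move=> [[_ hu] [_ hd] hud].
apply: le_trans (AC_point_bound (hud x (x + 1)) (lexx x) _) _; first by lra.
by apply: lerD; rewrite ler_pM2l//; apply: Rintegral_subset_le => // s; exact: sqr_ge0.
Qed.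

Lemma Rintegral_vanish (A : nat -> set RT) f : (forall n, measurable (A n)) ->
  (forall x, exists N, forall n, (N <= n)%N -> ~ A n x) -> L1on setT f ->
  (fun n => \int[mu]_(x in A n) f x) @ \oo --> (0 : R).
Proof.
move=> mA exA hf.
have mf : measurable_fun setT f by exact: L1on_measurable.
have [] := @dominated_convergence _ _ _ mu setT measurableT
    (fun n x => ((f \_ (A n)) x)%:E) (cst 0%E) (EFin \o (Num.norm \o f)).
- move=> n; apply/measurable_EFinP; apply/(measurable_restrict _ (mA n) measurableT).
  by apply: measurable_funS mf.
- exact: measurable_cst.
- apply: aeW => x _; have [N hN] := exA x.
  apply: cvg_near_cst; exists N => // n /= Nn.
  by rewrite patchE memNset//; exact: hN.
- exact: L1on_norm.
- apply: aeW => x n _ /=; rewrite lee_fin patchE.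
  by case: ifPn => //; rewrite normr0.
move=> _ _ h.
have e n : \int[mu]_(x in A n) f x = fine (\int[mu]_x ((f \_ (A n)) x)%:E).
  by rewrite Rintegral_mkcond.
under eq_fun do rewrite e.
by rewrite integral0 in h; exact: (fine_cvg h).
Qed.

Lemma two_quarters (p q e : R) : `|p| <= e / 4 -> `|q| <= e / 4 -> 2 * p + 2 * q <= e.
Proof. have := ler_norm p; have := ler_norm q; lra. Qed.

(** Finite energy on unit intervals far out tends to zero, and it controls the
    values at the end points. *)
Lemma rH1_cvgy u d : rH1 u d -> (fun n => u n%:R) @ \oo --> (0 : R).
Proof.
move=> [[_ hu] [_ hd] hud].
pose A n : set RT := `[n%:R, n%:R + 1]%classic.
have hA x : exists N, forall n, (N <= n)%N -> ~ A n x.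
  exists (Num.truncn `|x|).+1 => n Nn; rewrite /A /= in_itv/= => /andP[nx _].
  have /andP[_ h] := truncn_itv (normr_ge0 x).
  have h2 : (Num.truncn `|x|).+1%:R <= n%:R :> R by rewrite ler_nat.
  have := lt_le_trans h h2; rewrite ltNge; apply/negP; rewrite negbK.
  by apply: le_trans nx _; exact: ler_norm.
have mA n : measurable (A n) by exact: measurable_itv.
have cu := Rintegral_vanish mA hA hu.
have cd := Rintegral_vanish mA hA hd.
apply/cvgr0Pnorm_le => eps eps0.
have e2 : 0 < eps ^+ 2 / 4 by rewrite divr_gt0// exprn_gt0.
move/cvgr0Pnorm_le : cu => /(_ _ e2) cu; move/cvgr0Pnorm_le : cd => /(_ _ e2) cd.
near=> n.
have h1 : `|\int[mu]_(x in A n) (u x ^+ 2)| <= eps ^+ 2 / 4 by near: n.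
have h2 : `|\int[mu]_(x in A n) (d x ^+ 2)| <= eps ^+ 2 / 4 by near: n.
have n1 : n%:R <= n%:R + 1 :> R by rewrite lerDl.
have := AC_point_bound (hud n%:R (n%:R + 1)) (lexx _) n1.
move=> h3; rewrite -(@ler_pXn2r _ 2) ?nnegrE ?(ltW eps0)// real_normK ?num_real//.
by apply: le_trans h3 _; exact: two_quarters.
Unshelve. all: by end_near. Qed.

Lemma rH1_cvgNy u d : rH1 u d -> (fun n => u (- n%:R)) @ \oo --> (0 : R).
Proof.
move=> [[_ hu] [_ hd] hud].
pose A n : set RT := `[- n%:R, - n%:R + 1]%classic.
have hA x : exists N, forall n, (N <= n)%N -> ~ A n x.
  exists (Num.truncn `|x|).+2 => n Nn; rewrite /A /= in_itv/= => /andP[_ nx].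
  have /andP[_ h] := truncn_itv (normr_ge0 x).
  have h2 : (Num.truncn `|x|).+2%:R <= n%:R :> R by rewrite ler_nat.
  move: h2; rewrite -natr1 => h2.
  have := lerNnormlW (lexx `|x|); move: h h2 nx; clear.
  move: ((Num.truncn `|x|).+1%:R : R) (n%:R : R) => p q; lra.
have mA n : measurable (A n) by exact: measurable_itv.
have cu := Rintegral_vanish mA hA hu.
have cd := Rintegral_vanish mA hA hd.
apply/cvgr0Pnorm_le => eps eps0.
have e2 : 0 < eps ^+ 2 / 4 by rewrite divr_gt0// exprn_gt0.
move/cvgr0Pnorm_le : cu => /(_ _ e2) cu; move/cvgr0Pnorm_le : cd => /(_ _ e2) cd.
near=> n.
have h1 : `|\int[mu]_(x in A n) (u x ^+ 2)| <= eps ^+ 2 / 4 by near: n.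
have h2 : `|\int[mu]_(x in A n) (d x ^+ 2)| <= eps ^+ 2 / 4 by near: n.
have n1 : - n%:R <= - n%:R + 1 :> R by rewrite lerDl.
have := AC_point_bound (hud (- n%:R) (- n%:R + 1)) (lexx _) n1.
move=> h3; rewrite -(@ler_pXn2r _ 2) ?nnegrE ?(ltW eps0)// real_normK ?num_real//.
by apply: le_trans h3 _; exact: two_quarters.
Unshelve. all: by end_near. Qed.

Lemma truncnS_gt x : x < (Num.truncn `|x|).+1%:R.
Proof.
by have /andP[_] := truncn_itv (normr_ge0 x); apply: le_lt_trans; exact: ler_norm.
Qed.

Lemma Rintegral_derivative_half T d : (forall b, AC 0 b T d) -> L1on `[0, +oo[ d ->
  (fun n => T n%:R) @ \oo --> (0 : R) -> \int[mu]_(x in `[0, +oo[) d x = - T 0.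
Proof.
move=> hT hd T0.
have h : (fun n => \int[mu]_(x in `[0, n%:R]) d x) @ \oo --> \int[mu]_(x in `[0, +oo[) d x.
  apply: (@Rintegral_exhaust (fun n => `[0, n%:R]%classic)) => //.
    by move=> n x /=; rewrite !in_itv/= => /andP[->].
  move=> x /=; rewrite in_itv/= andbT => x0; exists (Num.truncn `|x|).+1 => n hn.
  rewrite in_itv/= x0/= (le_trans (ltW (truncnS_gt x)))// ler_nat//.
have h2 : (fun n => \int[mu]_(x in `[0, n%:R]) d x) @ \oo --> 0 - T 0.
  have -> : (fun n => \int[mu]_(x in `[0, n%:R]) d x) = (fun n => T n%:R - T 0).
    by apply/funext => n; rewrite (hT n%:R).2.
  by apply: cvgB => //; exact: cvg_cst.
by rewrite -(cvg_lim _ h)// (cvg_lim _ h2)// sub0r.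
Qed.

Lemma Rintegral_derivative T d : ACR T d -> L1on setT d ->
  (fun n => T n%:R) @ \oo --> (0 : R) -> (fun n => T (- n%:R)) @ \oo --> (0 : R) ->
  \int[mu]_x d x = 0.
Proof.
move=> hT hd T0 T1.
have h : (fun n => \int[mu]_(x in `[- n%:R, n%:R]) d x) @ \oo --> \int[mu]_x d x.
  apply: (@Rintegral_exhaust (fun n => `[- n%:R, n%:R]%classic)) => //.
  move=> x _; exists (Num.truncn `|x|).+1 => n hn.
  rewrite /= in_itv/= -ler_norml -[`|x|]normr_id.
  by rewrite normr_id (le_trans (ltW _) (_ : (Num.truncn `|x|).+1%:R <= _)) ?ler_nat//;
     have /andP[] := truncn_itv (normr_ge0 x).
have h2 : (fun n => \int[mu]_(x in `[- n%:R, n%:R]) d x) @ \oo --> (0 - 0 : R).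
  have -> : (fun n => \int[mu]_(x in `[- n%:R, n%:R]) d x) = (fun n => T n%:R - T (- n%:R)).
    apply/funext => n; rewrite (hT (- n%:R) n%:R).2//.
    by rewrite ge0_cp// ler0n.
  by apply: cvgB.
by rewrite -(cvg_lim _ h)// (cvg_lim _ h2)// sub0r oppr0.
Qed.

End SobolevReal.

(** * Weak derivatives of real functions *)

Section WeakDerivativeReal.
Context {R : realType}.
Local Notation mu := (@lebesgue_measure R).
Local Notation RT := (measurableTypeR R).
Implicit Types (f g h u w d e t : R -> R) (D : set RT) (a b x y z : R).

Definition rweak u g := forall t, test_function t ->
  \int[mu]_x (u x * derive1 t x) = - \int[mu]_x (g x * t x).

Lemma measurable_cut M : measurable (`[- M, M]%classic : set RT).
Proof. exact: measurable_itv. Qed.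

Lemma L1on_compact_support f M : (forall x, M <= `|x| -> f x = 0) ->
  L1on `[- M, M] f -> L1on setT f.
Proof.
move=> f0 hf; have := proj1 (@integrable_mkcond _ _ _ mu _ (EFin \o f) (measurable_cut M)) hf.
apply: (@eq_integrable _ _ _ mu setT measurableT) => x _.
rewrite /= patchE; case: ifPn => //; rewrite notin_setE/= in_itv/= -ler_norml => /negP.
by rewrite -ltNge => /ltW /f0 ->.
Qed.

Lemma test_AC t : test_function t -> ACR t (derive1 t).
Proof.
move=> [dt ct _] a b; apply: C1_AC => x _ _; last exact: ct.
by rewrite derive1E; exact/derivableP.
Qed.

Lemma test_support t : test_function t ->
  exists M, forall x, M <= `|x| -> t x = 0 /\ derive1 t x = 0.
Proof.
move=> [dt ct [M hM]]; exists (M + 1) => x Mx; split; first by apply: hM; lra.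
have e : \forall y \near x, t y = 0.
  exists 1 => //= y; rewrite /ball_/= => xy; apply: hM.
  have := lerB_dist x y; lra.
rewrite derive1E (near_eq_derive (g := cst 0)) ?derive_cst//.
Qed.

Lemma test_integrable f t : (forall a b, L2on `[a, b] f) -> test_function t ->
  L1on setT (fun x => f x * t x) /\ L1on setT (fun x => f x * derive1 t x).
Proof.
move=> hf ht; have [M hM] := test_support ht; have ACt := test_AC ht.
split; apply: (@L1on_compact_support _ M).
- by move=> x /hM[-> _]; rewrite mulr0.
- by apply: L2onM => //; exact: (AC_L2u (ACt _ _)).
- by move=> x /hM[_ ->]; rewrite mulr0.
- by apply: L2onM => //; case: (ACt (- M) M).
Qed.

Lemma cvg_compact_support T M : (forall x, M <= `|x| -> T x = 0) ->
  (fun n => T n%:R) @ \oo --> (0 : R) /\ (fun n => T (- n%:R)) @ \oo --> (0 : R).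
Proof.
move=> hT; have hn n : ((Num.truncn `|M|).+1 <= n)%N -> M <= n%:R.
  move=> hn; apply: le_trans (ltW (truncnS_gt M)) _; by rewrite ler_nat.
split; apply: cvg_near_cst; exists (Num.truncn `|M|).+1 => // n /= /hn Mn; apply: hT.
  by rewrite ger0_norm.
by rewrite normrN ger0_norm.
Qed.

Lemma ACR_weak u d : ACR u d -> rweak u d.
Proof.
move=> hu t ht; have [M hM] := test_support ht; have ACt := test_AC ht.
have [i1 _] := test_integrable (fun a b => (hu a b).1) ht.
have [_ i2] := test_integrable (fun a b => AC_L2u (hu a b)) ht.
have hT : ACR (fun x => u x * t x) (fun x => d x * t x + u x * derive1 t x).
  by move=> a b; exact: ACM.
have hc x : M <= `|x| -> u x * t x = 0 by move=> /hM[-> _]; rewrite mulr0.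
have [c1 c2] := cvg_compact_support hc.
have := Rintegral_derivative hT (L1onD measurableT i1 i2) c1 c2.
rewrite RintegralD// => /eqP; rewrite addrC addr_eq0 => /eqP //.
Qed.

Lemma ae_open_nonempty (P : RT -> Prop) a b : a < b -> {ae mu, forall x, P x} ->
  exists2 x, a < x < b & P x.
Proof.
move=> ab [N [mN N0 PN]]; apply: contrapT => h.
have sub : (`]a, b[%classic : set RT) `<=` N.
  move=> x; rewrite /= in_itv/= => xab; apply: PN => /= Px; apply: h; by exists x.
have : (mu (`]a, b[%classic : set RT) <= mu N)%E by apply: le_measure => //; rewrite inE.
rewrite N0 lebesgue_measure_itv/= lte_fin ab -EFinD lee_fin; lra.
Qed.

Lemma ae_eq_continuous u w : continuous u -> continuous w ->
  {ae mu, forall x : RT, u x = w x} -> forall x, u x = w x.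
Proof.
move=> cu cw uw x; apply/eqP; rewrite -subr_eq0 -normr_le0; apply/ler_addgt0Pr => eps eps0.
rewrite add0r; have c : {for x, continuous (fun y => u y - w y)} by apply: cvgB; [exact: cu|exact: cw].
move/cvgrPdist_le : c => /(_ _ eps0)[r /= r0 hr].
have [|y /andP[xy yx] e] := @ae_open_nonempty _ x (x + r) _ uw; first by rewrite ltrDl.
have := hr y; rewrite /ball_/= ltr0_norm ?subr_lt0// => /(_ ltac:(lra)).
by rewrite e subrr subr0.
Qed.

Lemma L2loc_locally_integrable f : (forall a b, L2on `[a, b] f) -> locally_integrable setT f.
Proof.
move=> hf; split; [|exact: openT|].
  by apply/measurable_funTP => a b; case: (hf a b).
move=> K _ cK; have [M [_ hM]] := compact_bounded cK.
pose N := `|M| + 1.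
have KN : K `<=` `[- N, N]%classic.
  move=> x Kx; rewrite /= in_itv/= -ler_norml; apply: (hM N) => //.
  by rewrite /N; have := ler_norm M; lra.
have /integrableP[mf] := L2on_L1on_itv (hf (- N) N).
apply: le_lt_trans; apply: ge0_subset_integral.
- by apply: compact_measurable.
- exact: measurable_itv.
- by do 2 apply: measurableT_comp => //; exact/measurable_EFinP.
- by move=> x _; rewrite lee_fin.
- exact: KN.
Qed.

Lemma zero_integrals_ae0 d : (forall a b, L2on `[a, b] d) ->
  (forall x y, x <= y -> \int[mu]_(s in `[x, y]) d s = 0) -> {ae mu, forall x : RT, d x = 0}.
Proof.
move=> hd d0; have := lebesgue_differentiation (L2loc_locally_integrable hd).
apply: aeS => x hx.
have := @FTC1_lebesgue_pt R d (BLeft (x - 1)) x (x + 1) (ltac:(by rewrite ltrDl)).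
have -> : (fun y => \int[mu]_(s in [set` Interval (BLeft (x - 1)) (BRight y)]) d s) = cst 0.
  apply/funext => y; have [xy|yx] := leP (x - 1) y; first exact: d0.
  by rewrite set_itv_ge ?Rintegral_set0// bnd_simp -ltNge.
have xb : (BLeft (x - 1)%R < BRight x)%E.
  by rewrite (@lte_fin R) ltrBlDr ltrDl.
move=> /(_ (L2on_L1on_itv (hd _ _)) xb hx) [_ <-].
by rewrite derive1_cst.
Qed.

Lemma ACR_unique u d w e : ACR u d -> ACR w e -> {ae mu, forall x : RT, u x = w x} ->
  u = w /\ {ae mu, forall x : RT, d x = e x}.
Proof.
move=> hu hw uw.
have e1 : u = w.
  by apply/funext; apply: ae_eq_continuous uw; [exact: ACR_continuous hu|exact: ACR_continuous hw].
split => //; subst w.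
have hz : ACR (fun x => u x - u x) (fun x => d x - e x) by move=> a b; exact: ACB.
have h0 x y : x <= y -> \int[mu]_(s in `[x, y]) (d s - e s) = 0.
  move=> xy; have := (hz x y).2 x y (lexx _) xy (lexx _).
  by rewrite !subrr.
have := @zero_integrals_ae0 (fun x => d x - e x) (fun a b => proj1 (hz a b)) h0.
by apply: aeS => x /eqP; rewrite subr_eq0 => /eqP.
Qed.

(** The primitive [ramp] of this function is a C^1 step; differences of rescaled steps are the test
    functions that compare averages around two points. *)
Definition hat x := Num.max 0 (1 - `|x|).

Lemma hat_ge0 x : 0 <= hat x.
Proof. by rewrite /hat le_max lexx. Qed.

Lemma hat_le1 x : hat x <= 1.
Proof. by rewrite /hat ge_max ler01/=; have := normr_ge0 x; lra. Qed.

Lemma hat0 x : 1 <= `|x| -> hat x = 0.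
Proof. by move=> x1; rewrite /hat max_l//; lra. Qed.

Lemma hat_continuous : continuous hat.
Proof.
move=> x.
have c0 : {for x, continuous (fun=> 0 : R^o)} by exact: cvg_cst.
have c1 : {for x, continuous (fun y => 1 - `|y| : R^o)}.
  by apply: cvgB; [exact: cvg_cst|exact: norm_continuous].
exact: (continuous_max c0 c1).
Qed.

Lemma hat_L1 : L1on setT hat.
Proof.
apply: (@L1on_compact_support _ 1); first exact: hat0.
by apply: L2on_L1on_itv; apply: continuous_L2 => x _ _; exact: hat_continuous.
Qed.

Definition ramp x := \int[mu]_(s in `]-oo, x]) hat s.

Lemma ramp_derive x : is_derive x 1 ramp (hat x).
Proof.
have hL : L1on `]-oo, x + 1] hat by exact: L1on_sub hat_L1.
have [h1 h2] := @continuous_FTC1 R hat -oo%O x (x + 1) (ltac:(by rewrite ltrDl)) hL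
  (ltac:(by rewrite ltNyr)) (@hat_continuous x).
by split; [exact: h1|rewrite -derive1E; exact: h2].
Qed.

Lemma ramp_cst_left x : x <= - 1 -> ramp x = 0.
Proof.
move=> x1; rewrite /ramp (@eq_Rintegral _ _ _ mu _ (cst 0)).
  by rewrite /Rintegral integral0.
move=> s; rewrite inE/= in_itv/= => sx; rewrite hat0//.
by have := lerNnormlW (lexx `|s|); lra.
Qed.

Lemma ramp_AC : ACR ramp hat.
Proof.
by move=> a b; apply: C1_AC => x _ _; [exact: ramp_derive|exact: hat_continuous].
Qed.

Lemma ramp_cst_right x : 1 <= x -> ramp x = ramp 1.
Proof.
move=> x1; apply/eqP; rewrite -subr_eq0 (ramp_AC 1 x).2//.
rewrite (@eq_Rintegral _ _ _ mu _ (cst 0)).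
  by rewrite /Rintegral integral0.
move=> s; rewrite inE/= in_itv/= => /andP[s1 _]; rewrite hat0//.
by apply: le_trans s1 _; exact: ler_norm.
Qed.

Lemma ramp1_gt0 : 0 < ramp 1.
Proof.
have h : (\int[mu]_(s in `[- 2^-1, 2^-1]) 2^-1 : R) <= \int[mu]_(s in `[- 2^-1, 2^-1]) hat s.
  apply: le_Rintegral => //.
  - by apply: L2on_L1on_itv; apply: (L2on_bounded_itv (M := `|2^-1|)).
  - exact: L1on_sub hat_L1.
  move=> s /=; rewrite in_itv/= -ler_norml => hs.
  by rewrite /hat le_max; apply/orP; right; lra.
rewrite Rintegral_itv_cst in h; last by lra.
have h2 : \int[mu]_(s in `[- 2^-1, 2^-1]) hat s <= \int[mu]_(s in `]-oo, 1]) hat s.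
  apply: Rintegral_subset_le => //.
  - by move=> s /=; rewrite !in_itv/= => /andP[_ ?]; lra.
  - exact: L1on_sub hat_L1.
  - exact: hat_ge0.
rewrite /ramp; lra.
Qed.

End WeakDerivativeReal.

(** * The du Bois-Reymond lemma *)

Section DuBoisReymond.
Context {R : realType}.
Local Notation mu := (@lebesgue_measure R).
Local Notation RT := (measurableTypeR R).
Implicit Types (f g h u w d t : R -> R) (D : set RT) (a b x y z : R).

Definition bump a e x : R := e^-1 * hat ((x - a) / e).

Lemma bump_ramp a e x : is_derive x 1 (fun s => ramp ((s - a) / e)) (bump a e x).
Proof.
have h : is_derive x 1 (fun s : R => (s - a) / e) e^-1.
  by apply: is_derive_eq; rewrite scaler0 add0r subr0 /GRing.scale/= mulr1.
have := @is_derive1_comp R (@ramp R) (fun s => (s - a) / e) x _ _ (ramp_derive _) h.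
by rewrite /bump /= mulrC.
Qed.

Lemma bump_continuous a e : continuous (bump a e).
Proof.
move=> x; apply: cvgM; first exact: cvg_cst.
apply: (@continuous_comp _ _ _ (fun s : R => (s - a) / e) hat); last exact: hat_continuous.
by apply: cvgM; [apply: cvgB; [exact: cvg_id|exact: cvg_cst]|exact: cvg_cst].
Qed.

Lemma bump_AC a e : ACR (fun s => ramp ((s - a) / e)) (bump a e).
Proof.
by move=> x y; apply: C1_AC => s _ _; [exact: bump_ramp|exact: bump_continuous].
Qed.

Lemma bump_ge0 a e x : 0 < e -> 0 <= bump a e x.
Proof. by move=> e0; rewrite /bump mulr_ge0 ?hat_ge0// invr_ge0 ltW. Qed.

Lemma bump_le a e x : 0 < e -> bump a e x <= e^-1.
Proof. by move=> e0; rewrite /bump -[leRHS]mulr1 ler_pM2l ?invr_gt0// hat_le1. Qed.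

Lemma bump_integral a e : 0 < e -> \int[mu]_(s in `[a - e, a + e]) bump a e s = ramp 1.
Proof.
move=> e0; rewrite -((bump_AC a e) (a - e) (a + e)).2//; last by lra.
have -> : (a + e - a) / e = 1 by field; rewrite gt_eqF.
have -> : (a - e - a) / e = -1 by field; rewrite gt_eqF.
by rewrite (@ramp_cst_left _ (-1)) ?lexx// subr0.
Qed.

Lemma Rintegral_bump f a e : 0 < e ->
  \int[mu]_s (f s * bump a e s) = \int[mu]_(s in `[a - e, a + e]) (f s * bump a e s).
Proof.
move=> e0; rewrite [RHS]Rintegral_mkcond; apply: eq_Rintegral => s _.
rewrite patchE; case: ifPn => //; rewrite notin_setE/= in_itv/= => /negP h.
rewrite /bump hat0 ?mulr0// normrM normfV (gtr0_norm e0) ler_pdivlMr// mul1r.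
by rewrite leNgt; apply: contra h; rewrite ltr_norml => /andP[h1 h2]; apply/andP; split; lra.
Qed.

(** At a Lebesgue point the bumps are an approximate identity of mass [ramp 1]. *)
Lemma lebesgue_pt_bump w a dl : (forall x y, L2on `[x, y] w) -> lebesgue_pt w a -> 0 < dl ->
  \forall e \near 0^'+, `|\int[mu]_s (w s * bump a e s) - w a * ramp 1| <= dl.
Proof.
move=> hw /fine_cvgP[finw cvw] dl0.
move/cvgr0Pnorm_le : cvw => /(_ (dl / 2) (ltac:(by rewrite divr_gt0))) cvw.
near=> e.
have e0 : 0 < e by near: e; exact: nbhs_right_gt.
have fe : davg w a e \is a fin_num by near: e.
have ve : `|fine (davg w a e)| <= dl / 2 by near: e.
have mI : measurable (`[a - e, a + e]%classic : set RT) by exact: measurable_itv.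
have L2w : L2on `[a - e, a + e] (fun s => w s - w a).
  by apply: L2onB => //; apply: (L2on_bounded_itv (M := `|w a|)).
have L2b : L2on `[a - e, a + e] (bump a e) by case: (bump_AC a e (a - e) (a + e)).
have L1n : L1on `[a - e, a + e] (fun s => `|w s - w a|).
  by apply: L1on_norm; exact: L2on_L1on_itv.
have hI : \int[mu]_(s in `[a - e, a + e]) `|w s - w a| <= dl * e.
  have h1 : \int[mu]_(s in `]a - e, a + e[) `|w s - w a| = 2 * e * fine (davg w a e).
    rewrite /davg /iavg lebesgue_measure_ball ?ltW//.
    rewrite ball_itv inver mulrn_eq0/= gt_eqF// fineM//; last 1 first.
    - rewrite ge0_fin_numE; last by apply: integral_ge0 => s _; rewrite lee_fin.
      have /integrableP[_] : L1on `]a - e, a + e[ (fun s => w s - w a).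
        apply: L1on_sub (L2on_L1on_itv L2w) => // s /=; rewrite !in_itv/= => /andP[? ?].
        by rewrite !ltW.
      by [].
    rewrite /= mulrA -[e *+ 2]mulr_natl mulfV ?mul1r//.
    by rewrite mulf_neq0// gt_eqF.
  rewrite -Rintegral_itv_obnd_cbnd; last first.
    by apply: L1on_sub L1n => // s /=; rewrite !in_itv/= => /andP[h1' ->]; rewrite ltW.
  rewrite -Rintegral_itv_bndo_bndc; last first.
    by apply: L1on_sub L1n => // s /=; rewrite !in_itv/= => /andP[h1' h2]; rewrite !ltW.
  rewrite h1; have := ler_norm (fine (davg w a e)); nra.
rewrite Rintegral_bump// -(bump_integral a e0) -RintegralZl//; last exact: L2on_L1on_itv.
rewrite -RintegralB//; last 2 first.
- exact: L2onM.
- by apply: L1onZ => //; exact: L2on_L1on_itv.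
rewrite (@eq_Rintegral _ _ _ mu _ (fun s => (w s - w a) * bump a e s)); last by move=> s _; ring.
apply: le_trans (le_normr_Rintegral mI (L2onM mI L2w L2b)) _.
apply: (@le_trans _ _ (\int[mu]_(s in `[a - e, a + e]) (e^-1 * `|w s - w a|))).
  apply: le_Rintegral => //.
  - by apply: L1on_norm; exact: L2onM.
  - exact: L1onZ.
  move=> s _; rewrite normrM mulrC ler_wpM2r// ger0_norm ?bump_ge0//.
  exact: bump_le.
rewrite RintegralZl// mulrC ler_pdivrMr//.
Unshelve. all: by end_near. Qed.

Lemma bump_test a b e : 0 < e ->
  test_function (fun s => ramp ((s - a) / e) - ramp ((s - b) / e)) /\
  derive1 (fun s => ramp ((s - a) / e) - ramp ((s - b) / e)) =
    (fun s => bump a e s - bump b e s).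
Proof.
move=> e0.
have d x : is_derive x 1 (fun s => ramp ((s - a) / e) - ramp ((s - b) / e))
    (bump a e x - bump b e x).
  by apply: is_deriveB; exact: bump_ramp.
have dE : derive1 (fun s => ramp ((s - a) / e) - ramp ((s - b) / e)) =
    (fun s => bump a e s - bump b e s).
  by apply/funext => x; rewrite derive1E; exact: (@derive_val _ _ _ _ _ _ _ (d x)).
split => //; split.
- by move=> x; have [] := d x.
- by rewrite dE => x; apply: cvgB; exact: bump_continuous.
exists (`|a| + `|b| + e) => x.
have na := ler_norm a; have nb := ler_norm b.
have na' := lerNnormlW (lexx `|a|); have nb' := lerNnormlW (lexx `|b|).
have [x0|x0] := leP 0 x.
  rewrite (ger0_norm x0) => h.
  have ha : 1 <= (x - a) / e by rewrite ler_pdivlMr// mul1r; lra.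
  have hb : 1 <= (x - b) / e by rewrite ler_pdivlMr// mul1r; lra.
  by rewrite !ramp_cst_right// subrr.
rewrite (ltr0_norm x0) => h.
have ha : (x - a) / e <= -1 by rewrite ler_pdivrMr// mulN1r; lra.
have hb : (x - b) / e <= -1 by rewrite ler_pdivrMr// mulN1r; lra.
by rewrite !ramp_cst_left// subrr.
Qed.

(** Testing against the difference of two ramps compares the averages of [w]
    around two points; at Lebesgue points the averages converge to the values. *)
Lemma weak_constant w : (forall x y, L2on `[x, y] w) ->
  (forall t, test_function t -> \int[mu]_x (w x * derive1 t x) = 0) ->
  exists k, {ae mu, forall x : RT, w x = k}.
Proof.
move=> hw wt; have lw := lebesgue_differentiation (L2loc_locally_integrable hw).
have [a _ ha] := ae_open_nonempty (@ltr01 R) lw.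
exists (w a); apply: aeS lw => b hb.
apply/eqP; rewrite -subr_eq0 -normr_le0; apply/ler_addgt0Pr => eps eps0; rewrite add0r.
have r0 := @ramp1_gt0 R.
have d0 : 0 < eps * ramp 1 / 2 by rewrite divr_gt0// mulr_gt0.
near (0:R)^'+ => e.
have e0 : 0 < e by near: e; exact: nbhs_right_gt.
have h1 : `|\int[mu]_s (w s * bump a e s) - w a * ramp 1| <= eps * ramp 1 / 2.
  by near: e; exact: lebesgue_pt_bump.
have h2 : `|\int[mu]_s (w s * bump b e s) - w b * ramp 1| <= eps * ramp 1 / 2.
  by near: e; exact: lebesgue_pt_bump.
have [ht tE] := bump_test a b e0.
have ib c : L1on setT (fun s => w s * bump c e s).
  apply: (@L1on_compact_support _ _ (`|c| + e)).
    move=> x cx; rewrite /bump hat0 ?mulr0// normrM normfV (gtr0_norm e0) ler_pdivlMr// mul1r.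
    have := lerB_dist x c; lra.
  by apply: L2onM => //; case: (bump_AC c e (- (`|c| + e)) (`|c| + e)).
have := wt _ ht; rewrite tE.
rewrite (@eq_Rintegral _ _ _ mu _ (fun s => w s * bump a e s - w s * bump b e s)); last by move=> s _; ring.
rewrite (RintegralB measurableT (ib a) (ib b)) => /eqP; rewrite subr_eq0 => /eqP ee; rewrite ee in h1.
rewrite -(ler_pM2r r0) -{1}(gtr0_norm r0) -normrM mulrBl.
have -> : w b * ramp 1 - w a * ramp 1 =
  (\int[mu]_s (w s * bump b e s) - w a * ramp 1) - (\int[mu]_s (w s * bump b e s) - w b * ramp 1).
  by ring.
apply: le_trans (ler_normB _ _) _; lra.
Unshelve. all: by end_near. Qed.

Definition primitive g x := \int[mu]_(s in `[0, x]) g s - \int[mu]_(s in `[x, 0]) g s.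

Lemma primitive_ACR g : (forall x y, L2on `[x, y] g) -> ACR (primitive g) g.
Proof.
move=> hg a b; split; first exact: hg.
have i x y : L1on `[x, y] g by exact: L2on_L1on_itv.
have e0 x y : y <= x -> \int[mu]_(s in `[x, y]) g s = 0.
  rewrite le_eqVlt => /orP[/eqP ->|yx]; first by rewrite set_itv1 Rintegral_set1.
  by rewrite set_itv_ge ?Rintegral_set0// bnd_simp -ltNge.
move=> x y _ xy _; rewrite /primitive.
have [x0|/ltW x0] := leP 0 x.
  have y0 := le_trans x0 xy.
  by rewrite (e0 x 0)// (e0 y 0)// !subr0 (@Rintegral_itv_split _ _ 0 x y)// addrAC subrr add0r.
have [y0|/ltW y0] := leP 0 y.
  by rewrite (e0 0 x)// (e0 y 0)// subr0 sub0r opprK addrC -Rintegral_itv_split.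
by rewrite (e0 0 x)// (e0 0 y)// !sub0r opprK (@Rintegral_itv_split _ _ x y 0)// addrC addrK.
Qed.

(** The difference of [u] and a primitive of its weak derivative has weak derivative
    zero, hence is constant. *)
Lemma weak_derivative_rep u g : L2on setT u -> L2on setT g -> rweak u g ->
  exists2 w, rH1 w g & {ae mu, forall x : RT, u x = w x}.
Proof.
move=> hu hg ug.
have lu x y : L2on `[x, y] u by exact: L2on_sub hu.
have lg x y : L2on `[x, y] g by exact: L2on_sub hg.
have AG := primitive_ACR lg.
pose z x := u x - primitive g x.
have lz x y : L2on `[x, y] z by apply: L2onB => //; exact: AC_L2u (AG x y).
have [k hk] : exists k, {ae mu, forall x : RT, z x = k}.
  apply: weak_constant lz _ => t ht.
  rewrite (@eq_Rintegral _ _ _ mu _ (fun x => u x * derive1 t x - primitive g x * derive1 t x)); last first.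
    by move=> x _; rewrite /z; ring.
  rewrite RintegralB//; last 2 first.
  - by have [] := test_integrable lu ht.
  - by have [] := test_integrable (fun x y => AC_L2u (AG x y)) ht.
  by rewrite ug// (ACR_weak AG ht) subrr.
have hw : ACR (fun x => primitive g x + k) g.
  move=> x y; have := ACD (AG x y) (AC_cst x y k); apply: AC_eqd => s _ _.
  by rewrite addr0.
have uw : {ae mu, forall x : RT, u x = primitive g x + k}.
  by apply: aeS hk => x <-; rewrite /z addrCA subrr addr0.
exists (fun x => primitive g x + k) => //; split => //.
apply: L2on_ae uw hu; apply: continuous_measurable; exact: ACR_continuous hw.
Qed.

Definition right_half f x : R := if 0 < x then f x else 0.

Lemma right_halfE f : right_half f = fun x => \1_(`]0, +oo[%classic) x * f x.
Proof.
apply/funext => x; rewrite /right_half indicE.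
have -> : (x \in (`]0, +oo[%classic : set R)) = (0 < x).
  by apply/idP/idP; rewrite inE/= in_itv/= andbT.
by case: ifP; rewrite ?mul1r ?mul0r.
Qed.

Lemma right_half_L2 D f : measurable D -> L2on D f -> L2on D (right_half f).
Proof.
move=> mD hf; rewrite right_halfE; apply: (L2onM_bounded (M := 1)) => //.
  by move=> x _; rewrite indicE; case: (_ \in _) => /=; rewrite ?normr1 ?normr0.
Qed.

(** A function may be cut off at one of its zeros without creating a jump. *)
Lemma right_half_ACR u d : ACR u d -> u 0 = 0 -> ACR (right_half u) (right_half d).
Proof.
move=> hu u0 a b; split; first by apply: right_half_L2 => //; case: (hu a b).
have z x y : y <= 0 -> \int[mu]_(s in `[x, y]) right_half d s = 0.
  move=> y0; rewrite (@eq_Rintegral _ _ _ mu _ (cst 0)); first by rewrite /Rintegral integral0.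
  move=> s; rewrite inE/= in_itv/= => /andP[_ sy]; rewrite /right_half ltNge.
  by rewrite (le_trans sy y0).
have p x y : 0 <= x -> x <= y ->
    right_half u y - right_half u x = \int[mu]_(s in `[x, y]) right_half d s.
  move=> x0 xy; rewrite -Rintegral_itv_obnd_cbnd; last first.
    apply: L1on_sub (_ : L1on `[x, y] _) => //.
      by move=> s /=; rewrite !in_itv/= => /andP[/ltW -> ->].
    by apply: L2on_L1on_itv; apply: right_half_L2 => //; case: (hu x y).
  rewrite (@eq_Rintegral _ _ _ mu _ d); last first.
    move=> s; rewrite inE/= in_itv/= => /andP[xs _].
    by rewrite /right_half (le_lt_trans x0 xs).
  rewrite Rintegral_itv_obnd_cbnd; last first.
    apply: L1on_sub (AC_L1 (hu x y) (lexx x) (lexx y)) => //.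
    by move=> s /=; rewrite !in_itv/= => /andP[/ltW -> ->].
  rewrite -(hu x y).2// /right_half.
  have e s : 0 <= s -> (if 0 < s then u s else 0) = u s.
    by rewrite le_eqVlt => /orP[/eqP <-|->] //; rewrite ltxx u0.
  by rewrite !e// (le_trans x0).
have n x : x <= 0 -> right_half u x = 0 by move=> x0; rewrite /right_half ltNge x0.
move=> x y _ xy _; have [x0|/ltW x0] := leP 0 x; first exact: p.
have [y0|/ltW y0] := leP 0 y; last by rewrite z// !n// subrr.
rewrite (@Rintegral_itv_split _ _ x 0 y)//; last first.
  by apply: L2on_L1on_itv; apply: right_half_L2 => //; case: (hu x y).
by rewrite z// add0r (n x x0) -p// (n 0).
Qed.

Lemma right_half_rH1 u d : rH1 u d -> u 0 = 0 -> rH1 (right_half u) (right_half d).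
Proof.
by move=> [h1 h2 h3] u0; split; [exact: right_half_L2|exact: right_half_L2|exact: right_half_ACR].
Qed.

End DuBoisReymond.

(** * Completeness of the space of square integrable functions *)

Section RieszFischer.
Context {R : realType}.
Local Notation mu := (@lebesgue_measure R).
Local Notation RT := (measurableTypeR R).

Lemma cvg_of_geometric_increments (g : nat -> R) C :
  (forall k, `|g k.+1 - g k| <= C / 2 ^+ k) -> cvgn g.
Proof.
move=> h.
have cs : cvgn (series (telescope g)).
  apply: normed_cvg; apply: (@series_le_cvg _ _ (geometric C 2^-1)).
  - by move=> n /=; exact: normr_ge0.
  - by move=> n; rewrite /geometric/= exprVn; exact: le_trans (normr_ge0 _) (h n).
  - by move=> n; rewrite /geometric/= exprVn; exact: h.
  - by apply: is_cvg_geometric_series; rewrite ger0_norm ?invr_ge0// invf_lt1// ltr1n.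
have : cvgn (fun n => g 0%N + series (telescope g) n) by apply: is_cvgD => //; exact: is_cvg_cst.
by congr (cvgn _); apply/funext => n; rewrite telescopeK/= addrCA subrr addr0.
Qed.

(** A subsequence with rapidly decreasing increments [d_k] converges almost
    everywhere, because the weighted sum [sum_k 4^k d_k^2] has a finite
    integral; Fatou's lemma then bounds the distance to the pointwise limit. *)
Theorem L2_complete (f : nat -> R -> R) : (forall n, L2on setT (f n)) ->
  (forall e : R, 0 < e -> exists n0, forall m n, (n0 <= m)%N -> (n0 <= n)%N ->
     \int[mu]_x ((f m x - f n x) ^+ 2) <= e) ->
  exists2 g, L2on setT g & forall e : R, 0 < e -> exists n0, forall n, (n0 <= n)%N ->
     \int[mu]_x ((f n x - g x) ^+ 2) <= e.
Proof.
move=> hf cf.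
have L2d m n : L2on setT (fun x => f m x - f n x) by exact: L2onB.
pose tau k : R := (4 ^+ k * 2 ^+ k.+1)^-1.
have tau0 k : 0 < tau k by rewrite invr_gt0 mulr_gt0 ?exprn_gt0.
have /choice[N hN] : forall k, exists n0, forall m n, (n0 <= m)%N -> (n0 <= n)%N ->
    \int[mu]_x ((f m x - f n x) ^+ 2) <= tau k by move=> k; exact: cf.
(* A subsequence index beyond [N k], monotone enough that [M k.+1] is beyond [N k] too. *)
pose M k := (k + \sum_(j < k.+1) N j)%N.
have NM k : (N k <= M k)%N by rewrite /M big_ord_recr/= addnA leq_addl.
have NM1 k : (N k <= M k.+1)%N.
  rewrite /M big_ord_recr/= big_ord_recr/= addnA.
  by apply: leq_trans (leq_addr _ _); rewrite addnA leq_addl.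
have kM k : (k <= M k)%N by rewrite leq_addr.
pose d k x := f (M k.+1) x - f (M k) x.
pose G x := (\sum_(0 <= k <oo) (4 ^+ k * d k x ^+ 2)%:E)%E.
have md k : measurable_fun [set: RT] (d k) by case: (L2d (M k.+1) (M k)).
have mG k : measurable_fun [set: RT] (fun x => (4 ^+ k * d k x ^+ 2)%:E).
  by apply/measurable_EFinP; apply: measurable_funM => //; exact: measurable_funX.
have G0 k x : (0 <= (4 ^+ k * d k x ^+ 2)%:E)%E.
  by rewrite lee_fin mulr_ge0 ?sqr_ge0// exprn_ge0.
have intG : (\int[mu]_x G x <= 1)%E.
  rewrite /G integral_nneseries//.
  have h := @cvg_geometric_eseries_half R 1 0; rewrite expr0 divr1 in h.
  rewrite -(cvg_lim _ h)//; apply: lee_nneseries.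
    by move=> k *; apply: integral_ge0 => x _; exact: G0.
  move=> k *; have i1 : L1on setT (fun x => 4 ^+ k * d k x ^+ 2).
    by apply: L1onZ => //; case: (L2d (M k.+1) (M k)).
  rewrite -(fineK (integrable_fin_num measurableT i1)) lee_fin.
  rewrite -/(Rintegral mu setT (fun x => 4 ^+ k * d k x ^+ 2)) RintegralZl//; last first.
    by case: (L2d (M k.+1) (M k)).
  have /(ler_wpM2l (exprn_ge0 k (ler0n R 4))) := hN k _ _ (NM1 k) (NM k).
  move=> /le_trans; apply; rewrite /tau addn1 invfM mulrA mulfV ?mul1r ?expf_neq0//.
  by rewrite natrX.
have iG : mu.-integrable setT G.
  apply/integrableP; split.
    by apply: ge0_emeasurable_sum.
  apply: le_lt_trans (ltry 1); apply: le_trans intG.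
  rewrite le_eqVlt; apply/orP; left; apply/eqP; apply: eq_integral => x _.
  by rewrite gee0_abs// nneseries_ge0.
have aeG := integrable_ae measurableT iG.
have cvg_ae : {ae mu, forall x : RT, cvgn (fun k => f (M k) x)}.
  apply: aeS aeG => x /(_ I) Gx.
  apply: (@cvg_of_geometric_increments _ (1 + fine (G x))) => k.
  have G1 : 0 <= fine (G x) by apply: fine_ge0; exact: nneseries_ge0.
  have h : 4 ^+ k * d k x ^+ 2 <= fine (G x).
    rewrite -lee_fin fineK//.
    apply: le_trans (nneseries_lim_ge (m := 0) k.+1 _) => //.
    by rewrite big_nat_recr//= leeDr// sume_ge0.
  rewrite -/(d k x) ler_pdivlMr ?exprn_gt0//.
  rewrite -(@ler_pXn2r _ 2) ?nnegrE ?mulr_ge0 ?exprn_ge0 ?addr_ge0//.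
  rewrite exprMn real_normK ?num_real// -exprM mulnC exprM mulrC.
  have -> : 2 ^+ 2 = 4 :> R by ring.
  apply: le_trans h _; nra.
pose g x := fine (limn_esup (fun k => (f (M k) x)%:E)).
have mg : measurable_fun [set: RT] g.
  apply: measurableT_comp; first exact: fine_measurable.
  apply: measurable_fun_limn_esup => k; apply/measurable_EFinP; by case: (hf (M k)).
have gP : {ae mu, forall x : RT, (fun k => f (M k) x) @ \oo --> g x}.
  apply: aeS cvg_ae => x cx.
  have h : (fun k => (f (M k) x)%:E) @ \oo --> (limn (fun k => f (M k) x))%:E.
    by apply: cvg_EFin => //; exact: nearW.
  by rewrite /g (cvg_limn_einf_sup h).2.
have key e n0 : (forall m n, (n0 <= m)%N -> (n0 <= n)%N ->
    \int[mu]_x ((f m x - f n x) ^+ 2) <= e) -> forall n, (n0 <= n)%N ->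
    (\int[mu]_x ((f n x - g x) ^+ 2)%:E <= e%:E)%E.
  move=> hn0 n hn.
  pose F k x := ((f n x - f (M (k + n0)%N) x) ^+ 2)%:E.
  have mF k : measurable_fun [set: RT] (F k).
    by apply/measurable_EFinP; apply: measurable_funX; case: (L2d n (M (k + n0)%N)).
  have F0 k x : [set: RT] x -> (0 <= F k x)%E by rewrite lee_fin sqr_ge0.
  have := fatou mu measurableT mF F0.
  have -> : (\int[mu]_x limn_einf (F ^~ x))%E = (\int[mu]_x ((f n x - g x) ^+ 2)%:E)%E.
    apply: ae_eq_integral => //.
    - apply: (eq_measurable_fun (fun x => (- limn_esup (fun k => (- F k x)))%E)) => //.
      by apply: measurableT_comp => //; apply: measurable_fun_limn_esup => k; apply: measurableT_comp => //; exact: mF.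
    - by apply/measurable_EFinP; apply: measurable_funX; apply: measurable_funB => //; case: (hf n).
    apply: aeS gP => x gx _.
    have c1 : (fun k => f (M (k + n0)%N) x) @ \oo --> g x.
      by have := gx; rewrite -(cvg_shiftn n0).
    have c2 : (fun k => F k x) @ \oo --> ((f n x - g x) ^+ 2)%:E.
      apply: cvg_EFin; first exact: nearW.
      rewrite /comp /F /= expr2; under eq_fun do rewrite expr2.
      by apply: cvgM; apply: cvgB => //; exact: cvg_cst.
    by rewrite (cvg_limn_einf_sup c2).1.
  move=> /le_trans; apply; rewrite limn_einf_lim; apply: lime_le; first exact: is_cvg_einfs.
  apply: nearW => k; apply: (@le_trans _ _ (\int[mu]_x F k x)%E).
    by apply: ereal_inf_lbound; exists k => //=.
  have i1 : L1on setT (fun x => (f n x - f (M (k + n0)%N) x) ^+ 2) by case: (L2d n (M (k + n0)%N)).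
  rewrite -(fineK (integrable_fin_num measurableT i1)) lee_fin.
  by apply: hn0 => //; apply: leq_trans (kM _); rewrite leq_addl.
have L2fg : exists n1, L2on setT (fun x => f n1 x - g x).
  have [n0 hn0] := cf 1 ltr01; exists n0.
  have mfg : measurable_fun [set: RT] (fun x => f n0 x - g x).
    by apply: measurable_funB => //; case: (hf n0).
  split => //; apply/integrableP; split; first by apply/measurable_EFinP; exact: measurable_funX.
  apply: le_lt_trans (ltry 1); apply: le_trans (key 1 n0 hn0 n0 (leqnn _)).
  rewrite le_eqVlt; apply/orP; left; apply/eqP; apply: eq_integral => x _ /=.
  by rewrite ger0_norm ?sqr_ge0.
have L2g : L2on setT g.
  have [n1 h1] := L2fg; apply: L2on_eq (L2onB measurableT (hf n1) h1) => x _.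
  by rewrite opprB addrCA subrr addr0.
exists g => // e e0; have [n0 hn0] := cf e e0; exists n0 => n hn.
have i1 : L1on setT (fun x => (f n x - g x) ^+ 2) by case: (L2onB measurableT (hf n) L2g).
by rewrite -lee_fin /Rintegral fineK ?(integrable_fin_num measurableT i1)//; exact: key hn0 n hn.
Qed.

End RieszFischer.

(** * The real Hilbert space of complex H1 functions *)

Section SobolevComplex.
Context {R : realType}.
Local Notation mu := (@lebesgue_measure R).
Local Notation RT := (measurableTypeR R).
Local Notation C := (Rcomplex R).
Local Notation Re := (@complex.Re R).
Local Notation Im := (@complex.Im R).
Implicit Types (v w g : R -> C) (f : R -> R).

Lemma ReM (x y : C) : Re (x * y) = Re x * Re y - Im x * Im y.
Proof. by case: x => a b; case: y. Qed.

Lemma ImM (x y : C) : Im (x * y) = Re x * Im y + Im x * Re y.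
Proof. by case: x => a b; case: y. Qed.

Lemma ReD (x y : C) : Re (x + y) = Re x + Re y.
Proof. by case: x => a b; case: y. Qed.

Lemma ImD (x y : C) : Im (x + y) = Im x + Im y.
Proof. by case: x => a b; case: y. Qed.

Lemma ReZ (a : R) (x : C) : Re (a *: x) = a * Re x.
Proof. by case: x. Qed.

Lemma ImZ (a : R) (x : C) : Im (a *: x) = a * Im x.
Proof. by case: x. Qed.

Lemma scaleC (a : R) (x : C) : a *: x = (a%:C : C) * x.
Proof. by case: x => b c; rewrite /GRing.scale/= /GRing.mul/= !mul0r subr0 addr0. Qed.

Lemma complex_eqP (x y : C) : Re x = Re y -> Im x = Im y -> x = y.
Proof. by case: x => a b; case: y => c e /= -> ->. Qed.

Lemma L2P v : L2 v <-> L2on setT (fun x => Re (v x)) /\ L2on setT (fun x => Im (v x)).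
Proof.
split=> [[h1 h2]|[h1 h2]]; first by split; exact/L2on_LfunP.
by split; exact/L2on_LfunP.
Qed.

Lemma weak_derivativeP v g : weak_derivative v g <->
  rweak (fun x => Re (v x)) (fun x => Re (g x)) /\
  rweak (fun x => Im (v x)) (fun x => Im (g x)).
Proof.
have e (a : R -> C) (t : R -> R) : cintegral (fun x => a x * (t x)%:C) =
    (\int[mu]_x (Re (a x) * t x)) +i* (\int[mu]_x (Im (a x) * t x)).
  rewrite /cintegral; congr (_ +i* _); apply: eq_Rintegral => x _.
    by rewrite ReM/= mulr0 subr0.
  by rewrite ImM/= mulr0 add0r.
split=> [h|[h1 h2]].
  by split=> t /h; rewrite !e => -[].
by move=> t ht; rewrite !e h1// h2.
Qed.

Lemma L2_lin (a : R) v w : L2 v -> L2 w -> L2 (a *: v + w).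
Proof.
move=> /L2P[v1 v2] /L2P[w1 w2]; apply/L2P; split.
  apply: L2on_eq (L2onD measurableT (L2onZ a measurableT v1) w1) => x _.
  by rewrite ReD ReZ.
apply: L2on_eq (L2onD measurableT (L2onZ a measurableT v2) w2) => x _.
by rewrite ImD ImZ.
Qed.

Lemma Dx_spec v : H1 v -> L2 (Dx v) /\ weak_derivative v (Dx v).
Proof.
move=> [_ [g hg]]; exact: (xgetPex (fun=> 0)
  (ex_intro (fun g : R -> R[i] => L2 g /\ weak_derivative v g) g hg)). Qed.

Lemma H1_L2 v : H1 v -> L2 v.
Proof. by case. Qed.

Lemma Dx_L2 v : H1 v -> L2 (Dx v).
Proof. by move/Dx_spec => []. Qed.

(** The continuous representative, by its real and imaginary parts. *)
Definition crep v (u1 d1 u2 d2 : R -> R) := [/\ rH1 u1 d1, rH1 u2 d2,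
  {ae mu, forall x : RT, v x = u1 x +i* u2 x} &
  {ae mu, forall x : RT, Dx v x = d1 x +i* d2 x}].

Lemma crep_exists v : H1 v -> exists u1 d1 u2 d2, crep v u1 d1 u2 d2.
Proof.
move=> Hv; have [/L2P[l1 l2] /weak_derivativeP[w1 w2]] := Dx_spec Hv.
have /L2P[v1 v2] := H1_L2 Hv.
have [u1 h1 e1] := weak_derivative_rep v1 l1 w1.
have [u2 h2 e2] := weak_derivative_rep v2 l2 w2.
exists u1, (fun x => Re (Dx v x)), u2, (fun x => Im (Dx v x)); split => //.
  by apply: aeS (aeI e1 e2) => x [a b]; exact: complex_eqP.
by apply: aeW => x; exact: complex_eqP.
Qed.

(** Weak derivatives are unique almost everywhere, so [Dx v] is the derivative of the
    continuous representative whichever weak derivative [Dx] selects. *)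
Lemma crep_intro v u1 d1 u2 d2 : L2 v -> rH1 u1 d1 -> rH1 u2 d2 ->
  {ae mu, forall x : RT, v x = u1 x +i* u2 x} -> H1 v /\ crep v u1 d1 u2 d2.
Proof.
move=> Lv h1 h2 e.
have [l1 m1 a1] := h1; have [l2 m2 a2] := h2.
have /L2P[v1 v2] := Lv.
have wk (p q : R -> R) d : ACR q d -> L2on setT p -> {ae mu, forall x : RT, p x = q x} -> rweak p d.
  move=> hq hp pq t ht; rewrite -(ACR_weak hq ht).
  have ct : ACR t (derive1 t) by exact: test_AC.
  apply: ae_integral_eq.
  - by apply: measurable_funM; [case: hp|exact: ACR_measurabled ct].
  - apply: measurable_funM; last exact: ACR_measurabled ct.
    by apply: continuous_measurable; exact: ACR_continuous hq.
  by apply: aeS pq => x ->.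
have Hv : H1 v.
  split => //; exists (fun x => d1 x +i* d2 x); split; first by apply/L2P.
  apply/weak_derivativeP; split => /=.
    by apply: wk a1 v1 _; apply: aeS e => x ->.
  by apply: wk a2 v2 _; apply: aeS e => x ->.
split => //; split => //.
have [p1 [q1 [p2 [q2 [[_ _ b1] [_ _ b2] e1 e2]]]]] := crep_exists Hv.
have f1 : {ae mu, forall x : RT, p1 x = u1 x}.
  by apply: aeS (aeI e e1) => x [-> []].
have f2 : {ae mu, forall x : RT, p2 x = u2 x}.
  by apply: aeS (aeI e e1) => x [-> []].
have [_ g1] := ACR_unique b1 a1 f1; have [_ g2] := ACR_unique b2 a2 f2.
by apply: aeS (aeI e2 (aeI g1 g2)) => x [-> [-> ->]].
Qed.

Lemma rH1_lin (a : R) u1 d1 u2 d2 : rH1 u1 d1 -> rH1 u2 d2 ->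
  rH1 (fun x : R => a * u1 x + u2 x) (fun x => a * d1 x + d2 x).
Proof.
move=> [a1 a2 a3] [b1 b2 b3]; split.
- by apply: L2onD => //; exact: L2onZ.
- by apply: L2onD => //; exact: L2onZ.
- by move=> x y; exact: AC_lin.
Qed.

Lemma crep_lin (a : R) v u1 d1 u2 d2 w p1 q1 p2 q2 : H1 v -> H1 w ->
  crep v u1 d1 u2 d2 -> crep w p1 q1 p2 q2 -> H1 (a *: v + w) /\
  crep (a *: v + w) (fun x => a * u1 x + p1 x) (fun x => a * d1 x + q1 x)
    (fun x => a * u2 x + p2 x) (fun x => a * d2 x + q2 x).
Proof.
move=> Hv Hw [h1 h2 e1 e2] [k1 k2 e3 e4]; apply: crep_intro.
- by apply: L2_lin; exact: H1_L2.
- exact: rH1_lin.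
- exact: rH1_lin.
by apply: aeS (aeI e1 e3) => x [E1 E3]; apply: complex_eqP; rewrite ?ReD ?ImD ?ReZ ?ImZ E1 E3.
Qed.

Lemma H1_subspace_lin (a : R) v w : H1 v -> H1 w -> H1 (a *: v + w).
Proof.
move=> Hv Hw; have [u1 [d1 [u2 [d2 rv]]]] := crep_exists Hv.
have [p1 [q1 [p2 [q2 rw]]]] := crep_exists Hw.
by have [] := crep_lin a Hv Hw rv rw.
Qed.

Lemma Dx_lin (a : R) v w : H1 v -> H1 w ->
  {ae mu, forall x : RT, Dx (a *: v + w) x = a *: (Dx v x : C) + Dx w x}.
Proof.
move=> Hv Hw; have [u1 [d1 [u2 [d2 rv]]]] := crep_exists Hv.
have [p1 [q1 [p2 [q2 rw]]]] := crep_exists Hw.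
have [_ [_ _ _ e]] := crep_lin a Hv Hw rv rw.
case: rv => _ _ _ e1; case: rw => _ _ _ e2.
by apply: aeS (aeI e (aeI e1 e2)) => x [-> [-> ->]]; apply: complex_eqP; rewrite ?ReD ?ImD ?ReZ ?ImZ.
Qed.

Lemma H1_0 : H1 (0 : R -> C).
Proof.
have z : rH1 (fun=> 0 : R) (fun=> 0 : R).
  by split; [exact: L2on0|exact: L2on0|move=> a b; exact: AC_cst].
have L0 : L2 (0 : R -> C) by apply/L2P; split; exact: L2on0.
by have [] := crep_intro L0 z z (aeW _ (fun x => erefl)).
Qed.

Lemma H1_is_subspace : subspace (H1 : set (R -> C)).
Proof. by split; [exact: H1_0|move=> a u v; exact: H1_subspace_lin]. Qed.

Lemma innerE v w : inner v w = \int[mu]_x (Re (v x) * Re (w x) + Im (v x) * Im (w x)).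
Proof.
rewrite /inner /cintegral/=; apply: eq_Rintegral => x _.
by case: (v x) => a b; case: (w x) => c e /=; rewrite mulrN opprK.
Qed.

Lemma inner_L1 v w : L2 v -> L2 w ->
  L1on setT (fun x => Re (v x) * Re (w x) + Im (v x) * Im (w x)).
Proof. by move=> /L2P[v1 v2] /L2P[w1 w2]; apply: L1onD => //; exact: L2onM. Qed.

Lemma innerC v w : inner v w = inner w v.
Proof. by rewrite !innerE; apply: eq_Rintegral => x _; ring. Qed.

Lemma inner_ge0 v : 0 <= inner v v.
Proof.
by rewrite innerE; apply: Rintegral_ge0 => x _; rewrite -!expr2 addr_ge0 ?sqr_ge0.
Qed.

Lemma inner_lin (a : R) (u v w : R -> C) : L2 u -> L2 v -> L2 w ->
  inner (a *: u + v) w = a * inner u w + inner v w.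
Proof.
move=> hu hv hw; rewrite !innerE -RintegralZl//; last exact: inner_L1.
rewrite -RintegralD//; last 2 first.
- by apply: L1onZ => //; exact: inner_L1.
- exact: inner_L1.
by apply: eq_Rintegral => x _; rewrite ReD ImD ReZ ImZ; ring.
Qed.

Lemma L2_measurable v : L2 v -> measurable_fun [set: RT] (fun x => Re (v x)) /\
  measurable_fun [set: RT] (fun x => Im (v x)).
Proof. by move=> /L2P[[h _] [k _]]. Qed.

Lemma inner_ae v v' w w' : L2 v -> L2 v' -> L2 w -> L2 w' ->
  {ae mu, forall x : RT, v x = v' x} -> {ae mu, forall x : RT, w x = w' x} ->
  inner v w = inner v' w'.
Proof.
move=> /L2_measurable[h1 h2] /L2_measurable[h3 h4] /L2_measurable[k1 k2] /L2_measurable[k3 k4] e1 e2.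
rewrite !innerE; apply: ae_integral_eq.
- by apply: measurable_funD; exact: measurable_funM.
- by apply: measurable_funD; exact: measurable_funM.
by apply: aeS (aeI e1 e2) => x [-> ->].
Qed.

Lemma inner_eq0 v : L2 v -> inner v v = 0 -> ae_equal v (fun=> 0).
Proof.
move=> hv; rewrite innerE => h.
have h0 x : [set: RT] x -> 0 <= Re (v x) * Re (v x) + Im (v x) * Im (v x).
  by rewrite -!expr2 addr_ge0 ?sqr_ge0.
apply: aeS (Rintegral_ge0_eq0 measurableT (inner_L1 hv hv) h0 h) => x /(_ Logic.I).
rewrite -!expr2 => /eqP.
rewrite paddr_eq0 ?sqr_ge0// !sqrf_eq0 => /andP[/eqP a /eqP b].
exact: complex_eqP.
Qed.

Lemma Dx_ae v w : H1 v -> H1 w -> ae_equal v w -> {ae mu, forall x : RT, Dx v x = Dx w x}.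
Proof.
move=> Hv Hw vw; have [u1 [d1 [u2 [d2 [h1 h2 e1 e2]]]]] := crep_exists Hv.
have e3 : {ae mu, forall x : RT, w x = u1 x +i* u2 x}.
  by apply: aeS (aeI vw e1) => x [<-].
have [_ [_ _ _ e4]] := crep_intro (H1_L2 Hw) h1 h2 e3.
by apply: aeS (aeI e2 e4) => x [-> ->].
Qed.

Definition inner1 v w := inner v w + inner (Dx v) (Dx w).

Lemma L2_Dx_lin (a : R) (u v : R -> C) : H1 u -> H1 v -> L2 (a *: (Dx u : R -> C) + Dx v).
Proof. by move=> Hu Hv; apply: L2_lin; exact: Dx_L2. Qed.

Lemma inner_Dx_lin (a : R) (u v w : R -> C) : H1 u -> H1 v -> L2 w ->
  inner (Dx (a *: u + v)) w = a * inner (Dx u) w + inner (Dx v) w.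
Proof.
move=> Hu Hv hw; rewrite -inner_lin//; [|exact: Dx_L2|exact: Dx_L2].
apply: inner_ae => //.
- by apply: Dx_L2; exact: H1_subspace_lin.
- exact: L2_Dx_lin.
- exact: Dx_lin.
- exact: aeW.
Qed.

Lemma inner_symform : symform (H1 : set (R -> C)) inner.
Proof.
split=> [u v _ _|w Hw a u v Hu Hv]; first exact: innerC.
by rewrite inner_lin//; exact: H1_L2.
Qed.

Lemma inner1_symform : symform (H1 : set (R -> C)) inner1.
Proof.
split=> [u v _ _|w Hw a u v Hu Hv]; first by rewrite /inner1 innerC (innerC (Dx u)).
rewrite /inner1 (inner_lin a (H1_L2 Hu) (H1_L2 Hv) (H1_L2 Hw)).
by rewrite (inner_Dx_lin a Hu Hv (Dx_L2 Hw)) mulrDr addrACA.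
Qed.

Lemma inner1_psd : psd (H1 : set (R -> C)) inner1.
Proof. by move=> v _; rewrite addr_ge0 ?inner_ge0. Qed.

Lemma H1norm_sqr v : H1norm v ^+ 2 = inner1 v v.
Proof. by rewrite /H1norm sqr_sqrtr// addr_ge0 ?inner_ge0. Qed.

Lemma inner_le_inner1 v : inner v v <= inner1 v v.
Proof. by rewrite /inner1 lerDl inner_ge0. Qed.

Lemma innerDx_le_inner1 v : inner (Dx v) (Dx v) <= inner1 v v.
Proof. by rewrite /inner1 lerDr inner_ge0. Qed.

Lemma inner1_eq0 v : H1 v -> inner1 v v = 0 -> ae_equal v (fun=> 0).
Proof.
move=> Hv h; apply: inner_eq0; first exact: H1_L2.
by apply/eqP; rewrite eq_le inner_ge0 andbT -h inner_le_inner1.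
Qed.

Lemma cintegral_parts v : L2 v ->
  inner v v = \int[mu]_x (Re (v x) ^+ 2) + \int[mu]_x (Im (v x) ^+ 2).
Proof.
move=> /L2P[[_ h1] [_ h2]]; rewrite innerE -RintegralD//.
Qed.

Lemma Rintegral_sqr_ge0 f : 0 <= \int[mu]_x (f x ^+ 2).
Proof. by apply: Rintegral_ge0 => x _; exact: sqr_ge0. Qed.

(** Completeness of [L2] applied to the real and imaginary parts. *)
Lemma L2_complex_complete (v : nat -> R -> C) : (forall n, L2 (v n)) ->
  (forall e : R, 0 < e -> exists n0, forall m n, (n0 <= m)%N -> (n0 <= n)%N ->
     inner (v m - v n) (v m - v n) <= e) ->
  exists2 w : R -> C, L2 w & forall e : R, 0 < e -> exists n0, forall n, (n0 <= n)%N ->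
     inner (v n - w) (v n - w) <= e.
Proof.
move=> hv cv.
have L2B (u w : R -> C) : L2 u -> L2 w -> L2 (u - w).
  move=> hu hw; have := L2_lin (-1) hw hu.
  by congr L2; apply/funext => x; rewrite scaleN1r addrC.
have ReB (z z' : C) : Re (z - z') = Re z - Re z' by case: z; case: z'.
have ImB (z z' : C) : Im (z - z') = Im z - Im z' by case: z; case: z'.
have pE (u w : R -> C) : L2 u -> L2 w -> inner (u - w) (u - w) =
    \int[mu]_x ((Re (u x) - Re (w x)) ^+ 2) + \int[mu]_x ((Im (u x) - Im (w x)) ^+ 2).
  move=> hu hw; rewrite cintegral_parts; last exact: L2B.
  by congr (_ + _); apply: eq_Rintegral => x _; rewrite ?ReB ?ImB.
have [|e e0|f1 hf1 c1] := @L2_complete R (fun n x => Re (v n x)).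
- by move=> n; have /L2P[] := hv n.
- have [n0 h] := cv e e0; exists n0 => m n hm hn; apply: le_trans (h m n hm hn).
  by rewrite pE// lerDl Rintegral_sqr_ge0.
have [|e e0|f2 hf2 c2] := @L2_complete R (fun n x => Im (v n x)).
- by move=> n; have /L2P[] := hv n.
- have [n0 h] := cv e e0; exists n0 => m n hm hn; apply: le_trans (h m n hm hn).
  by rewrite pE// lerDr Rintegral_sqr_ge0.
have hw : L2 (fun x => f1 x +i* f2 x) by apply/L2P.
exists (fun x => f1 x +i* f2 x) => // e e0.
have e2 : 0 < e / 2 by rewrite divr_gt0.
have [n1 h1] := c1 _ e2; have [n2 h2] := c2 _ e2.
exists (maxn n1 n2) => n; rewrite geq_max => /andP[hn1 hn2].
by rewrite pE//= (le_trans (lerD (h1 n hn1) (h2 n hn2)))// -splitr.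
Qed.

Lemma small_cvg (x : R) K : (forall e, 0 < e -> x ^+ 2 <= K * e) -> x = 0.
Proof.
move=> h; apply/eqP; rewrite -sqrf_eq0 eq_le sqr_ge0 andbT.
apply/ler_addgt0Pr => e e0; rewrite add0r.
have K1 : 0 < `|K| + 1 by rewrite ltr_wpDl.
apply: le_trans (h (e / (`|K| + 1)) (divr_gt0 e0 K1)) _.
rewrite mulrA ler_pdivrMr// mulrC ler_wpM2l ?(ltW e0)//.
by have := ler_norm K; lra.
Qed.

(** Weak derivatives pass to the limit because they are tested against fixed
    square integrable functions. *)
Lemma H1_complete : complete_for (H1 : set (R -> C)) inner1.
Proof.
move=> v hv cv.
have LB (u w : R -> C) : L2 u -> L2 w -> L2 (u - w).
  move=> hu hw; have := L2_lin (-1) hw hu.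
  by congr L2; apply/funext => x; rewrite scaleN1r addrC.
have DB m n : {ae mu, forall x : RT, Dx (v m - v n) x = ((Dx (v m) : R -> C) - Dx (v n)) x}.
  have -> : v m - v n = -1 *: v n + v m by rewrite scaleN1r addrC.
  apply: aeS (Dx_lin (-1) (hv n) (hv m)) => x ->.
  by rewrite scaleN1r addrC.
have HB m n : H1 (v m - v n) by apply: subspaceB => //; exact: H1_is_subspace.
have innerDB m n : inner (Dx (v m - v n)) (Dx (v m - v n)) =
    inner ((Dx (v m) : R -> C) - Dx (v n)) ((Dx (v m) : R -> C) - Dx (v n)).
  apply: inner_ae => //; try exact: Dx_L2; try (by apply: LB; exact: Dx_L2).
have [|e e0|w Lw cw] := @L2_complex_complete v; first by move=> n; exact: H1_L2.
  have [n0 h] := cv e e0; exists n0 => m n hm hn.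
  exact: le_trans (inner_le_inner1 _) (h m n hm hn).
have [|e e0|g Lg cg] := @L2_complex_complete (fun n => Dx (v n) : R -> C).
- by move=> n; exact: Dx_L2.
- have [n0 h] := cv e e0; exists n0 => m n hm hn.
  rewrite -innerDB; exact: le_trans (innerDx_le_inner1 _) (h m n hm hn).
have tests (p q : nat -> R -> R) (p0 q0 : R -> R) :
    (forall n, L2on setT (p n)) -> (forall n, L2on setT (q n)) ->
    L2on setT p0 -> L2on setT q0 -> (forall n, rweak (p n) (q n)) ->
    (forall e : R, 0 < e -> exists n, \int[mu]_x ((p n x - p0 x) ^+ 2) <= e /\
       \int[mu]_x ((q n x - q0 x) ^+ 2) <= e) -> rweak p0 q0.
  move=> hp hq hp0 hq0 hw hc t ht.
  have ct := test_AC ht; have [M hM] := test_support ht.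
  have lt : L2on setT t.
    split; first by apply: continuous_measurable; exact: ACR_continuous ct.
    apply: (@L1on_compact_support _ _ M); first by move=> x /hM[-> _]; rewrite expr0n.
    by case: (AC_L2u (ct (- M) M)).
  have lt' : L2on setT (derive1 t).
    split; first exact: ACR_measurabled ct.
    apply: (@L1on_compact_support _ _ M); first by move=> x /hM[_ ->]; rewrite expr0n.
    by case: (ct (- M) M) => -[].
  apply/eqP; rewrite -subr_eq0 opprK; apply/eqP.
  apply: (@small_cvg _ (2 * \int[mu]_x (derive1 t x ^+ 2) + 2 * \int[mu]_x (t x ^+ 2))).
  move=> e e0; have [n [h1 h2]] := hc e e0.
  have E : \int[mu]_x (p0 x * derive1 t x) + \int[mu]_x (q0 x * t x) =
      - (\int[mu]_x ((p n x - p0 x) * derive1 t x) + \int[mu]_x ((q n x - q0 x) * t x)).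
    rewrite (@eq_Rintegral _ _ _ mu _ (fun x => p n x * derive1 t x - p0 x * derive1 t x)
      (fun x => (p n x - p0 x) * derive1 t x)); last by move=> x _; ring.
    rewrite (@eq_Rintegral _ _ _ mu _ (fun x => q n x * t x - q0 x * t x)
      (fun x => (q n x - q0 x) * t x)); last by move=> x _; ring.
    rewrite RintegralB//; try exact: L2onM.
    rewrite RintegralB//; try exact: L2onM.
    by rewrite (hw n t ht); ring.
  rewrite E sqrrN.
  have k1 := Rintegral_cauchy_schwarz measurableT (L2onB measurableT (hp n) hp0) lt'.
  have k2 := Rintegral_cauchy_schwarz measurableT (L2onB measurableT (hq n) hq0) lt.
  have k3 := ler_wpM2r (Rintegral_sqr_ge0 (derive1 t)) h1.
  have k4 := ler_wpM2r (Rintegral_sqr_ge0 t) h2.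
  move: k1 k2 k3 k4; clear.
  move: (\int[mu]_x ((p n x - p0 x) * derive1 t x)) (\int[mu]_x ((q n x - q0 x) * t x)) => A B.
  move: (\int[mu]_x ((p n x - p0 x) ^+ 2)) (\int[mu]_x ((q n x - q0 x) ^+ 2)) => P Q.
  move: (\int[mu]_x (derive1 t x ^+ 2)) (\int[mu]_x (t x ^+ 2)) => S T k1 k2 k3 k4.
  by have := sqr_ge0 (A - B); nra.
have ReB (z z' : C) : Re (z - z') = Re z - Re z' by case: z; case: z'.
have ImB (z z' : C) : Im (z - z') = Im z - Im z' by case: z; case: z'.
have part (u u' : R -> C) : L2 u -> L2 u' -> \int[mu]_x ((Re (u x) - Re (u' x)) ^+ 2) <= inner (u - u') (u - u') /\
    \int[mu]_x ((Im (u x) - Im (u' x)) ^+ 2) <= inner (u - u') (u - u').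
  move=> hu hu'; rewrite cintegral_parts; last exact: LB.
  have -> : \int[mu]_x (Re ((u - u') x) ^+ 2) = \int[mu]_x ((Re (u x) - Re (u' x)) ^+ 2).
    by apply: eq_Rintegral => x _; rewrite ReB.
  have -> : \int[mu]_x (Im ((u - u') x) ^+ 2) = \int[mu]_x ((Im (u x) - Im (u' x)) ^+ 2).
    by apply: eq_Rintegral => x _; rewrite ImB.
  by rewrite lerDl lerDr !Rintegral_sqr_ge0.
have wg : weak_derivative w g.
  have Lv n := H1_L2 (hv n); have Ld n := Dx_L2 (hv n).
  have c e : 0 < e -> exists n, inner (v n - w) (v n - w) <= e /\
      inner ((Dx (v n) : R -> C) - g) ((Dx (v n) : R -> C) - g) <= e.
    move=> e0; have [n1 h1] := cw e e0; have [n2 h2] := cg e e0.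
    by exists (maxn n1 n2); rewrite h1 ?leq_maxl// h2 ?leq_maxr.
  apply/weak_derivativeP; split.
    apply: (tests (fun n x => Re (v n x)) (fun n x => Re (Dx (v n) x))).
    - by move=> n; have /L2P[] := Lv n.
    - by move=> n; have /L2P[] := Ld n.
    - by have /L2P[] := Lw.
    - by have /L2P[] := Lg.
    - by move=> n; have [_ /weak_derivativeP[]] := Dx_spec (hv n).
    move=> e /c[n [h1 h2]]; exists n; split.
      by apply: le_trans h1; have [] := part _ _ (Lv n) Lw.
    by apply: le_trans h2; have [] := part _ _ (Ld n) Lg.
  apply: (tests (fun n x => Im (v n x)) (fun n x => Im (Dx (v n) x))).
  - by move=> n; have /L2P[] := Lv n.
  - by move=> n; have /L2P[] := Ld n.
  - by have /L2P[] := Lw.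
  - by have /L2P[] := Lg.
  - by move=> n; have [_ /weak_derivativeP[]] := Dx_spec (hv n).
  move=> e /c[n [h1 h2]]; exists n; split.
    by apply: le_trans h1; have [] := part _ _ (Lv n) Lw.
  by apply: le_trans h2; have [] := part _ _ (Ld n) Lg.
have Hw : H1 w by split => //; exists g.
exists w => // e e0.
have wgD : {ae mu, forall x : RT, Dx w x = g x}.
  have [u1 [d1 [u2 [d2 [h1 h2 e1 e2]]]]] := crep_exists Hw.
  have /L2P[g1 g2] := Lg; have /weak_derivativeP[k1 k2] := wg; have /L2P[l1 l2] := Lw.
  have [p1 [_ _ a1] f1] := weak_derivative_rep l1 g1 k1.
  have [p2 [_ _ a2] f2] := weak_derivative_rep l2 g2 k2.
  case: h1 => _ _ b1; case: h2 => _ _ b2.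
  have i1 : {ae mu, forall x : RT, u1 x = p1 x}.
    by apply: aeS (aeI e1 f1) => x [E <-]; rewrite E.
  have i2 : {ae mu, forall x : RT, u2 x = p2 x}.
    by apply: aeS (aeI e1 f2) => x [E <-]; rewrite E.
  have [_ j1] := ACR_unique b1 a1 i1; have [_ j2] := ACR_unique b2 a2 i2.
  by apply: aeS (aeI e2 (aeI j1 j2)) => x [-> [J1 J2]]; apply: complex_eqP.
have e2 : 0 < e / 2 by rewrite divr_gt0.
have [n1 h1] := cw _ e2; have [n2 h2] := cg _ e2.
exists (maxn n1 n2) => n; rewrite geq_max => /andP[hn1 hn2].
rewrite /inner1; have -> : inner (Dx (v n - w)) (Dx (v n - w)) = inner ((Dx (v n) : R -> C) - g) ((Dx (v n) : R -> C) - g).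
  have Hnw : H1 (v n - w) by apply: subspaceB => //; exact: H1_is_subspace.
  have E : {ae mu, forall x : RT, Dx (v n - w) x = ((Dx (v n) : R -> C) - g) x}.
    have -> : v n - w = -1 *: w + v n by rewrite scaleN1r addrC.
    apply: aeS (aeI wgD (Dx_lin (-1) Hw (hv n))) => x [E1 E2].
    by rewrite E2 E1 scaleN1r addrC.
  apply: inner_ae => //; try exact: Dx_L2; try (by apply: LB => //; exact: Dx_L2).
by apply: le_trans (lerD (h1 n hn1) (h2 n hn2)) _; rewrite -splitr.
Qed.

End SobolevComplex.

(** * The soliton profile *)

Section Profile.
Context {R : realType}.
Implicit Types (b omega c x : R).

(** The squared modulus of the soliton is [1 / D], where [D] solves the linear
    equation [D'' = k2 D + c / 2] with first integral
    [D'^2 = k2 D^2 + c D - gam / 4]. Both the exponentially and the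
    algebraically decaying solitons are of this form; the limit case is
    [k2 = 0]. *)
Record profile (k2 c gam : R) (D D1 : R -> R) (eps : R) : Prop := Profile {
  profile_k2 : 0 <= k2;
  profile_D : forall x, is_derive x 1 D (D1 x);
  profile_D1 : forall x, is_derive x 1 D1 (k2 * D x + c / 2);
  profile_energy : forall x, D1 x ^+ 2 = k2 * D x ^+ 2 + c * D x - gam / 4;
  profile_eps : 0 < eps;
  profile_lb : forall x, eps * (1 + x ^+ 2) <= D x;
  profile_D1_lb : forall x, eps * x ^+ 2 <= x * D1 x;
  profile_D10 : D1 0 = 0;
  profile_D20 : 0 < k2 * D 0 + c / 2 }.

Definition sinh x : R := (expR x - expR (- x)) / 2.

#[local] Instance is_derive_expN x : is_derive x 1 (fun s : R => expR (- s)) (- expR (- x)).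
Proof.
have h : is_derive x 1 (fun s : R => - s) (- 1) by exact: is_deriveN.
have := @is_derive1_comp R expR (fun s => - s) x _ _ (is_derive_expR _) h.
by rewrite mulrN1.
Qed.

Lemma is_derive_cosh x : is_derive x 1 (@cosh R) (sinh x).
Proof.
rewrite /cosh; apply: is_derive_eq.
by rewrite /GRing.scale/= /sinh; ring.
Qed.

Lemma is_derive_sinh x : is_derive x 1 sinh (cosh x).
Proof.
rewrite /sinh; apply: is_derive_eq.
by rewrite /GRing.scale/= /cosh; ring.
Qed.

Lemma cosh_sinh x : cosh x ^+ 2 - sinh x ^+ 2 = 1.
Proof.
rewrite /cosh /sinh; have e : expR x * expR (- x) = 1 by rewrite -expRD subrr expR0.
transitivity (expR x * expR (- x)); last by [].
by field.
Qed.

Lemma sinh_ge x : x ^+ 2 / 2 <= x * sinh x.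
Proof.
wlog x0 : x / 0 <= x.
  move=> h; have [/h//|x0] := leP 0 x.
  have := h (- x); rewrite oppr_ge0 => /(_ (ltW x0)).
  by rewrite /sinh opprK sqrrN; lra.
have h1 : 1 + x <= expR x by exact: expR_ge1Dx.
have h2 : expR (- x) <= 1 by rewrite -expR0 ler_expR oppr_le0.
by rewrite /sinh; nra.
Qed.

Lemma cosh_ge x : 1 + x ^+ 2 / 8 <= cosh x.
Proof.
have h := sinh_ge (x / 2); have [->|x0] := eqVneq x 0.
  by rewrite /cosh oppr0 expR0; lra.
have e : cosh x = 1 + 2 * sinh (x / 2) ^+ 2.
  rewrite /cosh /sinh; have e1 : expR x = expR (x / 2) ^+ 2 by rewrite expr2 -expRD -splitr.
  have e2 : expR (- x) = expR (- (x / 2)) ^+ 2 by rewrite expr2 -expRD -opprD -splitr.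
  have e3 : expR (x / 2) * expR (- (x / 2)) = 1 by rewrite -expRD subrr expR0.
  rewrite e1 e2; move: e3; set p := expR (x / 2); set q := expR (- (x / 2)) => pq.
  by transitivity (p * q + 2 * ((p - q) / 2) ^+ 2); [field|rewrite pq].
have x2 : 0 < (x / 2) ^+ 2 by rewrite exprn_even_gt0//= mulf_neq0.
have h2 : ((x / 2) ^+ 2 / 2) ^+ 2 <= ((x / 2) * sinh (x / 2)) ^+ 2.
  by rewrite lerXn2r ?nnegrE// ?(le_trans _ h)// divr_ge0// ltW.
have h3 : ((x / 2) ^+ 2) / 4 <= sinh (x / 2) ^+ 2.
  rewrite -(ler_pM2l x2); move: h2; rewrite !exprMn; lra.
by rewrite e; lra.
Qed.

(** The case of exponential decay; [be = sqrt (c^2 + gam k2)] is the amplitude of the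
    hyperbolic cosine, and [c < be] keeps [D] positive. *)
Lemma profile_hyperbolic k2 c gam be : 0 < k2 -> 0 < be -> c < be ->
  be ^+ 2 = c ^+ 2 + gam * k2 ->
  let k := Num.sqrt k2 in
  profile k2 c gam (fun x => (be * cosh (k * x) - c) / (2 * k2))
    (fun x => be * sinh (k * x) / (2 * k)) (Num.min ((be - c) / (2 * k2)) (be / 16)).
Proof.
move=> k20 be0 cbe be2 k.
have k0 : 0 < k by rewrite sqrtr_gt0.
have kk : k2 = k ^+ 2 by rewrite sqr_sqrtr// ltW.
have dk x : is_derive x 1 (fun s : R => k * s) k.
  by apply: is_derive_eq; rewrite /GRing.scale/=; ring.
have dcosh x : is_derive x 1 (fun s => cosh (k * s)) (sinh (k * x) * k).
  exact: (@is_derive1_comp R (@cosh R) (fun s => k * s) x _ _ (is_derive_cosh _) (dk x)).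
have dsinh x : is_derive x 1 (fun s => sinh (k * s)) (cosh (k * x) * k).
  exact: (@is_derive1_comp R sinh (fun s => k * s) x _ _ (is_derive_sinh _) (dk x)).
have ep : 0 < Num.min ((be - c) / (2 * k2)) (be / 16).
  by rewrite lt_min !divr_gt0 ?mulr_gt0 ?subr_gt0.
have kn : k != 0 by rewrite gt_eqF.
split => //.
- exact: ltW.
- move=> x; apply: is_derive_eq.
  by rewrite /GRing.scale/= kk; field.
- move=> x; apply: is_derive_eq.
  by rewrite /GRing.scale/= kk; field.
- move=> x; have e := cosh_sinh (k * x).
  have -> : gam = (be ^+ 2 - c ^+ 2) / k ^+ 2 by rewrite be2 kk; field.
  have -> : (be * sinh (k * x) / (2 * k)) ^+ 2 = be ^+ 2 * sinh (k * x) ^+ 2 / (4 * k ^+ 2) by field.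
  have -> : sinh (k * x) ^+ 2 = cosh (k * x) ^+ 2 - 1 by rewrite -e; ring.
  by rewrite kk; field.
- move=> x; have h := cosh_ge (k * x).
  have h1 : Num.min ((be - c) / (2 * k2)) (be / 16) <= (be - c) / (2 * k2) by rewrite ge_min lexx.
  have h2 : Num.min ((be - c) / (2 * k2)) (be / 16) <= be / 16 by rewrite ge_min lexx orbT.
  have x2 := sqr_ge0 x; have h3 := ler_wpM2r x2 h2.
  have h4 : (be - c) / (2 * k2) + be / 16 * x ^+ 2 <= (be * cosh (k * x) - c) / (2 * k2).
    have -> : (be - c) / (2 * k2) + be / 16 * x ^+ 2
      = (be * (1 + (k * x) ^+ 2 / 8) - c) / (2 * k2) by rewrite kk; field.
    by rewrite ler_pM2r ?invr_gt0 ?mulr_gt0// lerB// ler_pM2l.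
  by apply: le_trans h4; rewrite mulrDr mulr1 lerD.
- move=> x; have h := sinh_ge (k * x).
  have h2 : Num.min ((be - c) / (2 * k2)) (be / 16) <= be / 16 by rewrite ge_min lexx orbT.
  have x2 := sqr_ge0 x; have h3 := ler_wpM2r x2 h2.
  apply: le_trans h3 _.
  have -> : x * (be * sinh (k * x) / (2 * k)) = be / (2 * k ^+ 2) * (k * x * sinh (k * x)) by field.
  apply: (@le_trans _ _ (be / (2 * k ^+ 2) * ((k * x) ^+ 2 / 2))).
    have -> : be / (2 * k ^+ 2) * ((k * x) ^+ 2 / 2) = be / 4 * x ^+ 2 by field.
    by rewrite ler_wpM2r//; lra.
  by rewrite ler_wpM2l// divr_ge0 ?mulr_ge0 ?ltW// exprn_gt0.
- by rewrite mulr0 /sinh oppr0 subrr mul0r mulr0 mul0r.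
- rewrite mulr0 /cosh oppr0 expR0.
  have -> : k2 * ((be * ((1 + 1) / 2) - c) / (2 * k2)) + c / 2 = be / 2 by rewrite kk; field.
  by rewrite divr_gt0.
Qed.

Lemma profile_algebraic c gam : 0 < c -> 0 < gam ->
  profile 0 c gam (fun x => ((c * x) ^+ 2 + gam) / (4 * c)) (fun x => c / 2 * x)
    (Num.min (gam / (4 * c)) (c / 4)).
Proof.
move=> c0 g0; have cn : c != 0 by rewrite gt_eqF.
have h1 : Num.min (gam / (4 * c)) (c / 4) <= gam / (4 * c) by rewrite ge_min lexx.
have h2 : Num.min (gam / (4 * c)) (c / 4) <= c / 4 by rewrite ge_min lexx orbT.
split => //.
- move=> x; apply: is_derive_eq.
  by rewrite /GRing.scale/=; field.
- move=> x; apply: is_derive_eq.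
  by rewrite /GRing.scale/=; ring.
- by move=> x; field.
- by rewrite lt_min !divr_gt0 ?mulr_gt0.
- move=> x; have x2 := sqr_ge0 x; have h3 := ler_wpM2r x2 h2.
  have -> : ((c * x) ^+ 2 + gam) / (4 * c) = gam / (4 * c) + c / 4 * x ^+ 2 by field.
  by rewrite mulrDr mulr1 lerD.
- move=> x; have x2 := sqr_ge0 x; have h3 := ler_wpM2r x2 h2.
  have x3 : 0 <= c * x ^+ 2 by rewrite mulr_ge0// ltW.
  have -> : x * (c / 2 * x) = c / 2 * x ^+ 2 by ring.
  by lra.
- by rewrite mulr0.
- by rewrite mul0r add0r divr_gt0.
Qed.

(** For [|c| < 2 sqrt omega] admissibility makes [c^2 + gamma (4 omega - c^2)] positive
    with a square root above [c]: if [- 3 / 16 < b] because [gamma] is positive, and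
    otherwise because the bound by [kappa_star] rearranges to this positivity while [c] is
    negative. *)
Lemma soliton_profile b omega c : admissible b omega c ->
  exists (D D1 : R -> R) (eps : R),
    [/\ profile (4 * omega - c ^+ 2) c (gamma b) D D1 eps,
        forall x, Phi b omega c x = Num.sqrt (D x)^-1 &
        c < 2 * Num.sqrt omega -> 0 < 4 * omega - c ^+ 2].
Proof.
move=> [om0 [hb1 hb2]].
set s := Num.sqrt omega in hb1 hb2 *.
have s0 : 0 < s by rewrite sqrtr_gt0.
have ss : omega = s ^+ 2 by rewrite sqr_sqrtr// ltW.
have [cs|cs] := ltP `|c| (2 * s).
  have k20 : 0 < 4 * omega - c ^+ 2.
    have : `|c| ^+ 2 < (2 * s) ^+ 2 by rewrite ltrXn2r ?nnegrE// mulr_ge0// ltW.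
    by rewrite real_normK ?num_real// ss; lra.
  set k2 := 4 * omega - c ^+ 2 in k20 *.
  have [B0 cB] : 0 < c ^+ 2 + gamma b * k2 /\ (c < Num.sqrt (c ^+ 2 + gamma b * k2)).
    have [bb|bb] := ltP (- 3 / 16) b.
      have g0 : 0 < gamma b by rewrite /gamma; lra.
      have gk : 0 < gamma b * k2 by rewrite mulr_gt0.
      split; first by have := sqr_ge0 c; lra.
      rewrite (le_lt_trans (ler_norm c))// -sqrtr_sqr ltr_sqrt; last by have := sqr_ge0 c; lra.
      lra.
    have [_ hc] := hb2 bb.
    have g0 : gamma b <= 0 by rewrite /gamma; lra.
    have r0 : 0 <= - gamma b / (1 - gamma b) by rewrite divr_ge0; lra.
    have ks : kappa_star b ^+ 2 = - gamma b / (1 - gamma b) by rewrite /kappa_star sqr_sqrtr.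
    have k0 : 0 <= kappa_star b by rewrite sqrtr_ge0.
    have c0 : c < 0 by apply: lt_le_trans hc _; rewrite mulNr mulNr oppr_le0 !mulr_ge0// ltW.
    have hc2 : 4 * kappa_star b ^+ 2 * s ^+ 2 < c ^+ 2.
      have h : (2 * kappa_star b * s) ^+ 2 < (- c) ^+ 2.
        by rewrite ltrXn2r ?nnegrE ?mulr_ge0 ?oppr_ge0 ?(ltW c0) ?(ltW s0)//; lra.
      by move: h; rewrite sqrrN; lra.
    have B : 0 < c ^+ 2 + gamma b * k2.
      have g1 : 0 < 1 - gamma b by lra.
      move: hc2; rewrite ks -ss => hc2.
      have : - gamma b * (4 * omega) < c ^+ 2 * (1 - gamma b).
        have := hc2; rewrite -(ltr_pM2r g1).
        have -> : 4 * (- gamma b / (1 - gamma b)) * omega * (1 - gamma b) = - gamma b * (4 * omega).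
          by field; rewrite gt_eqF.
        by [].
      by rewrite /k2; lra.
    by split => //; apply: lt_le_trans c0 _; rewrite sqrtr_ge0.
  set be := Num.sqrt _ in cB.
  have be0 : 0 < be by rewrite sqrtr_gt0.
  have be2 : be ^+ 2 = c ^+ 2 + gamma b * k2 by rewrite sqr_sqrtr// ltW.
  have pr := profile_hyperbolic k20 be0 cB be2.
  exists (fun x => (be * cosh (Num.sqrt k2 * x) - c) / (2 * k2)),
    (fun x => be * sinh (Num.sqrt k2 * x) / (2 * Num.sqrt k2)),
    (Num.min ((be - c) / (2 * k2)) (be / 16)); split => //.
  move=> x; rewrite /Phi -/s cs -/k2 -/be; congr Num.sqrt.
  by rewrite invf_div.
have bb : - 3 / 16 < b.
  rewrite ltNge; apply/negP => bb; have [h1 h2] := hb2 bb.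
  have k0 : 0 <= kappa_star b by rewrite sqrtr_ge0.
  have c0 : c < 0 by apply: lt_le_trans h2 _; rewrite mulNr mulNr oppr_le0 !mulr_ge0// ltW.
  by move: cs; rewrite ltr0_norm//; lra.
have [h1 h2] := hb1 bb.
have cE : c = 2 * s.
  apply/eqP; rewrite eq_le h2/=; move: cs; rewrite ler_normr => /orP[//|]; lra.
have c0 : 0 < c by rewrite cE mulr_gt0.
have g0 : 0 < gamma b by rewrite /gamma; lra.
have k2 : 4 * omega - c ^+ 2 = 0 by rewrite cE ss; ring.
exists (fun x => ((c * x) ^+ 2 + gamma b) / (4 * c)), (fun x => c / 2 * x),
  (Num.min (gamma b / (4 * c)) (c / 4)); split.
- by rewrite k2; exact: profile_algebraic.
- by move=> x; rewrite /Phi -/s ltNge cs/= invf_div.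
- by rewrite cE ltxx.
Qed.

End Profile.

(** * Logarithmic derivatives and potentials of the profile *)

Section BoundedContinuous.
Context {R : realType}.
Local Notation mu := (@lebesgue_measure R).
Local Notation RT := (measurableTypeR R).
Implicit Types (k l f g : R -> R).

Definition bc k := continuous k /\ exists M, forall x, `|k x| <= M.

Lemma bc_cst (a : R) : bc (fun=> a).
Proof. by split; [move=> x; exact: cvg_cst|exists `|a|]. Qed.

Lemma bcD k l : bc k -> bc l -> bc (fun x => k x + l x).
Proof.
move=> [ck [M hM]] [cl [N hN]]; split; first by move=> x; apply: cvgD; [exact: ck|exact: cl].
by exists (M + N) => x; rewrite (le_trans (ler_normD _ _))// lerD.
Qed.

Lemma bcM k l : bc k -> bc l -> bc (fun x => k x * l x).
Proof.
move=> [ck [M hM]] [cl [N hN]]; split; first by move=> x; apply: cvgM; [exact: ck|exact: cl].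
by exists (M * N) => x; rewrite normrM ler_pM.
Qed.

Lemma bcN k : bc k -> bc (fun x => - k x).
Proof.
move=> [ck [M hM]]; split; first by move=> x; apply: cvgN; exact: ck.
by exists M => x; rewrite normrN.
Qed.

Lemma bcB k l : bc k -> bc l -> bc (fun x => k x - l x).
Proof. by move=> hk hl; apply: bcD => //; exact: bcN. Qed.

Lemma bc_measurable k : bc k -> measurable_fun [set: RT] k.
Proof. by move=> [ck _]; exact: continuous_measurable. Qed.

Lemma bc_L2 k f : bc k -> L2on setT f -> L2on setT (fun x => k x * f x).
Proof.
move=> hk hf; have [_ [M hM]] := hk.
by apply: (L2onM_bounded (M := M)) => //; exact: bc_measurable.
Qed.

Lemma bc_L1 k f : bc k -> L1on setT f -> L1on setT (fun x => k x * f x).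
Proof.
move=> hk hf; have [_ [M hM]] := hk.
by apply: (L1onM_bounded (M := M)) => //; exact: bc_measurable.
Qed.

Lemma bounded_cvg0 k (u : nat -> R) (s : nat -> R) : bc k -> u @ \oo --> (0 : R) ->
  (fun n => k (s n) * u n) @ \oo --> (0 : R).
Proof.
move=> [_ [M hM]] /cvgr0Pnorm_le cu; apply/cvgr0Pnorm_le => e e0.
have M1 : 0 < `|M| + 1 by rewrite ltr_wpDl.
near=> n; have h : `|u n| <= e / (`|M| + 1) by near: n; apply: cu; rewrite divr_gt0.
rewrite normrM (le_trans (ler_pM _ _ (hM (s n)) h))//.
by rewrite mulrCA ger_pMr// ler_pdivrMr// mul1r; have := ler_norm M; lra.
Unshelve. all: by end_near. Qed.

(** Integrating the derivative of a product [k f g] over the line gives zero;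
    all first-order asymmetries of the linearized operator have this form. *)
Lemma total_derivative (k k1 f fd g gd : R -> R) :
  (forall x : R, is_derive x 1 k (k1 x)) -> bc k -> bc k1 -> rH1 f fd -> rH1 g gd ->
  L1on setT (fun x => k1 x * (f x * g x) + k x * (fd x * g x + f x * gd x)) /\
  \int[mu]_x (k1 x * (f x * g x) + k x * (fd x * g x + f x * gd x)) = 0.
Proof.
move=> dk bk bk1 hf hg.
have [f2 fd2 ACf] := hf; have [g2 gd2 ACg] := hg.
have i : L1on setT (fun x => k1 x * (f x * g x) + k x * (fd x * g x + f x * gd x)).
  apply: L1onD => //; apply: bc_L1 => //; first exact: L2onM.
  by apply: L1onD => //; exact: L2onM.
split => //.
have AT : ACR (fun x => k x * (f x * g x)) (fun x => k1 x * (f x * g x) + k x * (fd x * g x + f x * gd x)).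
  move=> a b; apply: ACM; last exact: ACM.
  by apply: C1_AC => x _ _; exact: bk1.1.
have c1 : (fun n => k n%:R * (f n%:R * g n%:R)) @ \oo --> (0 : R).
  apply: bounded_cvg0 => //; rewrite -[X in _ --> X](mulr0 (0 : R)).
  by apply: cvgM; [exact: rH1_cvgy hf|exact: rH1_cvgy hg].
have c2 : (fun n => k (- n%:R) * (f (- n%:R) * g (- n%:R))) @ \oo --> (0 : R).
  apply: bounded_cvg0 => //; rewrite -[X in _ --> X](mulr0 (0 : R)).
  by apply: cvgM; [exact: rH1_cvgNy hf|exact: rH1_cvgNy hg].
exact: Rintegral_derivative AT i c1 c2.
Qed.

Lemma oneDsqrV_L1 : L1on setT (fun x : R => (1 + x ^+ 2)^-1).
Proof.
have c : continuous (fun x : R => (1 + x ^+ 2)^-1) by exact: continuous_oneDsqrV.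
apply/integrableP; split; first by apply/measurable_EFinP; exact: continuous_measurable.
have p (x : R) : 0 <= (1 + x ^+ 2)^-1 by rewrite invr_ge0 addr_ge0// sqr_ge0.
pose h (x : R) : R := (1 + x ^+ 2)^-1.
rewrite (@eq_integral _ _ _ mu _ (EFin \o h)); last first.
  by move=> x _; rewrite /= ger0_norm.
rewrite (@ge0_symfun_integralT _ h)//; last first.
  by move=> x; rewrite /h/= sqrrN.
have -> : [set x : R | 0 <= x] = `[0, +oo[%classic.
  by apply/seteqP; split=> x /=; rewrite in_itv/= andbT.
have := @integral0y_oneDsqr R; rewrite /oneDsqr -/h => ->.
by rewrite -EFinM ltry.
Qed.

Lemma is_derive_continuous k k1 : (forall x : R, is_derive x 1 k (k1 x)) -> continuous k.
Proof.
move=> dk x; apply/differentiable_continuous/derivable1_diffP; by have := dk x; case.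
Qed.

End BoundedContinuous.

Section ProfileConsequences.
Context {R : realType}.
Local Notation mu := (@lebesgue_measure R).
Local Notation RT := (measurableTypeR R).
Variables (k2 c gam : R) (D D1 : R -> R) (eps : R).
Hypothesis pr : profile k2 c gam D D1 eps.
Implicit Types (x : R).

(** [U] is the squared modulus, [P] the modulus; [q0 = P' / P], [V = P'' / P],
    [Vp = P''' / P'] and [q = P'' / P'] are the logarithmic derivatives and
    potentials that occur in the factorizations. *)
Definition Uf (x : R) := (D x)^-1.
Definition Pf (x : R) := Num.sqrt (D x)^-1.
Definition q0f (x : R) := - (D1 x / (2 * D x)).
Definition Vf (x : R) := k2 / 4 + c / 2 * Uf x - 3 / 16 * gam * Uf x ^+ 2.
Definition Vpf (x : R) := k2 / 4 + 3 / 2 * c * Uf x - 15 / 16 * gam * Uf x ^+ 2.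
Definition qf (x : R) := (k2 * D x + c / 2) / D1 x - 3 / 2 * (D1 x / D x).
Definition P1f x := q0f x * Pf x.
Definition P2f x := Vf x * Pf x.
Definition th1f x := c / 2 - Uf x / 4.
Definition th2f x := D1 x / (4 * D x ^+ 2).

Lemma D_gt0 x : 0 < D x.
Proof.
have h := profile_lb pr x; have e := profile_eps pr.
by apply: lt_le_trans h; rewrite mulr_gt0// ltr_wpDr// sqr_ge0.
Qed.

Lemma D_neq0 x : D x != 0.
Proof. by rewrite gt_eqF// D_gt0. Qed.

Lemma U_gt0 x : 0 < Uf x.
Proof. by rewrite invr_gt0 D_gt0. Qed.

Lemma P_gt0 x : 0 < Pf x.
Proof. by rewrite sqrtr_gt0 U_gt0. Qed.

Lemma P_sqr x : Pf x ^+ 2 = Uf x.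
Proof. by rewrite sqr_sqrtr// ltW// U_gt0. Qed.

Lemma U_derive x : is_derive x 1 Uf (- (D1 x / D x ^+ 2)).
Proof.
have h1 := profile_D pr x.
have h := @is_deriveV R D x _ 1 (D_neq0 x) h1.
by apply: (is_derive_eq h); rewrite /GRing.scale/= mulNr mulrC.
Qed.

Lemma P_derive x : is_derive x 1 Pf (P1f x).
Proof.
have h := @is_derive1_comp R Num.sqrt Uf x _ _ (is_derive1_sqrt (U_gt0 x)) (U_derive x).
apply: (is_derive_eq h); rewrite /P1f /q0f -/(Pf x).
have p0 := P_gt0 x; have pn : Pf x != 0 by rewrite gt_eqF.
have -> : D1 x / (2 * D x) = D1 x * Uf x / 2 by rewrite /Uf; field; exact: D_neq0.
have -> : D1 x / D x ^+ 2 = D1 x * Uf x ^+ 2 by rewrite /Uf; field; exact: D_neq0.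
by rewrite -P_sqr; field.
Qed.

Lemma q0_derive x : is_derive x 1 q0f (Vf x - q0f x ^+ 2).
Proof.
have h1 := profile_D pr x; have h2 := profile_D1 pr x.
have e := profile_energy pr x.
have hV : is_derive x 1 (fun s => (D s)^-1) (- (D1 x / D x ^+ 2)) := U_derive x.
have h : is_derive x 1 (fun s => - 2^-1 * (D1 s * (D s)^-1)) (Vf x - q0f x ^+ 2).
  apply: is_derive_eq; rewrite /GRing.scale/= /Vf /q0f /Uf.
  have -> : (- (D1 x / (2 * D x))) ^+ 2 = D1 x ^+ 2 / (4 * D x ^+ 2) by field; exact: D_neq0.
  have -> : - 2^-1 * (D1 x * - (D1 x / D x ^+ 2) + (D x)^-1 * (k2 * D x + c / 2))
    = D1 x ^+ 2 / (2 * D x ^+ 2) - (k2 * D x + c / 2) / (2 * D x).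
    by field; exact: D_neq0.
  by rewrite e; field; exact: D_neq0.
have fE : (fun s => - 2^-1 * (D1 s * (D s)^-1)) = q0f.
  by apply/funext => s; rewrite /q0f; field; exact: D_neq0.
by rewrite fE in h.
Qed.

Lemma P1_derive x : is_derive x 1 P1f (P2f x).
Proof.
have h1 := q0_derive x; have h2 := P_derive x.
by apply: is_derive_eq; rewrite /GRing.scale/= /P2f /P1f; ring.
Qed.

Lemma V_derive x : is_derive x 1 Vf (- (D1 x / D x ^+ 2) * (c / 2 - 3 / 8 * gam * Uf x)).
Proof.
have h := U_derive x; rewrite /Vf; apply: is_derive_eq.
by rewrite /GRing.scale/=; field; exact: D_neq0.
Qed.

Lemma P2_derive x : is_derive x 1 P2f (Vpf x * P1f x).
Proof.
have h1 := V_derive x; have h2 := P_derive x.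
apply: is_derive_eq; rewrite /GRing.scale/= /P1f.
have -> : q0f x = - (D1 x * Uf x / 2) by rewrite /q0f /Uf; field; exact: D_neq0.
have -> : D1 x / D x ^+ 2 = D1 x * Uf x ^+ 2 by rewrite /Uf; field; exact: D_neq0.
by rewrite /Vf /Vpf; field.
Qed.

Lemma th1_derive x : is_derive x 1 th1f (th2f x).
Proof.
have h := U_derive x; rewrite /th1f; apply: is_derive_eq.
by rewrite /GRing.scale/= /th2f; field; exact: D_neq0.
Qed.

Lemma D1_neq0 x : x != 0 -> D1 x != 0.
Proof.
move=> x0; have h := profile_D1_lb pr x; apply/eqP => e; move: h; rewrite e mulr0.
by apply/negP; rewrite -ltNge mulr_gt0 ?(profile_eps pr)// exprn_even_gt0.
Qed.

Lemma q_derive x : x != 0 -> is_derive x 1 qf (Vpf x - qf x ^+ 2).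
Proof.
move=> x0; have n1 := D1_neq0 x0; have n2 := D_neq0 x.
have h1 := profile_D pr x; have h2 := profile_D1 pr x.
have e := profile_energy pr x.
have hU : is_derive x 1 (fun s => (D s)^-1) (- (D1 x / D x ^+ 2)) := U_derive x.
have hW : is_derive x 1 (fun s => (D1 s)^-1) (- ((k2 * D x + c / 2) / D1 x ^+ 2)).
  have h := @is_deriveV R D1 x _ 1 n1 h2.
  by apply: (is_derive_eq h); rewrite /GRing.scale/= mulNr mulrC.
rewrite /qf; apply: is_derive_eq; rewrite /GRing.scale/= /Vpf /Uf.
set E := k2 * D x + c / 2; set z := D1 x in n1 e *; set y := D x in n2 e E *.
transitivity (k2 - (E / z) ^+ 2 - 3 / 2 * (E / y) + 3 / 2 * (z ^+ 2 / y ^+ 2)).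
  by rewrite /E; field; rewrite n1 n2.
transitivity (k2 / 4 + 3 / 2 * c * y^-1 - 15 / 16 * gam * y^-1 ^+ 2 - (E / z) ^+ 2
    + 3 * (E / y) - 9 / 4 * (z ^+ 2 / y ^+ 2)); last first.
  by rewrite /E; field; rewrite n1 n2.
by rewrite e; move: ((E / z) ^+ 2) => s; rewrite /E; field.
Qed.

Lemma q0_sqr x : q0f x ^+ 2 = k2 / 4 + c / 4 * Uf x - gam / 16 * Uf x ^+ 2.
Proof.
have e := profile_energy pr x; have n := D_neq0 x.
have -> : q0f x ^+ 2 = D1 x ^+ 2 / (4 * D x ^+ 2) by rewrite /q0f; field.
by rewrite e /Uf; field.
Qed.

Lemma U_decay x : Uf x <= eps^-1 * (1 + x ^+ 2)^-1.
Proof.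
have e0 := profile_eps pr; have x1 : 0 < 1 + x ^+ 2 by rewrite ltr_wpDr// sqr_ge0.
by rewrite -invfM lef_pV2 ?posrE ?D_gt0 ?mulr_gt0// (profile_lb pr).
Qed.

Lemma U_bound x : Uf x <= eps^-1.
Proof.
apply: le_trans (U_decay x) _; rewrite ger_pMr ?invr_gt0 ?(profile_eps pr)//.
by rewrite invf_le1 ?lerDl ?sqr_ge0// ltr_wpDr// sqr_ge0.
Qed.

Lemma U_bc : bc Uf.
Proof.
split; first exact: is_derive_continuous U_derive.
by exists eps^-1 => x; rewrite ger0_norm ?U_bound// ltW// U_gt0.
Qed.

Lemma sqr_bound (a b : R) : 0 <= b -> a ^+ 2 <= b -> `|a| <= b + 1.
Proof.
move=> b0 h; rewrite -(@ler_pXn2r _ 2) ?nnegrE ?addr_ge0// real_normK ?num_real//; nra.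
Qed.

Lemma bounded_sqr (k l : R -> R) : bc l -> (forall x, k x ^+ 2 <= l x) -> exists M, forall x, `|k x| <= M.
Proof.
move=> [_ [M hM]] h; exists (`|M| + 1) => x; apply: sqr_bound => //.
by rewrite (le_trans (h x))// (le_trans (ler_norm _))// (le_trans (hM x))// ler_norm.
Qed.

Lemma q0_bc : bc q0f.
Proof.
split; first exact: is_derive_continuous q0_derive.
apply: (@bounded_sqr _ (fun x => k2 / 4 + c / 4 * Uf x - gam / 16 * Uf x ^+ 2)).
  apply: bcB; first by apply: bcD; [exact: bc_cst|apply: bcM; [exact: bc_cst|exact: U_bc]].
  by apply: bcM; [exact: bc_cst|apply: bcM; exact: U_bc].
by move=> x; rewrite q0_sqr.
Qed.

Lemma P_bc : bc Pf.
Proof.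
split; first exact: is_derive_continuous P_derive.
by apply: (@bounded_sqr _ Uf); [exact: U_bc|move=> x; rewrite P_sqr].
Qed.

Lemma V_bc : bc Vf.
Proof.
apply: bcB; first by apply: bcD; [exact: bc_cst|apply: bcM; [exact: bc_cst|exact: U_bc]].
by apply: bcM; [exact: bc_cst|apply: bcM; exact: U_bc].
Qed.

Lemma Vp_bc : bc Vpf.
Proof.
apply: bcB; first by apply: bcD; [exact: bc_cst|apply: bcM; [exact: bc_cst|exact: U_bc]].
by apply: bcM; [exact: bc_cst|apply: bcM; exact: U_bc].
Qed.

Lemma th1_bc : bc th1f.
Proof.
by apply: bcB; [exact: bc_cst|apply: bcM; [exact: U_bc|exact: bc_cst]].
Qed.

Lemma th2E x : th2f x = - (Uf x * q0f x / 2).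
Proof. by rewrite /th2f /Uf /q0f; field; exact: D_neq0. Qed.

Lemma th2_bc : bc th2f.
Proof.
have -> : th2f = fun x => - (Uf x * q0f x * 2^-1) by apply/funext => x; exact: th2E.
by apply: bcN; apply: bcM; [apply: bcM; [exact: U_bc|exact: q0_bc]|exact: bc_cst].
Qed.

Lemma U_L1 : L1on setT Uf.
Proof.
apply: (L1on_le _ _ _ (L1onZ eps^-1 measurableT oneDsqrV_L1)) => //.
  exact: bc_measurable U_bc.
by move=> x _; rewrite ger0_norm ?U_decay// ltW// U_gt0.
Qed.

Lemma P_L2 : L2on setT Pf.
Proof.
split; first exact: bc_measurable P_bc.
by apply: L1on_eq U_L1 => x _; rewrite P_sqr.
Qed.

Lemma P_rH1 : rH1 Pf P1f.
Proof.
split; [exact: P_L2|apply: bc_L2; [exact: q0_bc|exact: P_L2]|].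
move=> a b; apply: C1_AC => x _ _; first exact: P_derive.
exact: (is_derive_continuous P1_derive).
Qed.

Lemma P1_rH1 : rH1 P1f P2f.
Proof.
have [_ h _] := P_rH1; split => //; first by apply: bc_L2; [exact: V_bc|exact: P_L2].
move=> a b; apply: C1_AC => x _ _; first exact: P1_derive.
exact: (is_derive_continuous P2_derive).
Qed.

Lemma P2_rH1 : rH1 P2f (fun x => Vpf x * P1f x).
Proof.
have [_ h0 _] := P_rH1; have [_ h _] := P1_rH1; split => //.
  by apply: bc_L2; [exact: Vp_bc|exact: h0].
move=> a b; apply: C1_AC => x _ _; first exact: P2_derive.
by apply: cvgM; [exact: Vp_bc.1|exact: (is_derive_continuous P1_derive)].
Qed.

Lemma P1_0 : P1f 0 = 0.
Proof. by rewrite /P1f /q0f (profile_D10 pr) mul0r oppr0 mul0r. Qed.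

(** The modulus has a nondegenerate maximum at the origin. *)
Lemma P2_0_lt0 : P2f 0 < 0.
Proof.
have e := profile_energy pr 0; rewrite (profile_D10 pr) expr0n/= in e.
have d0 := D_gt0 0; have n := D_neq0 0; have h := profile_D20 pr.
have -> : P2f 0 = - ((k2 * D 0 + c / 2) / (2 * D 0) * Pf 0).
  rewrite /P2f -mulNr; congr (_ * _); rewrite /Vf /Uf.
  have -> : gam = 4 * (k2 * D 0 ^+ 2 + c * D 0) by lra.
  by field.
by rewrite oppr_lt0 mulr_gt0 ?P_gt0// divr_gt0 ?mulr_gt0.
Qed.

Lemma qE x : x != 0 -> qf x * P1f x = P2f x.
Proof.
move=> x0; have n1 := D1_neq0 x0; have n2 := D_neq0 x; have e := profile_energy pr x.
rewrite /P1f /P2f mulrA; congr (_ * _); rewrite /qf /q0f /Vf /Uf.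
transitivity (- ((k2 * D x + c / 2) / (2 * D x)) + 3 / 4 * (D1 x ^+ 2 / D x ^+ 2)).
  by field; rewrite n1 n2.
by rewrite e; field.
Qed.

Lemma P1_neq0 x : x != 0 -> P1f x != 0.
Proof.
move=> x0; rewrite /P1f mulf_neq0 ?(gt_eqF (P_gt0 x))// /q0f oppr_eq0.
by rewrite mulf_neq0 ?D1_neq0// invr_eq0 mulf_neq0 ?D_neq0.
Qed.

(** [P''/P'] has at most a simple pole at the origin. *)
Lemma q_bound : exists C, forall x, x != 0 -> `|qf x| <= C * (1 + `|x|^-1).
Proof.
have [_ [M hM]] := q0_bc.
pose be2 := k2 * gam + c ^+ 2.
exists (1 + k2 + `|be2| / 4 / eps ^+ 2 + 3 * `|M|) => x x0.
have n1 := D1_neq0 x0; have n2 := D_neq0 x; have e := profile_energy pr x.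
have e0 := profile_eps pr; have k20 := profile_k2 pr.
have x1 : 0 < `|x| by rewrite normr_gt0.
have E2 : (k2 * D x + c / 2) ^+ 2 = k2 * D1 x ^+ 2 + be2 / 4 by rewrite e /be2; field.
have lb : eps ^+ 2 * x ^+ 2 <= D1 x ^+ 2.
  have h := profile_D1_lb pr x.
  have x2 : 0 < x ^+ 2 by rewrite exprn_even_gt0.
  have h2 : (eps * x ^+ 2) ^+ 2 <= (x * D1 x) ^+ 2.
    by rewrite lerXn2r ?nnegrE// ?(le_trans _ h)// mulr_ge0// ltW.
  by rewrite -(ler_pM2l x2); move: h2; rewrite !exprMn; lra.
have z2 : 0 < D1 x ^+ 2 by rewrite exprn_even_gt0.
have b4 : 0 <= `|be2| / 4 by rewrite divr_ge0.
have F : `|(k2 * D x + c / 2) / D1 x| <= (1 + k2 + `|be2| / 4 / eps ^+ 2) * (1 + `|x|^-1).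
  have xi : 0 < `|x|^-1 by rewrite invr_gt0.
  have B0 : 0 <= `|be2| / 4 / eps ^+ 2 by rewrite divr_ge0// exprn_ge0// ltW.
  rewrite -(@ler_pXn2r _ 2) ?nnegrE//; last by rewrite mulr_ge0// ?addr_ge0// ltW.
  rewrite real_normK ?num_real// expr_div_n E2 mulrDl mulfK ?gt_eqF//.
  have G : be2 / 4 / D1 x ^+ 2 <= `|be2| / 4 / eps ^+ 2 * `|x|^-1 ^+ 2.
    apply: (@le_trans _ _ (`|be2| / 4 / D1 x ^+ 2)).
      by rewrite ler_pM2r ?invr_gt0// ler_pM2r// ler_norm.
    rewrite exprVn real_normK ?num_real//.
    have -> : `|be2| / 4 / eps ^+ 2 / x ^+ 2 = `|be2| / 4 * (eps ^+ 2 * x ^+ 2)^-1.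
      by field; rewrite x0 gt_eqF.
    apply: ler_wpM2l => //.
    have x2 : 0 < x ^+ 2 by rewrite exprn_even_gt0.
    have ex : 0 < eps ^+ 2 * x ^+ 2 by rewrite mulr_gt0// exprn_gt0.
    by rewrite lef_pV2 ?posrE.
  move: G xi B0; move: (`|be2| / 4 / eps ^+ 2) (be2 / 4 / D1 x ^+ 2) (`|x|^-1) => B W y G y0 B0.
  set S := 1 + k2 + B; have S1 : 1 <= S by rewrite /S; lra.
  have T1 : 0 <= (1 + y) ^+ 2 by exact: sqr_ge0.
  have T2 : 1 + y ^+ 2 <= (1 + y) ^+ 2 by nra.
  have T3 : S * (1 + y ^+ 2) <= S * (S * (1 + y) ^+ 2).
    apply: ler_wpM2l; first lra.
    by apply: (le_trans T2); rewrite ler_peMl.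
  have T4 : k2 + B * y ^+ 2 <= S * (1 + y ^+ 2).
    have := mulr_ge0 k20 (sqr_ge0 y); rewrite /S; have := sqr_ge0 y; nra.
  rewrite exprMn expr2 -mulrA; lra.
have q0E : 3 / 2 * (D1 x / D x) = - (3 * q0f x) by rewrite /q0f; field.
rewrite /qf q0E opprK (le_trans (ler_normD _ _))//.
have -> : (1 + k2 + `|be2| / 4 / eps ^+ 2 + 3 * `|M|) * (1 + `|x|^-1) =
  (1 + k2 + `|be2| / 4 / eps ^+ 2) * (1 + `|x|^-1) + 3 * `|M| * (1 + `|x|^-1) by ring.
apply: lerD => //; rewrite normrM ger0_norm// -mulrA ler_pM2l//.
apply: le_trans (hM x) _; apply: le_trans (ler_norm _) _.
by rewrite -[leLHS]mulr1 ler_wpM2l// lerDl invr_ge0.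
Qed.

End ProfileConsequences.

(** * Polar coordinates along a phase *)

Section PolarForm.
Context {R : realType}.
Local Notation mu := (@lebesgue_measure R).
Local Notation RT := (measurableTypeR R).
Local Notation C := (Rcomplex R).
Local Notation Re := (@complex.Re R).
Local Notation Im := (@complex.Im R).
Variables (th th1 : R -> R).
Hypothesis dth : forall x : R, is_derive x 1 th (th1 x).
Hypothesis bth1 : bc th1.
Implicit Types (v w : R -> C) (x : R).

Local Notation cs x := (cos (th x)).
Local Notation sn x := (sin (th x)).

Lemma cs_derive x : is_derive x 1 (fun s => cs s) (- (sn x * th1 x)).
Proof.
have h := @is_derive1_comp R cos th x _ _ (is_derive_cos _) (dth x).
by apply: (is_derive_eq h); rewrite mulNr.
Qed.

Lemma sn_derive x : is_derive x 1 (fun s => sn s) (cs x * th1 x).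
Proof. exact: (@is_derive1_comp R sin th x _ _ (is_derive_sin _) (dth x)). Qed.

Lemma cs_bc : bc (fun x => cs x).
Proof.
split; first exact: (is_derive_continuous cs_derive).
by exists 1 => x; rewrite ler_norml cos_geN1 cos_le1.
Qed.

Lemma sn_bc : bc (fun x => sn x).
Proof.
split; first exact: (is_derive_continuous sn_derive).
by exists 1 => x; rewrite ler_norml sin_geN1 sin_le1.
Qed.

Lemma rH1M (k k1 u d : R -> R) : (forall x, is_derive x 1 k (k1 x)) -> bc k -> bc k1 ->
  rH1 u d -> rH1 (fun x => k x * u x) (fun x => k1 x * u x + k x * d x).
Proof.
move=> dk bk bk1 [h1 h2 h3]; split; first exact: bc_L2.
  by apply: L2onD => //; exact: bc_L2.
by move=> a b; apply: ACM => //; apply: C1_AC => x _ _; exact: bk1.1.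
Qed.

Lemma rH1D (u d w e : R -> R) : rH1 u d -> rH1 w e ->
  rH1 (fun x => u x + w x) (fun x => d x + e x).
Proof.
move=> hu hw; have := rH1_lin 1 hu hw.
by congr rH1; apply/funext => x; rewrite mul1r.
Qed.

Lemma rH1N (u d : R -> R) : rH1 u d -> rH1 (fun x => - u x) (fun x => - d x).
Proof.
move=> hu; have z : rH1 (fun=> 0 : R) (fun=> 0 : R).
  by split; [exact: L2on0|exact: L2on0|move=> a b; exact: AC_cst].
have := rH1_lin (-1) hu z.
by congr rH1; apply/funext => x; rewrite mulN1r addr0.
Qed.

Definition rot (a b x : R) : R[i] := (a * cs x - b * sn x) +i* (a * sn x + b * cs x).

(** [v = e^{i th} (f + i g)], with the covariant derivative
    [e^{- i th} v' = (fd - th' g) + i (gd + th' f)]. *)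
Definition polar v (f fd g gd : R -> R) := [/\ rH1 f fd, rH1 g gd,
  {ae mu, forall x : RT, v x = rot (f x) (g x) x} &
  {ae mu, forall x : RT, Dx v x = rot (fd x - th1 x * g x) (gd x + th1 x * f x) x}].

Lemma cs2sn2' x : cs x ^+ 2 = 1 - sn x ^+ 2.
Proof. by rewrite -(cos2Dsin2 (th x)) addrK. Qed.

Lemma polar_intro v (f fd g gd : R -> R) : L2 v -> rH1 f fd -> rH1 g gd ->
  {ae mu, forall x : RT, v x = rot (f x) (g x) x} -> H1 v /\ polar v f fd g gd.
Proof.
move=> Lv hf hg e.
have bcs' : bc (fun x => - (sn x * th1 x)) by apply: bcN; apply: bcM => //; exact: sn_bc.
have bsn' : bc (fun x => cs x * th1 x) by apply: bcM => //; exact: cs_bc.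
have h1 := rH1D (rH1M cs_derive cs_bc bcs' hf) (rH1N (rH1M sn_derive sn_bc bsn' hg)).
have h2 := rH1D (rH1M sn_derive sn_bc bsn' hf) (rH1M cs_derive cs_bc bcs' hg).
have [|Hv [_ _ _ e2]] := crep_intro Lv h1 h2.
  by apply: aeS e => x ->; rewrite /rot; congr (_ +i* _); ring.
split => //; split => //.
by apply: aeS e2 => x ->; rewrite /rot; congr (_ +i* _); ring.
Qed.

Lemma rot_L2 (f g : R -> R) : L2on setT f -> L2on setT g -> L2 (fun x => rot (f x) (g x) x).
Proof.
move=> hf hg; apply/L2P; split=> /=.
  apply: L2on_eq (L2onB measurableT (bc_L2 cs_bc hf) (bc_L2 sn_bc hg)) => x _; ring.
apply: L2on_eq (L2onD measurableT (bc_L2 sn_bc hf) (bc_L2 cs_bc hg)) => x _; ring.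
Qed.

Lemma polar_rot (f fd g gd : R -> R) : rH1 f fd -> rH1 g gd ->
  H1 (fun x => rot (f x) (g x) x) /\ polar (fun x => rot (f x) (g x) x) f fd g gd.
Proof.
move=> hf hg; apply: polar_intro => //; last exact: aeW.
by apply: rot_L2; [case: hf|case: hg].
Qed.

Lemma rotK (a b x : R) : a = cs x * Re (rot a b x) + sn x * Im (rot a b x) /\
  b = cs x * Im (rot a b x) - sn x * Re (rot a b x).
Proof.
have e := cs2sn2' x; rewrite /rot/=; split.
  transitivity (a * cs x ^+ 2 + a * sn x ^+ 2); last by ring.
  by rewrite e; ring.
transitivity (b * cs x ^+ 2 + b * sn x ^+ 2); last by ring.
by rewrite e; ring.
Qed.

Lemma polar_exists v : H1 v -> exists f fd g gd, polar v f fd g gd.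
Proof.
move=> Hv; have [u1 [d1 [u2 [d2 [h1 h2 e1 _]]]]] := crep_exists Hv.
have bcs' : bc (fun x => - (sn x * th1 x)) by apply: bcN; apply: bcM => //; exact: sn_bc.
have bsn' : bc (fun x => cs x * th1 x) by apply: bcM => //; exact: cs_bc.
have hf := rH1D (rH1M cs_derive cs_bc bcs' h1) (rH1M sn_derive sn_bc bsn' h2).
have hg := rH1D (rH1M cs_derive cs_bc bcs' h2) (rH1N (rH1M sn_derive sn_bc bsn' h1)).
eexists; eexists; eexists; eexists.
have [] := polar_intro (H1_L2 Hv) hf hg; last by move=> _; apply.
apply: aeS e1 => x ->; rewrite /rot; congr (_ +i* _).
  transitivity (u1 x * (cs x ^+ 2 + sn x ^+ 2)); last by ring.
  by rewrite cs2sn2' subrK mulr1.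
transitivity (u2 x * (cs x ^+ 2 + sn x ^+ 2)); last by ring.
by rewrite cs2sn2' subrK mulr1.
Qed.

Lemma rot_inj (a b a' b' x : R) : rot a b x = rot a' b' x -> a = a' /\ b = b'.
Proof.
move=> e; have [E1 E2] := rotK a b x; have [E3 E4] := rotK a' b' x.
by split; [rewrite E1 e -E3|rewrite E2 e -E4].
Qed.

Lemma polar_unique v (f fd g gd f' fd' g' gd' : R -> R) : polar v f fd g gd -> polar v f' fd' g' gd' ->
  f = f' /\ g = g'.
Proof.
move=> [[_ _ a1] [_ _ a2] e1 _] [[_ _ b1] [_ _ b2] e2 _].
have e : {ae mu, forall x : RT, f x = f' x /\ g x = g' x}.
  by apply: aeS (aeI e1 e2) => x [->]; exact: rot_inj.
have e3 : {ae mu, forall x : RT, f x = f' x} by apply: aeS e => x [].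
have e4 : {ae mu, forall x : RT, g x = g' x} by apply: aeS e => x [].
by have [-> _] := ACR_unique a1 b1 e3; have [-> _] := ACR_unique a2 b2 e4.
Qed.

Lemma polar_lin (a : R) v w (f1 fd1 g1 gd1 f2 fd2 g2 gd2 : R -> R) : H1 v -> H1 w ->
  polar v f1 fd1 g1 gd1 -> polar w f2 fd2 g2 gd2 ->
  polar (a *: v + w) (fun x => a * f1 x + f2 x) (fun x => a * fd1 x + fd2 x)
    (fun x => a * g1 x + g2 x) (fun x => a * gd1 x + gd2 x).
Proof.
move=> Hv Hw [h1 h2 e1 _] [h3 h4 e2 _].
have [|_] // := polar_intro (H1_L2 (H1_subspace_lin a Hv Hw)) (rH1_lin a h1 h3) (rH1_lin a h2 h4).
apply: aeS (aeI e1 e2) => x [E1 E2]; apply: complex_eqP; rewrite ?ReD ?ImD ?ReZ ?ImZ E1 E2 /rot/=; ring.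
Qed.

(** Polar data are unique except for the values of the derivatives on a null set, so
    selecting some of them is harmless. *)
Definition polar_data v : (R -> R) * (R -> R) * (R -> R) * (R -> R) :=
  xget (fun=> 0, fun=> 0, fun=> 0, fun=> 0) [set t | polar v t.1.1.1 t.1.1.2 t.1.2 t.2].

(** The components along [e^{i th}] and [i e^{i th}]. *)
Definition amp v := (polar_data v).1.1.1.
Definition aux v := (polar_data v).1.2.

Lemma polar_dataP v : H1 v ->
  polar v (amp v) (polar_data v).1.1.2 (aux v) (polar_data v).2.
Proof.
move=> /polar_exists[f [fd [g [gd h]]]].
exact: (xgetPex (fun=> 0, fun=> 0, fun=> 0, fun=> 0)
  (ex_intro [set t | polar v t.1.1.1 t.1.1.2 t.1.2 t.2] (f, fd, g, gd) h)).
Qed.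

Lemma polar_amp v (f fd g gd : R -> R) : polar v f fd g gd -> H1 v -> amp v = f /\ aux v = g.
Proof. by move=> h Hv; exact: polar_unique (polar_dataP Hv) h. Qed.

Lemma amp_linear x : linear_on (H1 : set (R -> C)) (fun v => amp v x).
Proof.
move=> a v w Hv Hw.
by have [-> _] := polar_amp (polar_lin a Hv Hw (polar_dataP Hv) (polar_dataP Hw))
  (H1_subspace_lin a Hv Hw).
Qed.

Lemma aux_linear x : linear_on (H1 : set (R -> C)) (fun v => aux v x).
Proof.
move=> a v w Hv Hw.
by have [_ ->] := polar_amp (polar_lin a Hv Hw (polar_dataP Hv) (polar_dataP Hw))
  (H1_subspace_lin a Hv Hw).
Qed.

Lemma rot_inner (a b a' b' x : R) :
  Re (rot a b x) * Re (rot a' b' x) + Im (rot a b x) * Im (rot a' b' x) = a * a' + b * b'.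
Proof.
rewrite /rot/=; transitivity ((a * a' + b * b') * (cs x ^+ 2 + sn x ^+ 2)); first by ring.
by rewrite cs2sn2' subrK mulr1.
Qed.

Lemma polar_inner v w (f1 fd1 g1 gd1 f2 fd2 g2 gd2 : R -> R) : H1 v -> H1 w ->
  polar v f1 fd1 g1 gd1 -> polar w f2 fd2 g2 gd2 ->
  inner v w = \int[mu]_x (f1 x * f2 x + g1 x * g2 x).
Proof.
move=> Hv Hw [[h1 _ _] [h2 _ _] e1 _] [[h3 _ _] [h4 _ _] e2 _].
rewrite (inner_ae (H1_L2 Hv) (rot_L2 h1 h2) (H1_L2 Hw) (rot_L2 h3 h4) e1 e2) innerE.
by apply: eq_Rintegral => x _; exact: rot_inner.
Qed.

Lemma polar_inner_Dx v w (f1 fd1 g1 gd1 f2 fd2 g2 gd2 : R -> R) : H1 v -> H1 w ->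
  polar v f1 fd1 g1 gd1 -> polar w f2 fd2 g2 gd2 ->
  inner (Dx v) (Dx w) = \int[mu]_x ((fd1 x - th1 x * g1 x) * (fd2 x - th1 x * g2 x)
     + (gd1 x + th1 x * f1 x) * (gd2 x + th1 x * f2 x)).
Proof.
move=> Hv Hw [[h1 k1 _] [h2 k2 _] _ e1] [[h3 k3 _] [h4 k4 _] _ e2].
have B1 := L2onB measurableT k1 (bc_L2 bth1 h2).
have B2 := L2onD measurableT k2 (bc_L2 bth1 h1).
have B3 := L2onB measurableT k3 (bc_L2 bth1 h4).
have B4 := L2onD measurableT k4 (bc_L2 bth1 h3).
rewrite (inner_ae (Dx_L2 Hv) (rot_L2 B1 B2) (Dx_L2 Hw) (rot_L2 B3 B4) e1 e2) innerE.
by apply: eq_Rintegral => x _; exact: rot_inner.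
Qed.

End PolarForm.

(** * The linearized operator in polar coordinates *)

Section LinearizedOperator.
Context {R : realType}.
Local Notation mu := (@lebesgue_measure R).
Local Notation RT := (measurableTypeR R).
Local Notation C := (Rcomplex R).
Local Notation Re := (@complex.Re R).
Local Notation Im := (@complex.Im R).
Variables (b omega c : R) (D D1 : R -> R) (eps : R).
Hypothesis pr : profile (4 * omega - c ^+ 2) c (gamma b) D D1 eps.
Hypothesis PhiE : forall x, Phi b omega c x = Pf D x.
Implicit Types (v w : R -> C) (x : R).

Local Notation th := (phase b omega c).
Local Notation U := (Uf D).
Local Notation P := (Pf D).
Local Notation P1 := (P1f D D1).
Local Notation P2 := (P2f (4 * omega - c ^+ 2) c (gamma b) D).
Local Notation q0 := (q0f D D1).
Local Notation V := (Vf (4 * omega - c ^+ 2) c (gamma b) D).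
Local Notation Vp := (Vpf (4 * omega - c ^+ 2) c (gamma b) D).
Local Notation th1 := (th1f c D).
Local Notation rot := (rot th).
Local Notation polar := (polar th th1).
Local Notation LL := (Lop b omega c).

Lemma phase_derive x : is_derive x 1 th (th1 x).
Proof.
have E : (fun y => Phi b omega c y ^+ 2) = U.
  by apply/funext => y; rewrite PhiE (P_sqr pr).
pose F y := \int[mu]_(s in `]-oo, y]) U s.
have hF : is_derive x 1 F (U x).
  have hL : L1on `]-oo, x + 1] U by exact: L1on_sub (U_L1 pr).
  have [h1 h2] := @continuous_FTC1 R U -oo%O x (x + 1) (ltac:(by rewrite ltrDl)) hL
    (ltac:(by rewrite ltNyr)) ((U_bc pr).1 x).
  by split; [exact: h1|rewrite -derive1E; exact: h2].
have -> : th = (fun y => c / 2 * y - 1 / 4 * F y).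
  apply/funext => y; rewrite /phase /F; congr (_ - _ * _).
  by apply: eq_Rintegral => s _; rewrite -E.
by apply: is_derive_eq; rewrite /GRing.scale/= /th1f; field.
Qed.

Let bth1 := th1_bc pr.
Let dth := phase_derive.

Lemma phi_rot x : phi b omega c x = rot (P x) 0 x.
Proof.
by rewrite /phi PhiE; apply: complex_eqP; rewrite ?ReM ?ImM /rot/=; ring.
Qed.

Lemma cderiv_phi x : cderiv (phi b omega c) x = rot (P1 x) (th1 x * P x) x.
Proof.
have hP := P_derive pr x; have hc := cs_derive dth x; have hs := sn_derive dth x.
rewrite /cderiv /rot; congr (_ +i* _).
  have h : is_derive x 1 (fun y => P y * cos (th y)) (P1 x * cos (th x) - th1 x * P x * sin (th x)).
    by apply: is_derive_eq; rewrite /GRing.scale/=; ring.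
  have -> : (fun y => Re (phi b omega c y)) = (fun y => P y * cos (th y)).
    by apply/funext => y; rewrite phi_rot /rot/=; ring.
  by rewrite derive1E; exact: (@derive_val _ _ _ _ _ _ _ h).
have h : is_derive x 1 (fun y => P y * sin (th y)) (P1 x * sin (th x) + th1 x * P x * cos (th x)).
  by apply: is_derive_eq; rewrite /GRing.scale/=; ring.
have -> : (fun y => Im (phi b omega c y)) = (fun y => P y * sin (th y)).
  by apply/funext => y; rewrite phi_rot /rot/=; ring.
by rewrite derive1E; exact: (@derive_val _ _ _ _ _ _ _ h).
Qed.

Lemma rot_iM (a a' x : R) : 'i * rot a a' x = rot (- a') a x.
Proof. by apply: complex_eqP; rewrite ?ReM ?ImM /rot/=; ring. Qed.

Lemma rot_realM (k a a' x : R) : k%:C * rot a a' x = rot (k * a) (k * a') x.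
Proof. by apply: complex_eqP; rewrite ?ReM ?ImM /rot/=; ring. Qed.

Lemma rotD (a a' e e' x : R) : rot a a' x + rot e e' x = rot (a + e) (a' + e') x.
Proof. by rewrite /rot; congr (_ +i* _); ring. Qed.

Lemma rotN (a a' x : R) : - rot a a' x = rot (- a) (- a') x.
Proof. by rewrite /rot; congr (_ +i* _); ring. Qed.

(** The components of [e^{- i th} Lrest v] when [e^{- i th} v = f + i g] and the covariant
    derivative of [v] is [A + i B]. *)
Definition Lrest_f (f B x : R) :=
  omega * f - c * B + U x * B + 2 * (P x * f) * (th1 x * P x)
  - b * U x ^+ 2 * f - 4 * b * U x * (P x * f) * P x.

Definition Lrest_g (f g A x : R) :=
  omega * g + c * A - U x * A - 2 * (P x * f) * P1 x - b * U x ^+ 2 * g.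

Lemma Lrest_rot v x (f g A B : R) : v x = rot f g x -> Dx v x = rot A B x ->
  Lrest b omega c v x = rot (Lrest_f f B x) (Lrest_g f g A x) x.
Proof.
rewrite /Lrest_f /Lrest_g.
move=> ev ed.
have r2 : (2 : R[i]) = (2 : R)%:C by rewrite rmorph_nat.
have r4 : (4 : R[i]) = (4 : R)%:C by rewrite rmorph_nat.
have e1 : ComplexField.Normc.normc (phi b omega c x) ^+ 2 = U x.
  rewrite phi_rot /rot/= sqr_sqrtr ?addr_ge0 ?sqr_ge0//.
  rewrite -(P_sqr pr) !mul0r subr0 addr0 !exprMn -mulrDr cos2Dsin2 mulr1//.
have e2 : Re (phi b omega c x * (v x)^*) = P x * f.
  have := rot_inner th (P x) 0 f g x; rewrite mul0r addr0 => <-.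
  by rewrite phi_rot ev /rot/=; ring.
rewrite /Lrest e1 e2 ev ed cderiv_phi phi_rot r2 r4.
rewrite -!mulrA !rot_iM !rot_realM.
rewrite ?rotN ?rotD !rot_iM !rot_realM ?rotN ?rotD.
by congr (rot _ _ x); ring.
Qed.

Lemma unrot (z : C) x :
  z = rot (cos (th x) * Re z + sin (th x) * Im z) (cos (th x) * Im z - sin (th x) * Re z) x.
Proof.
apply: complex_eqP; rewrite /rot/=.
  transitivity (Re z * (cos (th x) ^+ 2 + sin (th x) ^+ 2)); last by ring.
  by rewrite cos2Dsin2 mulr1.
transitivity (Im z * (cos (th x) ^+ 2 + sin (th x) ^+ 2)); last by ring.
by rewrite cos2Dsin2 mulr1.
Qed.

Lemma Lrest_comp_L2 (f g A B : R -> R) : L2on setT f -> L2on setT g -> L2on setT A -> L2on setT B ->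
  L2 (fun x => rot (Lrest_f (f x) (B x) x) (Lrest_g (f x) (g x) (A x) x) x).
Proof.
rewrite /Lrest_f /Lrest_g.
move=> hf hg hA hB.
have bU := U_bc pr; have bP := P_bc pr; have bq := q0_bc pr.
have bP1 : bc P1 by exact: bcM.
apply: (rot_L2 dth).
  have k1 : bc (fun x => omega + 2 * (P x * (th1 x * P x)) - b * (U x * U x) - 4 * b * (U x * (P x * P x))).
    apply: bcB; first apply: bcB; first apply: bcD.
    - exact: bc_cst.
    - by apply: bcM; [exact: bc_cst|apply: bcM => //; exact: bcM].
    - by apply: bcM; [exact: bc_cst|exact: bcM].
    - by apply: bcM; [exact: bc_cst|apply: bcM => //; exact: bcM].
  have k2 : bc (fun x => U x - c) by apply: bcB => //; exact: bc_cst.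
  apply: L2on_eq (L2onD measurableT (bc_L2 k1 hf) (bc_L2 k2 hB)) => x _; ring.
have k1 : bc (fun x => omega - b * (U x * U x)).
  by apply: bcB; [exact: bc_cst|apply: bcM; [exact: bc_cst|exact: bcM]].
have k2 : bc (fun x => c - U x) by apply: bcB => //; exact: bc_cst.
have k3 : bc (fun x => - 2 * (P x * P1 x)) by apply: bcM; [exact: bc_cst|exact: bcM].
apply: L2on_eq (L2onD measurableT (L2onD measurableT (bc_L2 k1 hg) (bc_L2 k2 hA)) (bc_L2 k3 hf)) => x _; ring.
Qed.

Lemma unrot_L2 v : L2 v ->
  L2on setT (fun x => cos (th x) * Re (v x) + sin (th x) * Im (v x)) /\
  L2on setT (fun x => cos (th x) * Im (v x) - sin (th x) * Re (v x)).
Proof.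
move=> /L2P[h1 h2]; have bc1 := cs_bc dth; have bs := sn_bc dth.
by split; [apply: L2onD|apply: L2onB] => //; exact: bc_L2.
Qed.

Lemma Lrest_L2 v : H1 v -> L2 (Lrest b omega c v).
Proof.
move=> Hv; have [f2 g2] := unrot_L2 (H1_L2 Hv); have [A2 B2] := unrot_L2 (Dx_L2 Hv).
have := Lrest_comp_L2 f2 g2 A2 B2; congr L2; apply/funext => x.
by rewrite (@Lrest_rot v x _ _ _ _ (unrot (v x) x) (unrot (Dx v x) x)).
Qed.

(** In polar coordinates the second variation is the form of the scalar
    Schroedinger operator [- f'' + Vp f] plus the square of the first-order
    expression [h = g' - q0 g + U f / 2]; the remaining first-order terms are
    total derivatives. *)
Theorem Lop_polar v w (f1 fd1 g1 gd1 f2 fd2 g2 gd2 : R -> R) : H1 v -> H1 w ->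
  polar v f1 fd1 g1 gd1 -> polar w f2 fd2 g2 gd2 ->
  LL v w = \int[mu]_x (fd1 x * fd2 x + Vp x * (f1 x * f2 x)
    + (gd1 x - q0 x * g1 x + U x * f1 x / 2) * (gd2 x - q0 x * g2 x + U x * f2 x / 2)).
Proof.
move=> Hv Hw pv pw.
have Lr := Lrest_L2 Hv.
have [hf1 hg1 e1 e2] := pv; have [hf2 hg2 e3 e4] := pw.
have [lf1 lfd1 _] := hf1; have [lg1 lgd1 _] := hg1.
have [lf2 lfd2 _] := hf2; have [lg2 lgd2 _] := hg2.
have bU := U_bc pr; have bP := P_bc pr; have bq := q0_bc pr; have bV := V_bc pr; have bVp := Vp_bc pr.
have lA1 := L2onB measurableT lfd1 (bc_L2 bth1 lg1).
have lB1 := L2onD measurableT lgd1 (bc_L2 bth1 lf1).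
have lA2 := L2onB measurableT lfd2 (bc_L2 bth1 lg2).
have lB2 := L2onD measurableT lgd2 (bc_L2 bth1 lf2).
have eL : {ae mu, forall x : RT, Lrest b omega c v x =
    rot (Lrest_f (f1 x) (gd1 x + th1 x * f1 x) x)
        (Lrest_g (f1 x) (g1 x) (fd1 x - th1 x * g1 x) x) x}.
  by apply: aeS (aeI e1 e2) => x [E1 E2]; exact: (Lrest_rot E1 E2).
rewrite /Lop (polar_inner_Dx dth bth1 Hv Hw pv pw).
rewrite (inner_ae Lr (Lrest_comp_L2 lf1 lg1 lA1 lB1) (H1_L2 Hw) (rot_L2 dth lf2 lg2) eL e3).
rewrite innerE.
under [X in _ + X]eq_Rintegral do rewrite rot_inner.
have q0d x : is_derive x 1 q0 (V x - q0 x ^+ 2) by exact: q0_derive pr x.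
have UE x : - (D1 x / D x ^+ 2) = 2 * q0 x * U x.
  by rewrite /q0f /Uf; field; exact: D_neq0 pr x.
have Ud x : is_derive x 1 U (2 * q0 x * U x) by rewrite -UE; exact: U_derive pr x.
have bqU : bc (fun x => q0 x * U x) by exact: bcM.
have kd1 : bc (fun x => V x - q0 x ^+ 2) by apply: bcB => //; exact: bcM.
have k2d x : is_derive x 1 (fun y => c / 2 - 3 / 4 * U y) (- (3 / 2) * (q0 x * U x)).
  by have := Ud x => h; apply: is_derive_eq; rewrite /GRing.scale/=; field.
have k3d x : is_derive x 1 (fun y => U y / 4 - c / 2) (2^-1 * (q0 x * U x)).
  by have := Ud x => h; apply: is_derive_eq; rewrite /GRing.scale/=; field.
have bk2 : bc (fun y => c / 2 - 3 / 4 * U y).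
  by apply: bcB; [exact: bc_cst|apply: bcM => //; exact: bc_cst].
have bk2' : bc (fun x => - (3 / 2) * (q0 x * U x)) by apply: bcM => //; exact: bc_cst.
have bk3 : bc (fun y => U y / 4 - c / 2).
  by apply: bcB; [apply: bcM => //; exact: bc_cst|exact: bc_cst].
have bk3' : bc (fun x => 2^-1 * (q0 x * U x)) by apply: bcM => //; exact: bc_cst.
have [i1 T1] := total_derivative q0d bq kd1 hg1 hg2.
have [i2 T2] := total_derivative k2d bk2 bk2' hf1 hg2.
have [i3 T3] := total_derivative k3d bk3 bk3' hf2 hg1.
have bUh f : L2on setT f -> L2on setT (fun x => U x * f x / 2).
  move=> hf; apply: L2on_eq (L2onZ 2^-1 measurableT (bc_L2 bU hf)) => x _; exact: mulrC.
have lh1 := L2onD measurableT (L2onB measurableT lgd1 (bc_L2 bq lg1)) (bUh _ lf1).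
have lh2 := L2onD measurableT (L2onB measurableT lgd2 (bc_L2 bq lg2)) (bUh _ lf2).
have iQ : L1on setT (fun x => fd1 x * fd2 x + Vp x * (f1 x * f2 x)
    + (gd1 x - q0 x * g1 x + U x * f1 x / 2) * (gd2 x - q0 x * g2 x + U x * f2 x / 2)).
  apply: L1onD => //; last exact: L2onM.
  by apply: L1onD => //; [exact: L2onM|apply: bc_L1 => //; exact: L2onM].
have iA : L1on setT (fun x => (fd1 x - th1 x * g1 x) * (fd2 x - th1 x * g2 x)
     + (gd1 x + th1 x * f1 x) * (gd2 x + th1 x * f2 x)).
  by apply: L1onD => //; exact: L2onM.
have iB : L1on setT (fun x => Lrest_f (f1 x) (gd1 x + th1 x * f1 x) x * f2 x
    + Lrest_g (f1 x) (g1 x) (fd1 x - th1 x * g1 x) x * g2 x).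
  have := inner_L1 (Lrest_comp_L2 lf1 lg1 lA1 lB1) (rot_L2 dth lf2 lg2).
  by apply: L1on_eq => x _; rewrite rot_inner.
rewrite -RintegralD//.
rewrite -[RHS]addr0 -[X in _ = _ + X]T1 -[X in _ = X]addr0 -[X in _ = _ + X]T2.
rewrite -[X in _ = X]addr0 -[X in _ = _ + X]T3.
have i4 := L1onD measurableT iQ i1; have i5 := L1onD measurableT i4 i2.
rewrite -RintegralD// -RintegralD// -RintegralD//.
apply: eq_Rintegral => x _; rewrite /Lrest_f /Lrest_g.
have PP : P x ^+ 2 = U x by exact: P_sqr pr x.
have -> : 4 * b * U x * (P x * f1 x) * P x = 4 * b * U x * f1 x * P x ^+ 2 by ring.
have -> : 2 * (P x * f1 x) * (th1 x * P x) = 2 * f1 x * th1 x * P x ^+ 2 by ring.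
have -> : 2 * (P x * f1 x) * P1 x = 2 * f1 x * q0 x * P x ^+ 2 by rewrite /P1f; ring.
by rewrite PP /Vpf /Vf /th1f /gamma; field.
Qed.

End LinearizedOperator.

(** * Symmetry, kernel elements and the truncated kernel element *)

Section QuadraticForm.
Context {R : realType}.
Local Notation mu := (@lebesgue_measure R).
Local Notation RT := (measurableTypeR R).
Local Notation C := (Rcomplex R).
Local Notation Re := (@complex.Re R).
Local Notation Im := (@complex.Im R).
Variables (b omega c : R) (D D1 : R -> R) (eps : R).
Hypothesis pr : profile (4 * omega - c ^+ 2) c (gamma b) D D1 eps.
Hypothesis PhiE : forall x, Phi b omega c x = Pf D x.
Implicit Types (v w : R -> C) (x : R).

Local Notation th := (phase b omega c).
Local Notation U := (Uf D).
Local Notation P := (Pf D).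
Local Notation P1 := (P1f D D1).
Local Notation P2 := (P2f (4 * omega - c ^+ 2) c (gamma b) D).
Local Notation q0 := (q0f D D1).
Local Notation V := (Vf (4 * omega - c ^+ 2) c (gamma b) D).
Local Notation Vp := (Vpf (4 * omega - c ^+ 2) c (gamma b) D).
Local Notation th1 := (th1f c D).
Local Notation rot := (rot th).
Local Notation polar := (polar th th1).
Local Notation LL := (Lop b omega c).


Local Notation ph := (phi b omega c).
Let bth1 : bc th1 := th1_bc pr.
Let dth : forall x, is_derive x 1 th (th1 x) := phase_derive pr PhiE.

(** The first-order expression whose square appears in the form; both kernel elements
    annihilate it. *)
Definition hcov (f g gd : R -> R) x := gd x - q0 x * g x + U x * f x / 2.

Lemma hcov_L2 (f fd g gd : R -> R) : rH1 f fd -> rH1 g gd -> L2on setT (hcov f g gd).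
Proof.
move=> [lf _ _] [lg lgd _]; apply: L2onD => //.
  by apply: L2onB => //; exact: bc_L2 (q0_bc pr) lg.
apply: L2on_eq (L2onZ 2^-1 measurableT (bc_L2 (U_bc pr) lf)) => x _; exact: mulrC.
Qed.

Lemma Lop_integrand_L1 (f1 fd1 g1 gd1 f2 fd2 g2 gd2 : R -> R) :
  rH1 f1 fd1 -> rH1 g1 gd1 -> rH1 f2 fd2 -> rH1 g2 gd2 ->
  L1on setT (fun x => fd1 x * fd2 x + Vp x * (f1 x * f2 x) + hcov f1 g1 gd1 x * hcov f2 g2 gd2 x).
Proof.
move=> hf1 hg1 hf2 hg2.
have [lf1 lfd1 _] := hf1; have [lf2 lfd2 _] := hf2.
apply: L1onD => //; last by apply: L2onM => //; [exact: hcov_L2 hf1 hg1|exact: hcov_L2 hf2 hg2].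
by apply: L1onD => //; [exact: L2onM|apply: bc_L1; [exact: Vp_bc pr|exact: L2onM]].
Qed.

Lemma Lop_form v w (f1 fd1 g1 gd1 f2 fd2 g2 gd2 : R -> R) : H1 v -> H1 w ->
  polar v f1 fd1 g1 gd1 -> polar w f2 fd2 g2 gd2 ->
  LL v w = \int[mu]_x (fd1 x * fd2 x + Vp x * (f1 x * f2 x) + hcov f1 g1 gd1 x * hcov f2 g2 gd2 x).
Proof. exact: Lop_polar pr PhiE v w f1 fd1 g1 gd1 f2 fd2 g2 gd2. Qed.

Lemma Lop_symform : symform (H1 : set (R -> C)) LL.
Proof.
split=> [v w Hv Hw|w Hw a u v Hu Hv].
  have [f1 [fd1 [g1 [gd1 pv]]]] := polar_exists dth bth1 Hv.
  have [f2 [fd2 [g2 [gd2 pw]]]] := polar_exists dth bth1 Hw.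
  rewrite (Lop_form Hv Hw pv pw) (Lop_form Hw Hv pw pv).
  by apply: eq_Rintegral => x _; ring.
have [f1 [fd1 [g1 [gd1 pu]]]] := polar_exists dth bth1 Hu.
have [f2 [fd2 [g2 [gd2 pv]]]] := polar_exists dth bth1 Hv.
have [f3 [fd3 [g3 [gd3 pw]]]] := polar_exists dth bth1 Hw.
rewrite (Lop_form (H1_subspace_lin a Hu Hv) Hw (polar_lin dth bth1 a Hu Hv pu pv) pw).
rewrite (Lop_form Hu Hw pu pw) (Lop_form Hv Hw pv pw).
have [u1 u2 _ _] := pu; have [v1 v2 _ _] := pv; have [w1 w2 _ _] := pw.
have i1 := Lop_integrand_L1 u1 u2 w1 w2; have i2 := Lop_integrand_L1 v1 v2 w1 w2.
rewrite -(RintegralZl a measurableT i1) -(RintegralD measurableT (L1onZ a measurableT i1) i2).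
by apply: eq_Rintegral => x _; rewrite /hcov; ring.
Qed.

Lemma rH1_0 : rH1 (fun=> 0 : R) (fun=> 0 : R).
Proof. by split; [exact: L2on0|exact: L2on0|move=> a e; exact: AC_cst]. Qed.

Lemma phi_polar : H1 ph /\ polar ph P P1 (fun=> 0) (fun=> 0).
Proof.
have [h1 h2] := polar_rot dth bth1 (P_rH1 pr) rH1_0.
have E : (fun x => rot (P x) 0 x) = ph by apply/funext => x; rewrite (phi_rot PhiE).
by rewrite E in h1 h2.
Qed.

Lemma iphi_polar : H1 (fun x => 'i * ph x) /\
  polar (fun x => 'i * ph x) (fun=> 0) (fun=> 0) P P1.
Proof.
have [h1 h2] := polar_rot dth bth1 rH1_0 (P_rH1 pr).
have E : (fun x => rot 0 (P x) x) = (fun x => 'i * ph x).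
  by apply/funext => x; rewrite (phi_rot PhiE) rot_iM oppr0.
by rewrite E in h1 h2.
Qed.

Lemma th1P_rH1 (k : R) : rH1 (fun x => (th1 x - k) * P x) (fun x => th2f D D1 x * P x + (th1 x - k) * P1 x).
Proof.
apply: rH1M; [|by apply: bcB => //; exact: bc_cst|exact: th2_bc pr|exact: P_rH1 pr].
move=> x; have h := th1_derive pr x; apply: is_derive_eq; exact: subr0.
Qed.

Lemma dphi_polar : H1 (cderiv ph) /\
  polar (cderiv ph) P1 P2 (fun x => (th1 x - 0) * P x) (fun x => th2f D D1 x * P x + (th1 x - 0) * P1 x).
Proof.
have [h1 h2] := polar_rot dth bth1 (P1_rH1 pr) (th1P_rH1 0).
have E : (fun x => rot (P1 x) ((th1 x - 0) * P x) x) = cderiv ph.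
  by apply/funext => x; rewrite (cderiv_phi pr PhiE) subr0.
by rewrite E in h1 h2.
Qed.

(** The combination [phi' - i th'(0) phi] of kernel elements vanishes at the
    origin, so its restriction to the right half-line is in [H1]. *)
Definition nplus x : R[i] :=
  rot (right_half P1 x) (right_half (fun x => (th1 x - th1 0) * P x) x) x.

Lemma nplus_polar : H1 nplus /\
  polar nplus (right_half P1) (right_half P2) (right_half (fun x => (th1 x - th1 0) * P x))
    (right_half (fun x => th2f D D1 x * P x + (th1 x - th1 0) * P1 x)).
Proof.
apply: (polar_rot dth bth1).
  by apply: right_half_rH1; [exact: P1_rH1 pr|exact: P1_0 pr].
by apply: right_half_rH1; [exact: th1P_rH1|rewrite subrr mul0r].
Qed.

Lemma hcov_iphi x : hcov (fun=> 0) P P1 x = 0.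
Proof. by rewrite /hcov /P1f; ring. Qed.

Lemma hcov_dphi k x : hcov P1 (fun x => (th1 x - k) * P x)
  (fun x => th2f D D1 x * P x + (th1 x - k) * P1 x) x = 0.
Proof. by rewrite /hcov (th2E pr) /P1f; field. Qed.

Lemma Lop_iphi w : H1 w -> LL (fun x => 'i * ph x) w = 0.
Proof.
move=> Hw; have [h1 h2] := iphi_polar.
have [f [fd [g [gd pw]]]] := polar_exists dth bth1 Hw.
rewrite (Lop_form h1 Hw h2 pw).
rewrite (@eq_Rintegral _ _ _ mu _ (cst 0)); first by rewrite /Rintegral integral0.
by move=> x _; rewrite hcov_iphi; rewrite /=; ring.
Qed.

(** The integrand is the derivative of the product of [P2] and the amplitude of [w],
    since [P2] is the derivative of [P1] and [Vp P1] that of [P2]. *)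
Lemma Lop_dphi w : H1 w -> LL (cderiv ph) w = 0.
Proof.
move=> Hw; have [h1 h2] := dphi_polar.
have [f [fd [g [gd pw]]]] := polar_exists dth bth1 Hw; have [w1 _ _ _] := pw.
rewrite (Lop_form h1 Hw h2 pw).
have [_ T] := total_derivative (fun x => is_derive_cst (1 : R) x 1) (bc_cst 1) (bc_cst 0) (P2_rH1 pr) w1.
rewrite -[RHS]T; apply: eq_Rintegral => x _; rewrite hcov_dphi /=; ring.
Qed.

(** Cutting off a kernel element at the origin produces a boundary term. *)
Lemma Lop_nplus w : H1 w -> LL nplus w = - (P2 0 * amp th th1 w 0).
Proof.
move=> Hw; have [h1 h2] := nplus_polar.
have [f [fd [g [gd pw]]]] := polar_exists dth bth1 Hw; have [w1 _ _ _] := pw.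
have [-> _] := polar_amp dth bth1 pw Hw.
rewrite (Lop_form h1 Hw h2 pw).
have [p2 q2 _] := P2_rH1 pr; have [f2 fd2 _] := w1.
have iT : L1on setT (fun x => Vp x * P1 x * f x + P2 x * fd x).
  by apply: L1onD => //; exact: L2onM.
have cT : (fun n => P2 n%:R * f n%:R) @ \oo --> (0 : R).
  rewrite -[X in _ --> X](mulr0 (0 : R)).
  by apply: cvgM; [exact: rH1_cvgy (P2_rH1 pr)|exact: rH1_cvgy w1].
have AT e : AC 0 e (fun x => P2 x * f x) (fun x => Vp x * P1 x * f x + P2 x * fd x).
  by case: (P2_rH1 pr) w1 => _ _ a1 [_ _ a2]; exact: ACM.
have iT0 : L1on `[0, +oo[ (fun x => Vp x * P1 x * f x + P2 x * fd x) by exact: L1on_sub iT.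
have := Rintegral_derivative_half AT iT0 cT; rewrite /= => <-.
rewrite -Rintegral_itv_obnd_cbnd; last by exact: L1on_sub iT.
rewrite [RHS]Rintegral_mkcond; apply: eq_Rintegral => x _.
rewrite patchE; have -> : (x \in (`]0, +oo[%classic : set R)) = (0 < x).
  by apply/idP/idP; rewrite inE/= in_itv/= andbT.
have [x0|x0] := ltP 0 x.
  have -> : hcov (right_half P1) (right_half (fun x => (th1 x - th1 0) * P x))
     (right_half (fun x => th2f D D1 x * P x + (th1 x - th1 0) * P1 x)) x = 0.
    by have := hcov_dphi (th1 0) x; rewrite /hcov /right_half x0.
  by rewrite /right_half x0; ring.
have x0' : (0 < x) = false by apply/negbTE; rewrite -leNgt.
by rewrite /hcov /right_half x0' /=; transitivity (0 : R) => //; ring.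
Qed.

Lemma amp_phi : amp th th1 ph = P.
Proof. by have [h1 h2] := phi_polar; have [] := polar_amp dth bth1 h2 h1. Qed.

Lemma amp_nplus0 : amp th th1 nplus 0 = 0.
Proof.
have [h1 h2] := nplus_polar; have [-> _] := polar_amp dth bth1 h2 h1.
by rewrite /right_half ltxx.
Qed.

End QuadraticForm.

(** * Jacobi factorization of the amplitude form *)

Section Jacobi.
Context {R : realType}.
Local Notation mu := (@lebesgue_measure R).
Local Notation RT := (measurableTypeR R).
Variables (k2 c gam : R) (D D1 : R -> R) (eps : R).
Hypothesis pr : profile k2 c gam D D1 eps.
Implicit Types (f fd : R -> R) (x y a b : R).

Local Notation U := (Uf D).
Local Notation P := (Pf D).
Local Notation P1 := (P1f D D1).
Local Notation P2 := (P2f k2 c gam D).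
Local Notation q0 := (q0f D D1).
Local Notation Vp := (Vpf k2 c gam D).
Local Notation q := (qf k2 c D D1).

Lemma q_AC a b : 0 < a \/ b < 0 -> AC a b q (fun x => Vp x - q x ^+ 2).
Proof.
move=> ab; have nz t : a <= t -> t <= b -> t != 0.
  move=> at_ tb; case: ab => h; first by rewrite gt_eqF// (lt_le_trans h).
  by rewrite lt_eqF// (le_lt_trans tb).
apply: C1_AC => t at_ tb; first exact: q_derive pr t (nz t at_ tb).
have cq : {for t, continuous q}.
  apply/differentiable_continuous/derivable1_diffP.
  by have := q_derive pr (nz t at_ tb); case.
by apply: cvgB; [exact: (Vp_bc pr).1|apply: cvgM].
Qed.

Definition jac f fd x := fd x - q x * f x.

Lemma jac_L2 f fd a b : rH1 f fd -> 0 < a \/ b < 0 -> L2on `[a, b] (jac f fd).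
Proof.
move=> [_ _ hf] ab; apply: L2onB => //; first by case: (hf a b).
have [M hM] := AC_bounded (q_AC ab).
apply: (L2onM_bounded (M := M)) => //.
- exact: AC_measurable (q_AC ab).
- by move=> t /=; rewrite in_itv/= => /andP[]; exact: hM.
- exact: AC_L2u (hf a b).
Qed.

(** Jacobi's factorization of the form with potential [Vp = q' + q^2]. *)
Lemma jacobi_interval f fd a b : rH1 f fd -> a <= b -> 0 < a \/ b < 0 ->
  \int[mu]_(x in `[a, b]) (fd x ^+ 2 + Vp x * f x ^+ 2) =
  \int[mu]_(x in `[a, b]) (jac f fd x ^+ 2) + (q b * f b ^+ 2 - q a * f a ^+ 2).
Proof.
move=> hf ab h; have [_ _ af] := hf.
have A := ACM (q_AC h) (ACM (af a b) (af a b)).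
have hE := A.2 a b (lexx _) ab (lexx _).
rewrite !expr2 hE.
rewrite -RintegralD//; last 2 first.
- by case: (jac_L2 hf h).
- exact: AC_L1 A (lexx _) (lexx _).
by apply: eq_Rintegral => x _; rewrite /jac; ring.
Qed.

Lemma jac_mono f fd a b x y : rH1 f fd -> 0 < a \/ b < 0 -> a <= x -> y <= b ->
  \int[mu]_(t in `[x, y]) (jac f fd t ^+ 2) <= \int[mu]_(t in `[a, b]) (jac f fd t ^+ 2).
Proof. by move=> hf h; exact: Rintegral_sqr_mono (jac_L2 hf h). Qed.

(** The boundary terms [q f^2] of the factorization disappear along an exhaustion. *)
Lemma jacobi_exhaust (E : set RT) (s t : nat -> R) f fd : rH1 f fd -> measurable E ->
  (forall n, s n <= t n) -> (forall n, 0 < s n \/ t n < 0) ->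
  (forall n, `[s n, t n] `<=` E) ->
  (forall x y, x <= y -> (forall z, x <= z -> z <= y -> E z) ->
     exists N, forall n, (N <= n)%N -> s n <= x /\ y <= t n) ->
  (fun n => q (s n) * f (s n) ^+ 2) @ \oo --> (0 : R) ->
  (fun n => q (t n) * f (t n) ^+ 2) @ \oo --> (0 : R) ->
  forall x y, x <= y -> (forall z, x <= z -> z <= y -> E z) ->
  \int[mu]_(r in `[x, y]) (jac f fd r ^+ 2) <=
  \int[mu]_(r in E) (fd r ^+ 2 + Vp r * f r ^+ 2).
Proof.
move=> hf mE st h0 stE exh cs ct x y xy xyE.
have [lf lfd _] := hf.
have iF : L1on setT (fun r => fd r ^+ 2 + Vp r * f r ^+ 2).
  exact: (L1onD measurableT lfd.2 (bc_L1 (Vp_bc pr) lf.2)).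
have cF : (fun n => \int[mu]_(r in `[s n, t n]) (fd r ^+ 2 + Vp r * f r ^+ 2)) @ \oo -->
    \int[mu]_(r in E) (fd r ^+ 2 + Vp r * f r ^+ 2).
  apply: (@Rintegral_exhaust _ (fun n => `[s n, t n]%classic)) => //.
  - move=> z Ez; have [|N hN] := exh z z (lexx z).
      by move=> w zw wz; have -> : w = z by apply/eqP; rewrite eq_le wz zw.
    by exists N => n /hN[sz zt]; rewrite /= in_itv/= sz zt.
  - exact: L1on_sub iF.
have cB : (fun n => \int[mu]_(r in `[s n, t n]) (fd r ^+ 2 + Vp r * f r ^+ 2)
     - (q (t n) * f (t n) ^+ 2 - q (s n) * f (s n) ^+ 2)) @ \oo -->
    \int[mu]_(r in E) (fd r ^+ 2 + Vp r * f r ^+ 2) - (0 - 0).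
  by apply: cvgB => //; exact: cvgB.
rewrite subrr subr0 in cB.
apply: (ler_cvg_to (cvg_cst _) cB).
have [N hN] := exh x y xy xyE; exists N => // n /= /hN[sx yt].
by rewrite jacobi_interval// addrK; exact: jac_mono.
Qed.

Lemma q_cvg_infty f (s : nat -> R) : (forall n, 1 <= `|s n|) ->
  (fun n => f (s n)) @ \oo --> (0 : R) -> (fun n => q (s n) * f (s n) ^+ 2) @ \oo --> (0 : R).
Proof.
move=> s1 cf; have [K hK] := q_bound pr.
have cf2 : (fun n => `|K| * 2 * (f (s n) * f (s n))) @ \oo --> (0 : R).
  have h : (fun n => f (s n) * f (s n)) @ \oo --> (0 * 0 : R) by exact: cvgM.
  rewrite mulr0 in h.
  exact: (@bounded_cvg0 R (fun=> `|K| * 2) _ (fun=> 0) (bc_cst (`|K| * 2)) h).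
apply/cvgr0Pnorm_le => e e0; move/cvgr0Pnorm_le : cf2 => /(_ e e0).
apply: filterS => n; apply: le_trans.
have sn : s n != 0 by rewrite -normr_gt0 (lt_le_trans ltr01).
rewrite -expr2 normrM [leRHS]normrM ler_wpM2r// (le_trans (hK _ sn))//.
have i1 : `|s n|^-1 <= 1 by rewrite invf_le1// (lt_le_trans ltr01).
have i0 : 0 <= `|s n|^-1 by rewrite invr_ge0.
rewrite ger0_norm ?mulr_ge0//.
apply: (@le_trans _ _ (`|K| * (1 + `|s n|^-1))).
  by apply: ler_wpM2r; [rewrite addr_ge0|exact: ler_norm].
by apply: ler_wpM2l => //; lra.
Qed.

(** The simple pole of [q] is compensated by [f(x)^2 = o(|x|)], the Hoelder estimate with
    an energy that shrinks to zero. *)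
Lemma q_cvg_zero f fd (s I : nat -> R) : (forall n, 0 < `|s n| <= 1) ->
  (forall n, f (s n) ^+ 2 <= `|s n| * I n) -> I @ \oo --> (0 : R) ->
  (fun n => q (s n) * f (s n) ^+ 2) @ \oo --> (0 : R).
Proof.
move=> s1 hf cI; have [K hK] := q_bound pr.
have cI2 : (fun n => `|K| * 2 * I n) @ \oo --> (0 : R).
  exact: (@bounded_cvg0 R (fun=> `|K| * 2) _ (fun=> 0) (bc_cst (`|K| * 2)) cI).
apply/cvgr0Pnorm_le => e e0; move/cvgr0Pnorm_le : cI2 => /(_ e e0).
apply: filterS => n; apply: le_trans.
have /andP[s0 sle] := s1 n.
have sn : s n != 0 by rewrite -normr_gt0.
have I0 : 0 <= I n by rewrite -(pmulr_rge0 _ s0) (le_trans _ (hf n))// sqr_ge0.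
have f0 := sqr_ge0 (f (s n)).
rewrite normrM (ger0_norm f0) [leRHS]ger0_norm ?mulr_ge0//.
have k1 : `|q (s n)| <= `|K| * (1 + `|s n|^-1).
  by apply: le_trans (hK _ sn) _; rewrite ler_wpM2r ?ler_norm// addr_ge0// invr_ge0.
apply: le_trans (ler_pM (normr_ge0 _) f0 k1 (hf n)) _.
rewrite -!mulrA ler_wpM2l// mulrA mulrDl mul1r mulVf ?gt_eqF//.
by rewrite ler_wpM2r//; lra.
Qed.

Lemma invnS_le1 (n : nat) : (n.+1%:R)^-1 <= 1 :> R.
Proof. by rewrite invf_le1 ?ltr0n// ler1n. Qed.

Lemma invnS_lt x : 0 < x -> exists N, forall n, (N <= n)%N -> (n.+1%:R)^-1 < x.
Proof.
move=> x0; exists (Num.truncn `|x^-1|).+1 => n hn.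
rewrite invf_plt ?posrE ?ltr0n//; apply: lt_le_trans (truncnS_gt x^-1) _.
by rewrite ler_nat ltnW.
Qed.

Lemma nS_ge x : exists N, forall n, (N <= n)%N -> x <= n.+1%:R.
Proof.
exists (Num.truncn `|x|).+1 => n hn; apply: le_trans (ltW (truncnS_gt x)) _.
by rewrite ler_nat ltnW.
Qed.

Section half_lines.
Variables (f fd : R -> R).
Hypothesis hf : rH1 f fd.
Hypothesis f0 : f 0 = 0.

Let ifd : L1on setT (fun x => fd x ^+ 2).
Proof. by case: hf => _ [_ h] _. Qed.

Lemma q_cvg_0r : (fun n => q (n.+1%:R)^-1 * f (n.+1%:R)^-1 ^+ 2) @ \oo --> (0 : R).
Proof.
pose A n : set RT := `]0, (n.+1%:R)^-1]%classic.
apply: (@q_cvg_zero f fd _ (fun n => \int[mu]_(x in A n) (fd x ^+ 2))).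
- by move=> n; rewrite ger0_norm ?invr_ge0// invr_gt0 ltr0n invnS_le1.
- move=> n; have [_ _ af] := hf; have n0 : 0 <= (n.+1%:R)^-1 :> R by rewrite invr_ge0.
  rewrite /A Rintegral_itv_obnd_cbnd; last by exact: L1on_sub ifd.
  have := AC_holder (af 0 (n.+1%:R)^-1) (lexx 0) n0 (lexx _).
  by rewrite f0 !subr0 ger0_norm.
- apply: Rintegral_vanish => //; first by move=> n; exact: measurable_itv.
  move=> x; have [x0|x0] := ltP 0 x.
    have [N hN] := invnS_lt x0; exists N => n /hN h; rewrite /A /= in_itv/= x0/=.
    by apply/negP; rewrite -ltNge.
  by exists 0%N => n _; rewrite /A /= in_itv/= ltNge x0.
Qed.

Lemma q_cvg_0l : (fun n => q (- (n.+1%:R)^-1) * f (- (n.+1%:R)^-1) ^+ 2) @ \oo --> (0 : R).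
Proof.
pose A n : set RT := `[- (n.+1%:R)^-1, 0[%classic.
apply: (@q_cvg_zero f fd _ (fun n => \int[mu]_(x in A n) (fd x ^+ 2))).
- by move=> n; rewrite normrN ger0_norm ?invr_ge0// invr_gt0 ltr0n invnS_le1.
- move=> n; have [_ _ af] := hf; have n0 : - (n.+1%:R)^-1 <= 0 :> R by rewrite oppr_le0 invr_ge0.
  rewrite /A Rintegral_itv_bndo_bndc; last by exact: L1on_sub ifd.
  have := AC_holder (af (- (n.+1%:R)^-1) 0) (lexx _) n0 (lexx _).
  by rewrite f0 !sub0r sqrrN opprK normrN ger0_norm ?invr_ge0.
- apply: Rintegral_vanish => //; first by move=> n; exact: measurable_itv.
  move=> x; have [x0|x0] := ltP x 0.
    have [|N hN] := @invnS_lt (- x); first by rewrite oppr_gt0.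
    exists N => n /hN h; rewrite /A /= in_itv/= x0 andbT.
    by apply/negP; rewrite -ltNge ltrNr.
  by exists 0%N => n _; rewrite /A /= in_itv/= ltNge x0 andbF.
Qed.

Lemma q_cvg_y : (fun n => q n.+1%:R * f n.+1%:R ^+ 2) @ \oo --> (0 : R).
Proof.
apply: (@q_cvg_infty f (fun n => n.+1%:R)).
  by move=> n; rewrite ger0_norm// ler1n.
by have := rH1_cvgy hf; rewrite -(cvg_shiftS (fun n => f n%:R)).
Qed.

Lemma q_cvg_Ny : (fun n => q (- n.+1%:R) * f (- n.+1%:R) ^+ 2) @ \oo --> (0 : R).
Proof.
apply: (@q_cvg_infty f (fun n => - n.+1%:R)).
  by move=> n; rewrite normrN ger0_norm// ler1n.
by have := rH1_cvgNy hf; rewrite -(cvg_shiftS (fun n => f (- n%:R))).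
Qed.

Lemma invnS_le_nS (n : nat) : (n.+1%:R)^-1 <= n.+1%:R :> R.
Proof. by apply: le_trans (invnS_le1 n) _; rewrite ler1n. Qed.

Lemma jacobi_right x y : 0 < x -> x <= y ->
  \int[mu]_(r in `[x, y]) (jac f fd r ^+ 2) <=
  \int[mu]_(r in `]0, +oo[) (fd r ^+ 2 + Vp r * f r ^+ 2).
Proof.
move=> x0 xy; apply: (@jacobi_exhaust _ (fun n => (n.+1%:R)^-1) (fun n => n.+1%:R)) => //.
- exact: invnS_le_nS.
- by move=> n; left; rewrite invr_gt0.
- move=> n z /=; rewrite !in_itv/= andbT => /andP[nz _].
  by apply: lt_le_trans nz; rewrite invr_gt0.
- move=> a b ab h; have a0 : 0 < a by have := h a (lexx a) ab; rewrite /= in_itv/= andbT.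
  have [N1 h1] := invnS_lt a0; have [N2 h2] := nS_ge b.
  exists (maxn N1 N2) => n; rewrite geq_max => /andP[n1 n2].
  by split; [apply: ltW; exact: h1|exact: h2].
- exact: q_cvg_0r.
- exact: q_cvg_y.
- by move=> z xz _; rewrite /= in_itv/= andbT (lt_le_trans x0).
Qed.

Lemma jacobi_left x y : y < 0 -> x <= y ->
  \int[mu]_(r in `[x, y]) (jac f fd r ^+ 2) <=
  \int[mu]_(r in `]-oo, 0[) (fd r ^+ 2 + Vp r * f r ^+ 2).
Proof.
move=> y0 xy; apply: (@jacobi_exhaust _ (fun n => - n.+1%:R) (fun n => - (n.+1%:R)^-1)) => //.
- by move=> n; rewrite lerN2; exact: invnS_le_nS.
- by move=> n; right; rewrite oppr_lt0 invr_gt0.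
- move=> n z /=; rewrite !in_itv/= => /andP[_ zn].
  by apply: le_lt_trans zn _; rewrite oppr_lt0 invr_gt0.
- move=> a b ab h; have b0 : b < 0 by have := h b ab (lexx b); rewrite /= in_itv/=.
  have [|N1 h1] := @invnS_lt (- b); first by rewrite oppr_gt0.
  have [N2 h2] := nS_ge (- a).
  exists (maxn N1 N2) => n; rewrite geq_max => /andP[n1 n2].
  by split; [rewrite lerNl; exact: h2|rewrite lerNr; apply: ltW; exact: h1].
- exact: q_cvg_Ny.
- exact: q_cvg_0l.
- by move=> z _ zy; rewrite /= in_itv/= (le_lt_trans zy).
Qed.

Lemma jacobi_integrable : L1on setT (fun r => fd r ^+ 2 + Vp r * f r ^+ 2).
Proof.
have [lf lfd _] := hf.
exact: (L1onD measurableT lfd.2 (bc_L1 (Vp_bc pr) lf.2)).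
Qed.

Lemma jacobi_split : \int[mu]_r (fd r ^+ 2 + Vp r * f r ^+ 2) =
  \int[mu]_(r in `]-oo, 0[) (fd r ^+ 2 + Vp r * f r ^+ 2) +
  \int[mu]_(r in `]0, +oo[) (fd r ^+ 2 + Vp r * f r ^+ 2).
Proof.
have i := jacobi_integrable.
rewrite Rintegral_itv_bndo_bndc; last by exact: L1on_sub i.
have -> : [set: RT] = (`]-oo, 0] `|` `]0, +oo[)%classic.
  apply/seteqP; split => // x _ /=; rewrite !in_itv/= andbT.
  by have [|] := leP x 0; [left|right].
rewrite Rintegral_setU//.
- by apply: L1on_sub i => //; apply: measurableU.
- apply/disj_setPS => x [/=]; rewrite !in_itv/= andbT => x0.
  by rewrite ltNge x0.
Qed.

(** On each half-line both boundary terms of the factorization vanish, at the origin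
    because [f] does and at infinity because [f] decays and [q] is bounded. *)
Lemma jacobi_ge0 : 0 <= \int[mu]_r (fd r ^+ 2 + Vp r * f r ^+ 2).
Proof.
rewrite jacobi_split; apply: addr_ge0.
  apply: le_trans (jacobi_left (ltrN10 R) (lexx _)).
  by apply: Rintegral_ge0 => x _; exact: sqr_ge0.
apply: le_trans (jacobi_right ltr01 (lexx _)).
by apply: Rintegral_ge0 => x _; exact: sqr_ge0.
Qed.

Lemma jacobi_eq0 a b : \int[mu]_r (fd r ^+ 2 + Vp r * f r ^+ 2) = 0 ->
  0 < a \/ b < 0 -> a <= b -> \int[mu]_(r in `[a, b]) (jac f fd r ^+ 2) = 0.
Proof.
rewrite jacobi_split => h ab leab.
have hl : 0 <= \int[mu]_(r in `]-oo, 0[) (fd r ^+ 2 + Vp r * f r ^+ 2).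
  apply: le_trans (jacobi_left (ltrN10 R) (lexx _)).
  by apply: Rintegral_ge0 => x _; exact: sqr_ge0.
have hr : 0 <= \int[mu]_(r in `]0, +oo[) (fd r ^+ 2 + Vp r * f r ^+ 2).
  apply: le_trans (jacobi_right ltr01 (lexx _)).
  by apply: Rintegral_ge0 => x _; exact: sqr_ge0.
have /andP[/eqP el /eqP er] : (\int[mu]_(r in `]-oo, 0[) (fd r ^+ 2 + Vp r * f r ^+ 2) == 0)
    && (\int[mu]_(r in `]0, +oo[) (fd r ^+ 2 + Vp r * f r ^+ 2) == 0).
  by rewrite -paddr_eq0// h.
apply/eqP; rewrite eq_le; apply/andP; split; last first.
  by apply: Rintegral_ge0 => x _; exact: sqr_ge0.
by case: ab => z; [rewrite -er; exact: jacobi_right|rewrite -el; exact: jacobi_left].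
Qed.

End half_lines.

End Jacobi.

(** * Null vectors with vanishing amplitude at the origin *)

Section NullVectors.
Context {R : realType}.
Local Notation mu := (@lebesgue_measure R).
Local Notation RT := (measurableTypeR R).
Local Notation C := (Rcomplex R).
Variables (b omega c : R) (D D1 : R -> R) (eps : R).
Hypothesis pr : profile (4 * omega - c ^+ 2) c (gamma b) D D1 eps.
Hypothesis PhiE : forall x, Phi b omega c x = Pf D x.
Implicit Types (v w : R -> C) (x : R).

Local Notation th := (phase b omega c).
Local Notation U := (Uf D).
Local Notation P := (Pf D).
Local Notation P1 := (P1f D D1).
Local Notation P2 := (P2f (4 * omega - c ^+ 2) c (gamma b) D).
Local Notation q0 := (q0f D D1).
Local Notation Vp := (Vpf (4 * omega - c ^+ 2) c (gamma b) D).
Local Notation q := (qf (4 * omega - c ^+ 2) c D D1).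
Local Notation th1 := (th1f c D).
Local Notation rot := (rot th).
Local Notation polar := (polar th th1).
Local Notation LL := (Lop b omega c).
Local Notation ph := (phi b omega c).
Local Notation nplus := (nplus b omega c D D1).
Let bth1 : bc th1 := th1_bc pr.
Let dth : forall x, is_derive x 1 th (th1 x) := phase_derive pr PhiE.

Lemma polar_ae v w (f fd g gd : R -> R) : H1 w -> ae_equal v w -> polar v f fd g gd -> polar w f fd g gd.
Proof.
move=> Hw e [hf hg e1 _]; have [|_] // := polar_intro dth bth1 (H1_L2 Hw) hf hg.
by apply: aeS (aeI e e1) => x [<-].
Qed.

Lemma Lop_ae v w u : H1 v -> H1 w -> H1 u -> ae_equal v w -> LL v u = LL w u.
Proof.
move=> Hv Hw Hu e; have [f1 [fd1 [g1 [gd1 pv]]]] := polar_exists dth bth1 Hv.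
have [f2 [fd2 [g2 [gd2 pu]]]] := polar_exists dth bth1 Hu.
by rewrite (Lop_form pr PhiE Hv Hu pv pu) (Lop_form pr PhiE Hw Hu (polar_ae Hw e pv) pu).
Qed.

(** An integrating factor [k]: the first-order expression [J] of [u] vanishes
    almost everywhere only if [k u] is constant. *)
Lemma integrating_factor (a e : R) (k k1 u d J : R -> R) : a <= e ->
  (forall t, a <= t -> t <= e -> is_derive t 1 k (k1 t)) ->
  (forall t, a <= t -> t <= e -> {for t, continuous k1}) -> AC a e u d ->
  (forall t, a <= t -> t <= e -> k1 t * u t + k t * d t = k t * J t) ->
  L2on `[a, e] J -> \int[mu]_(t in `[a, e]) (J t ^+ 2) = 0 ->
  k e * u e = k a * u a.
Proof.
move=> ae dk ck hu kJ lJ J0.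
have Ak := C1_AC dk ck.
have A := AC_eqd kJ (ACM Ak hu).
have [M hM] := AC_bounded Ak.
have le0 : \int[mu]_(t in `[a, e]) ((k t * J t) ^+ 2) <= 0.
  apply: (@le_trans _ _ (\int[mu]_(t in `[a, e]) (M ^+ 2 * J t ^+ 2))).
    apply: le_Rintegral => //.
    - by case: (AC_L2 A (lexx _) (lexx _)).
    - by apply: L1onZ => //; case: lJ.
    - move=> t /=; rewrite in_itv/= => /andP[at_ te].
      rewrite exprMn ler_wpM2r ?sqr_ge0//.
      have h := hM t at_ te; rewrite -[k t ^+ 2]real_normK ?num_real//.
      by rewrite lerXn2r ?nnegrE// (le_trans _ h).
  by rewrite RintegralZl ?J0 ?mulr0//; case: lJ.
have := AC_holder A (lexx a) ae (lexx e) => h.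
apply/eqP; rewrite -subr_eq0 -sqrf_eq0 eq_le sqr_ge0 andbT (le_trans h)//.
by rewrite mulr_ge0_le0// subr_ge0.
Qed.

(** Here [1 / P1] is the integrating factor, as [q = P2 / P1]. *)
Lemma amp_null_const (f fd : R -> R) a e : rH1 f fd -> 0 < a \/ e < 0 -> a <= e ->
  \int[mu]_(r in `[a, e]) (jac (4 * omega - c ^+ 2) c D D1 f fd r ^+ 2) = 0 ->
  f e / P1 e = f a / P1 a.
Proof.
move=> hf h ae J0.
have nz t : a <= t -> t <= e -> t != 0.
  move=> at_ te; case: h => h; first by rewrite gt_eqF// (lt_le_trans h).
  by rewrite lt_eqF// (le_lt_trans te).
have dk t : a <= t -> t <= e -> is_derive t 1 (fun s => (P1 s)^-1) (- (P2 t / P1 t ^+ 2)).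
  move=> at_ te; have n := P1_neq0 pr (nz t at_ te).
  have h1 := @is_deriveV R P1 t _ 1 n (P1_derive pr t).
  by apply: (is_derive_eq h1); rewrite /GRing.scale/= mulNr mulrC.
rewrite ![_ / P1 _]mulrC.
apply: (integrating_factor ae dk _ _ _ (jac_L2 pr hf h) J0).
- move=> t at_ te; have n := P1_neq0 pr (nz t at_ te).
  apply: cvgN; apply: cvgM; first exact: (is_derive_continuous (P2_derive pr)).
  apply: cvgV; first by rewrite sqrf_eq0.
  have cP := is_derive_continuous (P1_derive pr).
  by rewrite expr2; apply: cvgM; exact: cP.
- by case: hf.
- move=> t at_ te; have n := P1_neq0 pr (nz t at_ te).
  by rewrite /jac -(qE pr (nz t at_ te)); field.
Qed.

(** After subtraction of the solution [al (th1 - th1 0) P] of the inhomogeneous equation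
    [g' = q0 g - U f / 2], the integrating factor is [1 / P]. *)
Lemma aux_null_const (f fd g gd : R -> R) (al a e : R) : rH1 f fd -> rH1 g gd -> a <= e ->
  (forall t, a <= t -> t <= e -> f t = al * P1 t) ->
  \int[mu]_r (hcov D D1 f g gd r ^+ 2) = 0 ->
  (g e - al * ((th1 e - th1 0) * P e)) / P e = (g a - al * ((th1 a - th1 0) * P a)) / P a.
Proof.
move=> hf hg ae fE H0.
have lh := hcov_L2 pr hf hg.
have h0 : \int[mu]_(t in `[a, e]) (hcov D D1 f g gd t ^+ 2) = 0.
  apply/eqP; rewrite eq_le; apply/andP; split; last by apply: Rintegral_ge0 => x _; exact: sqr_ge0.
  rewrite -H0; apply: Rintegral_subset_le => //; first by case: lh.
  by move=> x; exact: sqr_ge0.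
have dk t : a <= t -> t <= e -> is_derive t 1 (fun s => (P s)^-1) (- (P1 t / P t ^+ 2)).
  move=> _ _; have n : P t != 0 by rewrite gt_eqF ?(P_gt0 pr).
  have h1 := @is_deriveV R P t _ 1 n (P_derive pr t).
  by apply: (is_derive_eq h1); rewrite /GRing.scale/= mulNr mulrC.
have cP := is_derive_continuous (P_derive pr).
rewrite ![_ / P _]mulrC.
have := @integrating_factor a e (fun s => (P s)^-1) (fun t => - (P1 t / P t ^+ 2))
  (fun t => g t - al * ((th1 t - th1 0) * P t))
  (fun t => gd t - al * (th2f D D1 t * P t + (th1 t - th1 0) * P1 t)) (hcov D D1 f g gd) ae dk.
apply => //.
- move=> t _ _; have n : P t != 0 by rewrite gt_eqF ?(P_gt0 pr).
  apply: cvgN; apply: cvgM; first exact: (is_derive_continuous (P1_derive pr)).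
  by apply: cvgV; [rewrite sqrf_eq0|rewrite expr2; apply: cvgM; exact: cP].
- have [_ _ Ag] := hg; have [_ _ At] := th1P_rH1 pr (th1 0).
  have A := AC_lin (- al) (At a e) (Ag a e).
  apply: AC_eqd (AC_equ _ A) => t _ _ /=; ring.
- move=> t at_ te; have n : P t != 0 by rewrite gt_eqF ?(P_gt0 pr).
  by rewrite /hcov (fE t at_ te) (th2E pr) /P1f; field.
- exact: L2on_sub lh.
Qed.

Lemma Lop_split v (f fd g gd : R -> R) : H1 v -> polar v f fd g gd ->
  LL v v = \int[mu]_x (fd x ^+ 2 + Vp x * f x ^+ 2) + \int[mu]_x (hcov D D1 f g gd x ^+ 2).
Proof.
move=> Hv pv; have [hf hg _ _] := pv; have [_ lh] := hcov_L2 pr hf hg.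
rewrite (Lop_form pr PhiE Hv Hv pv pv).
rewrite -(RintegralD measurableT (jacobi_integrable pr hf) lh).
by apply: eq_Rintegral => x _; rewrite !expr2.
Qed.

(** The inequality of Jacobi applies because the amplitude vanishes where [P1] does. *)
Lemma Lop_ge0 v : H1 v -> amp th th1 v 0 = 0 -> 0 <= LL v v.
Proof.
move=> Hv; have [f [fd [g [gd pv]]]] := polar_exists dth bth1 Hv; have [hf _ _ _] := pv.
have [-> _] := polar_amp dth bth1 pv Hv => f0.
have Z1 := jacobi_ge0 pr hf f0.
have Z2 := Rintegral_sqr_ge0 (hcov D D1 f g gd).
by rewrite (Lop_split Hv pv) addr_ge0.
Qed.

(** On each side of the origin a null vector is a combination of the two kernel
    elements; continuity at the origin leaves one free jump. *)
Lemma Lop_null v : H1 v -> amp th th1 v 0 = 0 -> LL v v = 0 -> exists a s be : R,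
  ae_equal v (a *: (cderiv ph : R -> C) + (s *: ((fun x => 'i * ph x) : R -> C) + be *: (nplus : R -> C))).
Proof.
move=> Hv; have [f [fd [g [gd pv]]]] := polar_exists dth bth1 Hv; have [hf hg ev _] := pv.
have [-> _] := polar_amp dth bth1 pv Hv => f0.
rewrite (Lop_split Hv pv) => E0.
have Z1 := jacobi_ge0 pr hf f0.
have Z2 : 0 <= \int[mu]_x (hcov D D1 f g gd x ^+ 2) by exact: Rintegral_sqr_ge0.
have J0 : \int[mu]_x (fd x ^+ 2 + Vp x * f x ^+ 2) = 0 by apply/eqP; rewrite eq_le Z1 andbT; lra.
have H0 : \int[mu]_x (hcov D D1 f g gd x ^+ 2) = 0 by apply/eqP; rewrite eq_le Z2 andbT; lra.
clear E0 Z1 Z2.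
pose ap := f 1 / P1 1; pose am := f (-1) / P1 (-1).
have fp t : 0 <= t -> f t = ap * P1 t.
  rewrite le_eqVlt => /orP[/eqP <-|t0]; first by rewrite f0 (P1_0 pr) mulr0.
  have n : P1 t != 0 by rewrite (P1_neq0 pr)// gt_eqF.
  rewrite -[LHS](divfK n); congr (_ * _); rewrite /ap.
  have [t1|t1] := leP t 1.
    symmetry; apply: (amp_null_const hf _ t1); first by left.
    by apply: (jacobi_eq0 pr hf f0 J0) => //; left.
  apply: (amp_null_const hf _ (ltW t1)); first by left; exact: ltr01.
  by apply: (jacobi_eq0 pr hf f0 J0) (ltW t1); left; exact: ltr01.
have fm t : t <= 0 -> f t = am * P1 t.
  rewrite le_eqVlt => /orP[/eqP ->|t0]; first by rewrite f0 (P1_0 pr) mulr0.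
  have n : P1 t != 0 by rewrite (P1_neq0 pr)// lt_eqF.
  rewrite -[LHS](divfK n); congr (_ * _); rewrite /am.
  have [t1|t1] := leP t (-1).
    symmetry; apply: (amp_null_const hf _ t1); first by right; exact: ltrN10.
    by apply: (jacobi_eq0 pr hf f0 J0) t1; right; exact: ltrN10.
  apply: (amp_null_const hf _ (ltW t1)); first by right.
  by apply: (jacobi_eq0 pr hf f0 J0) (ltW t1); right.
have Pn t : P t != 0 by rewrite gt_eqF ?(P_gt0 pr).
pose s := g 0 / P 0.
have gp t : 0 <= t -> g t = s * P t + ap * ((th1 t - th1 0) * P t).
  move=> t0; have := aux_null_const hf hg t0 (fun r r0 _ => fp r r0) H0.
  rewrite subrr mul0r mulr0 subr0 -/s => /(congr1 (fun z => z * P t)).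
  by rewrite divfK// => /eqP; rewrite subr_eq => /eqP.
have gm t : t <= 0 -> g t = s * P t + am * ((th1 t - th1 0) * P t).
  move=> t0; have := aux_null_const hf hg t0 (fun r _ r0 => fm r r0) H0.
  rewrite subrr mul0r mulr0 subr0 -/s => /esym/(congr1 (fun z => z * P t)).
  by rewrite divfK// => /eqP; rewrite subr_eq => /eqP.
exists am, (s - am * th1 0), (ap - am).
apply: aeS ev => x ->.
transitivity (am *: (cderiv ph x : C) + ((s - am * th1 0) *: ('i * ph x : C) + (ap - am) *: (nplus x : C))); last by [].
rewrite (cderiv_phi pr PhiE) (phi_rot PhiE) rot_iM !scaleC /nplus !rot_realM !rotD.
have [x0|x0] := ltP 0 x.
  rewrite (fp _ (ltW x0)) (gp _ (ltW x0)) /right_half x0.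
  by congr (rot _ _ x); ring.
have x0' : (0 < x) = false by apply/negbTE; rewrite -leNgt.
rewrite (fm _ x0) (gm _ x0) /right_half x0'.
by congr (rot _ _ x); ring.
Qed.

End NullVectors.

(** * Bounds for the form in covariant derivatives *)

Section Bounds.
Context {R : realType}.
Local Notation mu := (@lebesgue_measure R).
Local Notation RT := (measurableTypeR R).
Local Notation C := (Rcomplex R).
Variables (b omega c : R) (D D1 : R -> R) (eps : R).
Hypothesis pr : profile (4 * omega - c ^+ 2) c (gamma b) D D1 eps.
Hypothesis PhiE : forall x, Phi b omega c x = Pf D x.
Implicit Types (v w : R -> C) (x : R).

Local Notation th := (phase b omega c).
Local Notation U := (Uf D).
Local Notation P := (Pf D).
Local Notation P1 := (P1f D D1).
Local Notation q0 := (q0f D D1).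
Local Notation th1 := (th1f c D).
Local Notation rot := (rot th).
Local Notation polar := (polar th th1).
Local Notation LL := (Lop b omega c).
Let bth1 : bc th1 := th1_bc pr.
Let dth : forall x, is_derive x 1 th (th1 x) := phase_derive pr PhiE.

(** The integrand of the form in terms of the covariant derivative [A + i B], written
    as its constant-coefficient limit at infinity plus terms carrying the decaying
    factor [U]. *)
Definition dens (f g A B x : R) :=
  A ^+ 2 + B ^+ 2 + c * (A * g - B * f) + omega * (f ^+ 2 + g ^+ 2)
  - U x * (A * g - B * f)
  + U x * ((2 * th1 x - 5 * b * U x) * f ^+ 2 - 2 * q0 x * (f * g) - b * U x * g ^+ 2).

Lemma Lop_dens v (f fd g gd : R -> R) : H1 v -> polar v f fd g gd ->
  LL v v = \int[mu]_x dens (f x) (g x) (fd x - th1 x * g x) (gd x + th1 x * f x) x.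
Proof.
move=> Hv pv.
have Lr := Lrest_L2 pr PhiE Hv.
have [[lf lfd _] [lg lgd _] e1 e2] := pv.
have lA := L2onB measurableT lfd (bc_L2 bth1 lg).
have lB := L2onD measurableT lgd (bc_L2 bth1 lf).
have eL : {ae mu, forall x : RT, Lrest b omega c v x =
    rot (Lrest_f b omega c D (f x) (gd x + th1 x * f x) x)
        (Lrest_g b omega c D D1 (f x) (g x) (fd x - th1 x * g x) x) x}.
  by apply: aeS (aeI e1 e2) => x [E1 E2]; exact: (Lrest_rot pr PhiE E1 E2).
have l2 := Lrest_comp_L2 pr PhiE lf lg lA lB.
rewrite /Lop (polar_inner_Dx dth bth1 Hv Hv pv pv).
rewrite (inner_ae Lr l2 (H1_L2 Hv) (rot_L2 dth lf lg) eL e1) innerE.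
under [X in _ + X]eq_Rintegral do rewrite rot_inner.
have iA := L1onD measurableT (L2onM measurableT lA lA) (L2onM measurableT lB lB).
have iB : L1on setT (fun x => Lrest_f b omega c D (f x) (gd x + th1 x * f x) x * f x
    + Lrest_g b omega c D D1 (f x) (g x) (fd x - th1 x * g x) x * g x).
  have := inner_L1 l2 (rot_L2 dth lf lg).
  by apply: L1on_eq => x _; rewrite rot_inner.
rewrite -(RintegralD measurableT iA iB).
apply: eq_Rintegral => x _; rewrite /Lrest_f /Lrest_g /dens.
move: (fd x - th1 x * g x) (gd x + th1 x * f x) => A B.
have PP : P x ^+ 2 = U x by exact: P_sqr pr x.
have -> : 4 * b * U x * (P x * f x) * P x = 4 * b * U x * f x * P x ^+ 2 by ring.
have -> : 2 * (P x * f x) * (th1 x * P x) = 2 * f x * th1 x * P x ^+ 2 by ring.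
have -> : 2 * (P x * f x) * P1 x = 2 * f x * q0 x * P x ^+ 2 by rewrite /P1f; ring.
by rewrite PP; ring.
Qed.

Lemma dens_coef : exists2 N : R, 0 <= N & forall x,
  [/\ `|2 * th1 x - 5 * b * U x| <= N, `|2 * q0 x| <= N, `|b * U x| <= N, U x <= N & `|c| <= N].
Proof.
have bU := U_bc pr.
have [_ [N1 h1]] : bc (fun x => 2 * th1 x - 5 * b * U x).
  by apply: bcB; apply: bcM => //; exact: bc_cst.
have [_ [N2 h2]] : bc (fun x => 2 * q0 x) by apply: bcM; [exact: bc_cst|exact: q0_bc pr].
have [_ [N3 h3]] : bc (fun x => b * U x) by apply: bcM => //; exact: bc_cst.
have [_ [N4 h4]] := bU.
have n1 := le_trans (normr_ge0 _) (h1 0); have n2 := le_trans (normr_ge0 _) (h2 0).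
have n3 := le_trans (normr_ge0 _) (h3 0); have n4 := le_trans (normr_ge0 _) (h4 0).
have n5 := normr_ge0 c.
exists (N1 + N2 + N3 + N4 + `|c|) => [|x]; first by rewrite !addr_ge0.
split; first by apply: le_trans (h1 x) _; lra.
- by apply: le_trans (h2 x) _; lra.
- by apply: le_trans (h3 x) _; lra.
- by apply: le_trans (ler_norm _) (le_trans (h4 x) _); lra.
- by lra.
Qed.

Lemma mul_le_half (s r : R) : `|s * r| <= (s ^+ 2 + r ^+ 2) / 2.
Proof.
have h1 := sqr_ge0 (s - r); have h2 := sqr_ge0 (s + r).
rewrite ler_norml; apply/andP; split; nra.
Qed.

Lemma mul_bound (n s M : R) : `|n| <= M -> `|n * s| <= M * `|s|.
Proof. by move=> h; rewrite normrM ler_wpM2r. Qed.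

Lemma dens_low (N n1 n2 n3 f g u : R) : 0 <= u -> `|n1| <= N -> `|n2| <= N -> `|n3| <= N ->
  `|u * (n1 * f ^+ 2 - n2 * (f * g) - n3 * g ^+ 2)| <= 2 * N * (u * (f ^+ 2 + g ^+ 2)).
Proof.
move=> u0 h1 h2 h3.
rewrite normrM (ger0_norm u0) [leRHS]mulrCA ler_wpM2l//.
have k1 := mul_bound (f ^+ 2) h1; have k2 := mul_bound (f * g) h2; have k3 := mul_bound (g ^+ 2) h3.
have N0 := le_trans (normr_ge0 _) h1.
have k4 := ler_wpM2l N0 (mul_le_half f g).
rewrite (ger0_norm (sqr_ge0 f)) in k1; rewrite (ger0_norm (sqr_ge0 g)) in k3.
have k5 := ler_normB (n1 * f ^+ 2 - n2 * (f * g)) (n3 * g ^+ 2).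
have k6 := ler_normB (n1 * f ^+ 2) (n2 * (f * g)).
have k7 := mulr_ge0 N0 (sqr_ge0 f); have k8 := mulr_ge0 N0 (sqr_ge0 g).
rewrite mulrDr; lra.
Qed.

Lemma cross_bound (s A B f g k : R) : 0 < k ->
  `|s * (A * g - B * f)| <= k / 2 * (A ^+ 2 + B ^+ 2) + s ^+ 2 / (2 * k) * (f ^+ 2 + g ^+ 2).
Proof.
move=> k0.
have e (z : R) : z / (2 * k) = z / k / 2 by field; rewrite gt_eqF.
have h y z : `|s * (y * z)| <= k / 2 * y ^+ 2 + s ^+ 2 / (2 * k) * z ^+ 2.
  have h1 := sqr_ge0 (k * y + s * z); have h2 := sqr_ge0 (k * y - s * z).
  have -> : k / 2 * y ^+ 2 + s ^+ 2 / (2 * k) * z ^+ 2 = (k ^+ 2 * y ^+ 2 + s ^+ 2 * z ^+ 2) / (2 * k).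
    by field; rewrite gt_eqF.
  have k20 : 0 < 2 * k by rewrite mulr_gt0.
  rewrite ler_pdivlMr// -[2 * k]ger0_norm ?(ltW k20)// -normrM ler_norml.
  by apply/andP; split; nra.
have := ler_normB (s * (A * g)) (s * (B * f)); rewrite -mulrBr => h1.
apply: (le_trans h1); have := h A g; have := h B f; lra.
Qed.

(** The first-order terms are absorbed into half of [A^2 + B^2]. *)
Lemma dens_garding : exists2 K : R, 0 <= K & forall (f g A B x : R),
  (A ^+ 2 + B ^+ 2) / 2 - K * (f ^+ 2 + g ^+ 2) <= dens f g A B x /\
  dens f g A B x <= 2 * (A ^+ 2 + B ^+ 2) + K * (f ^+ 2 + g ^+ 2).
Proof.
have [N N0 hN] := dens_coef.
exists (`|omega| + (2 * N) ^+ 2 / (2 * 1) + 2 * N * N) => [|f g A B x].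
  by rewrite !addr_ge0// ?mulr_ge0// ?divr_ge0 ?sqr_ge0.
have [h1 h2 h3 h4 h5] := hN x.
have u0 := ltW (U_gt0 pr x).
have L := dens_low f g u0 h1 h2 h3.
have S := cross_bound (c - U x) A B f g ltr01.
have T0 : 0 <= f ^+ 2 + g ^+ 2 by rewrite addr_ge0 ?sqr_ge0.
have L2 : 2 * N * (U x * (f ^+ 2 + g ^+ 2)) <= 2 * N * N * (f ^+ 2 + g ^+ 2).
  rewrite [leLHS]mulrA ler_wpM2r// ler_wpM2l ?mulr_ge0//.
have cU : (c - U x) ^+ 2 <= (2 * N) ^+ 2.
  rewrite -[(c - U x) ^+ 2]real_normK ?num_real// lerXn2r ?nnegrE ?mulr_ge0//.
  by apply: le_trans (ler_normB _ _) _; rewrite (ger0_norm u0); lra.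
have S2 : (c - U x) ^+ 2 / (2 * 1) * (f ^+ 2 + g ^+ 2) <= (2 * N) ^+ 2 / (2 * 1) * (f ^+ 2 + g ^+ 2).
  by rewrite ler_wpM2r// ler_wpM2r// invr_ge0 mulr_ge0.
have W : `|omega * (f ^+ 2 + g ^+ 2)| <= `|omega| * (f ^+ 2 + g ^+ 2).
  by rewrite normrM (ger0_norm T0).
have A0 : 0 <= A ^+ 2 + B ^+ 2 by rewrite addr_ge0 ?sqr_ge0.
have E : dens f g A B x = A ^+ 2 + B ^+ 2 + (c - U x) * (A * g - B * f) + omega * (f ^+ 2 + g ^+ 2) +
  U x * ((2 * th1 x - 5 * b * U x) * f ^+ 2 - 2 * q0 x * (f * g) - b * U x * g ^+ 2).
  by rewrite /dens; ring.
rewrite E; clear E h1 h2 h3 h4 h5 hN cU T0.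
move: L S L2 S2 W A0.
rewrite [(_ + _ + 2 * N * N) * _]mulrDl [(`|omega| + _) * _]mulrDl.
move: (U x * (_ - _ - _)) ((c - U x) * (A * g - B * f)) (omega * _) (`|omega| * _)
  (2 * N * N * _) ((c - U x) ^+ 2 / (2 * 1) * _) ((2 * N) ^+ 2 / (2 * 1) * _) (2 * N * (U x * _)).
move=> l s w w' t5 t6 t7 t8; rewrite !ler_norml.
move: (A ^+ 2) (B ^+ 2) => a2 b2.
move=> /andP[l1 l2] /andP[s1 s2] L2 S2 /andP[w1 w2] A0; split; lra.
Qed.

(** In the subcritical case the form at infinity is definite: its symbol
    [A^2 + c A g + omega g^2] has discriminant [c^2 - 4 omega < 0]. The constant is the
    determinant of the symbol divided by its trace, a lower bound for its smaller
    eigenvalue. *)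
Lemma symbol_ge (A g s : R) : 0 < omega -> 0 < 4 * omega - c ^+ 2 -> s ^+ 2 = c ^+ 2 ->
  (4 * omega - c ^+ 2) / (4 * (1 + omega)) * (A ^+ 2 + g ^+ 2) <= A ^+ 2 + s * (A * g) + omega * g ^+ 2.
Proof.
move=> o0 k0 sc; set k := _ / _.
have o1 : 0 < 4 * (1 + omega) by rewrite mulr_gt0// addr_gt0.
have kE : k * (1 + omega) = (4 * omega - c ^+ 2) / 4 by rewrite /k; field; rewrite gt_eqF// addr_gt0.
have k1 : 0 < 1 - k.
  rewrite subr_gt0 /k ltr_pdivrMr// mul1r; have := sqr_ge0 c; lra.
rewrite -subr_ge0 -(pmulr_rge0 _ k1).
have -> : (1 - k) * (A ^+ 2 + s * (A * g) + omega * g ^+ 2 - k * (A ^+ 2 + g ^+ 2)) =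
  ((1 - k) * A + s * g / 2) ^+ 2 + (omega - k * (1 + omega) + k ^+ 2 - s ^+ 2 / 4) * g ^+ 2 by field.
rewrite sc kE; apply: addr_ge0; first exact: sqr_ge0.
by rewrite mulr_ge0 ?sqr_ge0//; have := sqr_ge0 k; lra.
Qed.

Lemma dens_gap : 0 < omega -> 0 < 4 * omega - c ^+ 2 -> exists k K : R, [/\ 0 < k, 0 <= K &
  forall (f g A B x : R), k * (A ^+ 2 + B ^+ 2 + f ^+ 2 + g ^+ 2) - K * (U x * (f ^+ 2 + g ^+ 2)) <= dens f g A B x].
Proof.
move=> o0 d0; have [N N0 hN] := dens_coef.
pose k := (4 * omega - c ^+ 2) / (4 * (1 + omega)).
have k0 : 0 < k by rewrite divr_gt0// mulr_gt0// addr_gt0.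
exists (k / 2), (N / (2 * k) + 2 * N); split.
- by rewrite divr_gt0.
- by have kk := ltW k0; apply: addr_ge0; [apply: divr_ge0 => //; apply: mulr_ge0|apply: mulr_ge0].
move=> f g A B x; have [h1 h2 h3 h4 h5] := hN x.
have u0 := ltW (U_gt0 pr x).
have L := dens_low f g u0 h1 h2 h3.
have S := cross_bound (U x) A B f g k0.
have T0 : 0 <= f ^+ 2 + g ^+ 2 by rewrite addr_ge0 ?sqr_ge0.
have S2 : U x ^+ 2 / (2 * k) * (f ^+ 2 + g ^+ 2) <= N / (2 * k) * (U x * (f ^+ 2 + g ^+ 2)).
  have -> : U x ^+ 2 / (2 * k) * (f ^+ 2 + g ^+ 2) = (2 * k)^-1 * (U x * (f ^+ 2 + g ^+ 2)) * U x by ring.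
  rewrite [leRHS](_ : _ = (2 * k)^-1 * (U x * (f ^+ 2 + g ^+ 2)) * N); last by ring.
  have kk : 0 <= (2 * k)^-1 by rewrite invr_ge0 mulr_ge0// ltW.
  by apply: ler_wpM2l => //; exact: mulr_ge0 kk (mulr_ge0 u0 T0).
have Y1 := symbol_ge A g o0 d0 (erefl (c ^+ 2)).
have Y2 := symbol_ge B f o0 d0 (sqrrN c).
rewrite -/k in Y1 Y2; move: L S => /ler_normlP[L1 L2] /ler_normlP[S1 S3].
have E : dens f g A B x = (A ^+ 2 + c * (A * g) + omega * g ^+ 2) + (B ^+ 2 + - c * (B * f) + omega * f ^+ 2)
  - U x * (A * g - B * f) +
  U x * ((2 * th1 x - 5 * b * U x) * f ^+ 2 - 2 * q0 x * (f * g) - b * U x * g ^+ 2).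
  by rewrite /dens; ring.
rewrite E [(_ + 2 * N) * _]mulrDl.
clear E h1 h2 h3 h4 h5 hN T0.
have X0 := mulr_ge0 (ltW k0) (sqr_ge0 f); have X1 := mulr_ge0 (ltW k0) (sqr_ge0 g).
move: L1 L2 S1 S3 S2 Y1 Y2 X0 X1.
move: (U x * (_ - _ - _)) (U x * (A * g - B * f)) (A ^+ 2 + c * _ + _) (B ^+ 2 + - c * _ + _)
  (N / (2 * k) * _) (U x ^+ 2 / _ * _) (2 * N * _) => z1 z2 z3 z4 z5 z6 z7.
move: (A ^+ 2) (B ^+ 2) (f ^+ 2) (g ^+ 2) => a2 b2 f2 g2.
move=> L1 L2 S1 S3 S2 Y1 Y2 X0 X1; lra.
Qed.

Section polar_integrals.
Variables (v : R -> C) (f fd g gd : R -> R).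
Hypotheses (Hv : H1 v) (pv : polar v f fd g gd).
Local Notation A x := (fd x - th1 x * g x).
Local Notation B x := (gd x + th1 x * f x).

Let lf : L2on setT f. Proof. by case: pv => -[]. Qed.
Let lg : L2on setT g. Proof. by case: pv => _ []. Qed.
Let lfd : L2on setT fd. Proof. by case: pv => -[]. Qed.
Let lgd : L2on setT gd. Proof. by case: pv => _ []. Qed.
Let lA : L2on setT (fun x => A x). Proof. exact: L2onB measurableT lfd (bc_L2 bth1 lg). Qed.
Let lB : L2on setT (fun x => B x). Proof. exact: L2onD measurableT lgd (bc_L2 bth1 lf). Qed.

Lemma polar_norm : L1on setT (fun x => f x ^+ 2 + g x ^+ 2) /\
  inner v v = \int[mu]_x (f x ^+ 2 + g x ^+ 2).
Proof.
split; first by apply: L1onD => //; [case: lf|case: lg].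
rewrite (polar_inner dth Hv Hv pv pv).
by apply: eq_Rintegral => x _; rewrite !expr2.
Qed.

Lemma polar_Dnorm : L1on setT (fun x => A x ^+ 2 + B x ^+ 2) /\
  inner (Dx v) (Dx v) = \int[mu]_x (A x ^+ 2 + B x ^+ 2).
Proof.
split; first by apply: L1onD => //; [case: lA|case: lB].
rewrite (polar_inner_Dx dth bth1 Hv Hv pv pv).
by apply: eq_Rintegral => x _; rewrite !expr2.
Qed.

Lemma U_norm_L1 : L1on setT (fun x => U x * (f x ^+ 2 + g x ^+ 2)).
Proof. by apply: bc_L1; [exact: U_bc pr|exact: polar_norm.1]. Qed.

Lemma dens_L1 : L1on setT (fun x => dens (f x) (g x) (A x) (B x) x).
Proof.
have bU := U_bc pr; have bq := q0_bc pr.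
have bc1 (k : R -> R) (r : R) : bc k -> bc (fun x => r * k x) by move=> h; apply: bcM => //; exact: bc_cst.
have bc2 : bc (fun x => c - U x) by apply: bcB => //; exact: bc_cst.
have i1 := polar_Dnorm.1; have i2 := L1onZ omega measurableT polar_norm.1.
have i3 := bc_L1 bc2 (L1onB measurableT (L2onM measurableT lA lg) (L2onM measurableT lB lf)).
have b3 := bcM bU (bcB (bc1 _ 2 bth1) (bc1 _ (5 * b) bU)).
have i4 := bc_L1 b3 lf.2.
have i5 := bc_L1 (bcM bU (bc1 _ (-2) bq)) (L2onM measurableT lf lg).
have i6 := bc_L1 (bcM bU (bc1 _ (- b) bU)) lg.2.
have := L1onD measurableT (L1onD measurableT i1 i3) (L1onD measurableT i2 (L1onD measurableT i4 (L1onD measurableT i5 i6))).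
by apply: L1on_eq => x _; rewrite /dens; ring.
Qed.

(** [f' = A + th1 g] converts covariant bounds into bounds on the components. *)
Lemma polar_components (T : R) : (forall x, `|th1 x| <= T) ->
  [/\ \int[mu]_x (f x ^+ 2) <= inner v v, \int[mu]_x (g x ^+ 2) <= inner v v,
      \int[mu]_x (fd x ^+ 2) <= 2 * inner (Dx v) (Dx v) + 2 * T ^+ 2 * inner v v &
      \int[mu]_x (gd x ^+ 2) <= 2 * inner (Dx v) (Dx v) + 2 * T ^+ 2 * inner v v].
Proof.
move=> hT; have [i1 e1] := polar_norm; have [i2 e2] := polar_Dnorm.
have i3 := L1onD measurableT (L1onZ 2 measurableT i2) (L1onZ (2 * T ^+ 2) measurableT i1).
have e3 : 2 * inner (Dx v) (Dx v) + 2 * T ^+ 2 * inner v v =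
   \int[mu]_x (2 * (A x ^+ 2 + B x ^+ 2) + 2 * T ^+ 2 * (f x ^+ 2 + g x ^+ 2)).
  rewrite e1 e2 -(RintegralZl _ measurableT i2) -(RintegralZl _ measurableT i1).
  by rewrite -(RintegralD measurableT (L1onZ 2 measurableT i2) (L1onZ (2 * T ^+ 2) measurableT i1)).
have T2 x : th1 x ^+ 2 <= T ^+ 2.
  rewrite -[th1 x ^+ 2]real_normK ?num_real// lerXn2r ?nnegrE//.
  exact: le_trans (normr_ge0 _) (hT x).
have step (y z : R) x : (y + th1 x * z) ^+ 2 <= 2 * y ^+ 2 + 2 * (T ^+ 2 * z ^+ 2).
  have := sqr_ge0 (y - th1 x * z); have := ler_wpM2r (sqr_ge0 z) (T2 x); nra.
have pos (y : R) : 0 <= 2 * y ^+ 2 by rewrite mulr_ge0// sqr_ge0.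
have pos2 (y : R) : 0 <= 2 * (T ^+ 2 * y ^+ 2) by apply: mulr_ge0 => //; apply: mulr_ge0; exact: sqr_ge0.
split.
- by rewrite e1; apply: le_Rintegral => //; [case: lf|move=> x _; have := sqr_ge0 (g x); lra].
- by rewrite e1; apply: le_Rintegral => //; [case: lg|move=> x _; have := sqr_ge0 (f x); lra].
- rewrite e3; apply: le_Rintegral => //; first by case: lfd.
  move=> x _; have := step (A x) (g x) x; rewrite subrK => h; apply: (le_trans h).
  by have := pos (B x); have := pos2 (f x); rewrite -!mulrA !mulrDr; lra.
- rewrite e3; apply: le_Rintegral => //; first by case: lgd.
  move=> x _; have := step (B x) (- f x) x; rewrite mulrN addrK sqrrN => h; apply: (le_trans h).
  by have := pos (A x); have := pos2 (g x); rewrite -!mulrA !mulrDr; lra.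
Qed.

End polar_integrals.

Lemma garding : exists2 K : R, 0 <= K & forall v, H1 v ->
  inner (Dx v) (Dx v) / 2 - K * inner v v <= LL v v /\
  LL v v <= 2 * inner (Dx v) (Dx v) + K * inner v v.
Proof.
have [K K0 hK] := dens_garding; exists K => // v Hv.
have [f [fd [g [gd pv]]]] := polar_exists dth bth1 Hv.
have [i1 e1] := polar_norm Hv pv; have [i2 e2] := polar_Dnorm Hv pv.
have i3 := dens_L1 Hv pv; rewrite (Lop_dens Hv pv) e1 e2.
split.
  rewrite mulrC -(RintegralZl _ measurableT i1) -(RintegralZl _ measurableT i2).
  rewrite -(RintegralB measurableT (L1onZ _ measurableT i2) (L1onZ _ measurableT i1)).
  apply: le_Rintegral => //.
    exact: L1onB measurableT (L1onZ _ measurableT i2) (L1onZ _ measurableT i1).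
  by move=> x _; rewrite [2^-1 * _]mulrC; exact: (hK _ _ _ _ _).1.
rewrite -(RintegralZl _ measurableT i1) -(RintegralZl _ measurableT i2).
rewrite -(RintegralD measurableT (L1onZ _ measurableT i2) (L1onZ _ measurableT i1)).
apply: le_Rintegral => //; last by move=> x _; exact: (hK _ _ _ _ _).2.
exact: L1onD measurableT (L1onZ _ measurableT i2) (L1onZ _ measurableT i1).
Qed.

Lemma component_bound : exists2 K : R, 0 <= K & forall v (f fd g gd : R -> R), H1 v -> polar v f fd g gd ->
  [/\ \int[mu]_x (f x ^+ 2) <= K * inner1 v v, \int[mu]_x (g x ^+ 2) <= K * inner1 v v,
      \int[mu]_x (fd x ^+ 2) <= K * inner1 v v & \int[mu]_x (gd x ^+ 2) <= K * inner1 v v].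
Proof.
have [_ [T hT]] := bth1; exists (2 + 2 * T ^+ 2) => [|v f fd g gd Hv pv].
  by apply: addr_ge0 => //; apply: mulr_ge0 => //; exact: sqr_ge0.
have [h1 h2 h3 h4] := polar_components Hv pv hT.
have p1 := inner_ge0 v; have p2 := inner_ge0 (Dx v); rewrite /inner1.
have p3 := mulr_ge0 (sqr_ge0 T) p1; have p4 := mulr_ge0 (sqr_ge0 T) p2.
move: h1 h2 h3 h4 p1 p2 p3 p4; move: (inner v v) (inner (Dx v) (Dx v)) (T ^+ 2) => I J S.
move=> h1 h2 h3 h4 p1 p2 p3 p4; split.
- by apply: (le_trans h1); nra.
- by apply: (le_trans h2); nra.
- by apply: (le_trans h3); nra.
- by apply: (le_trans h4); nra.
Qed.

Lemma point_bound : exists2 K : R, 0 <= K & forall v x, H1 v ->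
  amp th th1 v x ^+ 2 <= K * inner1 v v /\ aux th th1 v x ^+ 2 <= K * inner1 v v.
Proof.
have [K K0 hK] := component_bound; exists (4 * K) => [|v x Hv]; first by rewrite mulr_ge0.
have [f [fd [g [gd pv]]]] := polar_exists dth bth1 Hv; have [hf hg _ _] := pv.
have [-> ->] := polar_amp dth bth1 pv Hv.
have [h1 h2 h3 h4] := hK _ _ _ _ _ Hv pv.
have k1 := rH1_point_bound x hf; have k2 := rH1_point_bound x hg.
by rewrite -mulrA; split; lra.
Qed.

End Bounds.

(** * Coercivity modulo finitely many point values *)

Section Gap.
Context {R : realType}.
Local Notation mu := (@lebesgue_measure R).
Local Notation RT := (measurableTypeR R).
Local Notation C := (Rcomplex R).

Section decay.
Variables (k2 c gam : R) (D D1 : R -> R) (eps : R).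
Hypothesis pr : profile k2 c gam D D1 eps.
Local Notation U := (Uf D).

Definition grid (m N j : nat) : R := - m%:R + j%:R / N.+1%:R.

Lemma grid_near (m N : nat) (x : R) : `|x| <= m%:R -> exists2 j, (j < (m + m) * N.+1 + 1)%N &
  grid m N j <= x /\ x - grid m N j <= N.+1%:R^-1.
Proof.
move=> /ler_normlP[x1 x2]; have n0 : 0 < N.+1%:R :> R by rewrite ltr0n.
pose t := (x + m%:R) * N.+1%:R.
have t0 : 0 <= t by rewrite mulr_ge0 ?(ltW n0)//; lra.
have /andP[h1 h2] := Num.Theory.truncn_itv t0.
exists (Num.truncn t).
  rewrite addn1 ltnS -(ler_nat R) (le_trans h1)// natrM ler_wpM2r ?(ltW n0)//.
  by rewrite natrD; lra.
have E : x = - m%:R + t / N.+1%:R by rewrite /t mulfK ?gt_eqF//; ring.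
clearbody t; split.
  by rewrite E /grid lerD2l ler_pM2r ?invr_gt0.
have -> : x - grid m N (Num.truncn t) = (t - (Num.truncn t)%:R) / N.+1%:R.
  by rewrite E /grid mulrBl; ring.
by rewrite -[leRHS]mul1r ler_pM2r ?invr_gt0// lerBlDl natr1 ltW.
Qed.

(** The weight [U] is integrable and small at infinity, so that functions
    vanishing on a fine enough finite grid have a small weighted norm. *)
Lemma weighted_small (del : R) : 0 < del -> exists m N : nat, forall f fd : R -> R, rH1 f fd ->
  (forall j, (j < (m + m) * N.+1 + 1)%N -> f (grid m N j) = 0) ->
  \int[mu]_x (U x * f x ^+ 2) <= del * (\int[mu]_x (f x ^+ 2) + \int[mu]_x (fd x ^+ 2)).
Proof.
move=> d0; have e0 := profile_eps pr; have ei : 0 < eps^-1 by rewrite invr_gt0.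
pose w (x : R) : R := (1 + x ^+ 2)^-1; pose I0 := \int[mu]_x w x.
have wp x : 0 < w x by rewrite invr_gt0 ltr_wpDr// sqr_ge0.
have I00 : 0 <= I0 by apply: Rintegral_ge0 => x _; exact: ltW.
(* [m] makes [U] at most [del / 2] outside the grid, and [N] makes the mesh so fine that
   the part inside contributes at most [del / 2]. *)
pose m := (Num.truncn `|2 * eps^-1 / del|).+1.
pose N := Num.truncn `|2 * (eps^-1 * I0) / del|.
have hm : 2 * eps^-1 / del <= m%:R by apply: ltW; exact: truncnS_gt.
have hN : 2 * (eps^-1 * I0) / del <= N.+1%:R by apply: ltW; exact: truncnS_gt.
have n0 : 0 < N.+1%:R :> R by rewrite ltr0n.
have m1 : 1 <= m%:R :> R by rewrite ler1n.
exists m, N => f fd hf f0; have [[mf lf] [mfd lfd] af] := hf.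
set F := \int[mu]_x (fd x ^+ 2).
have F0 : 0 <= F by exact: Rintegral_sqr_ge0.
have near x : `|x| <= m%:R -> f x ^+ 2 <= N.+1%:R^-1 * F.
  move=> /(grid_near N)[j jn [jx xj]].
  have := AC_holder (af (grid m N j) x) (lexx _) jx (lexx _).
  rewrite f0// subr0 => h; apply: (le_trans h); apply: ler_pM => //.
  - by rewrite subr_ge0.
  - by apply: Rintegral_ge0 => s _; exact: sqr_ge0.
  - by apply: Rintegral_subset_le => // s; exact: sqr_ge0.
have far x : m%:R < `|x| -> U x <= del / 2.
  move=> xm; apply: le_trans (U_decay pr x) _.
  have x2 : m%:R <= 1 + x ^+ 2.
    rewrite -[x ^+ 2]real_normK ?num_real//; nra.
  have x0 : 0 < 1 + x ^+ 2 by apply: lt_le_trans x2; exact: lt_le_trans m1.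
  rewrite ler_pdivrMr//; apply: (@le_trans _ _ (del / 2 * m%:R)).
    by move: hm; rewrite ler_pdivrMr//; lra.
  by rewrite ler_pM2l// divr_gt0.
have i1 : L1on setT (fun x => U x * f x ^+ 2) by apply: bc_L1 => //; exact: U_bc pr.
have i2 := L1onZ (del / 2) measurableT lf.
have i3 := L1onZ (eps^-1 * (N.+1%:R^-1 * F)) measurableT oneDsqrV_L1.
apply: (@le_trans _ _ (\int[mu]_x (del / 2 * f x ^+ 2 + eps^-1 * (N.+1%:R^-1 * F) * (1 + x ^+ 2)^-1))).
  apply: le_Rintegral => //; first exact: L1onD measurableT i2 i3.
  move=> x _; have [xm|xm] := leP `|x| m%:R.
    have h1 := ler_pM (ltW (U_gt0 pr x)) (sqr_ge0 (f x)) (U_decay pr x) (near x xm).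
    apply: (le_trans h1); rewrite -[leLHS]add0r; apply: lerD; last by rewrite [leLHS]mulrAC.
    by apply: mulr_ge0; [rewrite divr_ge0// ltW|exact: sqr_ge0].
  rewrite -[leLHS]addr0; apply: lerD; first by apply: ler_wpM2r; [exact: sqr_ge0|exact: far].
  apply: mulr_ge0; last exact: ltW (wp x).
  by apply: mulr_ge0; [exact: ltW|apply: mulr_ge0 => //; rewrite invr_ge0 ltW].
rewrite (RintegralD measurableT i2 i3) (RintegralZl _ measurableT lf).
rewrite (RintegralZl _ measurableT oneDsqrV_L1) -/I0 mulrDr.
apply: lerD.
  by apply: ler_wpM2r; [exact: Rintegral_sqr_ge0|lra].
have -> : eps^-1 * (N.+1%:R^-1 * F) * I0 = (eps^-1 * I0) / N.+1%:R * F by ring.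
apply: ler_wpM2r => //; rewrite ler_pdivrMr//.
have p : 0 <= eps^-1 * I0 by apply: mulr_ge0 => //; exact: ltW.
by move: hN; rewrite ler_pdivrMr//; lra.
Qed.

End decay.

Variables (b omega c : R) (D D1 : R -> R) (eps : R).
Hypothesis pr : profile (4 * omega - c ^+ 2) c (gamma b) D D1 eps.
Hypothesis PhiE : forall x, Phi b omega c x = Pf D x.
Local Notation U := (Uf D).
Local Notation th := (phase b omega c).
Local Notation th1 := (th1f c D).
Local Notation LL := (Lop b omega c).
Let bth1 : bc th1 := th1_bc pr.
Let dth : forall x : R, is_derive x 1 th (th1 x) := phase_derive pr PhiE.

Definition grid_values (m N : nat) : seq ((R -> C) -> R) :=
  mkseq (fun k v => if odd k then aux th th1 v (grid m N k./2) else amp th th1 v (grid m N k./2))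
    ((m + m) * N.+1 + 1).*2.

Lemma grid_values_linear (m N j : nat) : (j < size (grid_values m N))%N ->
  linear_on (H1 : set (R -> C)) (nth (fun=> 0) (grid_values m N) j).
Proof.
rewrite size_mkseq => h; rewrite nth_mkseq//; case: (odd j).
  exact: aux_linear dth bth1 _.
exact: amp_linear dth bth1 _.
Qed.

Lemma grid_values_bound : exists K : R, forall (m N j : nat) v, (j < size (grid_values m N))%N ->
  H1 v -> nth (fun=> 0) (grid_values m N) j v ^+ 2 <= K * inner1 v v.
Proof.
have [K _ hK] := point_bound pr PhiE; exists K => m N j v.
rewrite size_mkseq => h Hv; rewrite nth_mkseq//; case: (odd j); by have [] := hK v (grid m N j./2) Hv.
Qed.

(** The form is coercive up to the [U]-weighted norm, which is absorbed on the functions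
    that vanish on a fine grid. *)
Lemma gap_on_grid : 0 < omega -> 0 < 4 * omega - c ^+ 2 -> exists m N : nat,
  coercive ((H1 : set (R -> C)) `&` [set v : R -> C | forall j, (j < size (grid_values m N))%N ->
    nth (fun=> 0) (grid_values m N) j v = 0]) inner1 LL.
Proof.
move=> o0 k20; have [k [K [k0 K0 hK]]] := dens_gap pr o0 k20.
have [M M0 hM] := component_bound pr PhiE.
pose del := k / (2 * (4 * M * K + 1)).
have MK : 0 <= M * K by exact: mulr_ge0.
have MK1 : 0 < 4 * M * K + 1 by rewrite -mulrA; lra.
have d0 : 0 < del by rewrite /del divr_gt0// mulr_gt0.
have [m [N hs]] := weighted_small pr d0.
exists m, N; exists (k / 2); first by rewrite divr_gt0.
move=> v [Hv hv].
have [f [fd [g [gd pv]]]] := polar_exists dth bth1 Hv; have [hf hg _ _] := pv.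
have [Ef Eg] := polar_amp dth bth1 pv Hv.
have f0 j : (j < (m + m) * N.+1 + 1)%N -> f (grid m N j) = 0.
  move=> jn; have := hv j.*2; rewrite size_mkseq ltn_double => /(_ jn).
  by rewrite nth_mkseq ?ltn_double// odd_double half_double Ef.
have g0 j : (j < (m + m) * N.+1 + 1)%N -> g (grid m N j) = 0.
  move=> jn; have := hv j.*2.+1; rewrite size_mkseq ltn_Sdouble => /(_ jn).
  by rewrite nth_mkseq ?ltn_Sdouble// /= odd_double /= uphalf_double Eg.
have s1 := hs f fd hf f0; have s2 := hs g gd hg g0.
have [b1 b2 b3 b4] := hM _ _ _ _ _ Hv pv.
have [i1 e1] := polar_norm pr PhiE Hv pv; have [i2 e2] := polar_Dnorm pr PhiE Hv pv.
have i3 := dens_L1 pr PhiE Hv pv; have i4 := U_norm_L1 pr PhiE Hv pv.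
have [[_ lf2] _ _] := hf; have [[_ lg2] _ _] := hg.
have bU := U_bc pr.
have eU : \int[mu]_x (U x * (f x ^+ 2 + g x ^+ 2)) =
    \int[mu]_x (U x * f x ^+ 2) + \int[mu]_x (U x * g x ^+ 2).
  rewrite -(RintegralD measurableT (bc_L1 bU lf2) (bc_L1 bU lg2)).
  by apply: eq_Rintegral => x _; rewrite mulrDr.
have low : k * inner1 v v - K * \int[mu]_x (U x * (f x ^+ 2 + g x ^+ 2)) <= LL v v.
  rewrite (Lop_dens pr PhiE Hv pv) /inner1 e1 e2.
  rewrite -(RintegralD measurableT i1 i2) -(RintegralZl _ measurableT (L1onD measurableT i1 i2)).
  rewrite -(RintegralZl _ measurableT i4).
  rewrite -(RintegralB measurableT (L1onZ _ measurableT (L1onD measurableT i1 i2)) (L1onZ _ measurableT i4)).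
  apply: le_Rintegral => //.
    exact: L1onB measurableT (L1onZ _ measurableT (L1onD measurableT i1 i2)) (L1onZ _ measurableT i4).
  move=> x _; apply: le_trans (hK _ _ _ _ x).
  by rewrite lerD2r ler_pM2l// addrC addrA lexx.
apply: le_trans low; have n0 := inner1_psd Hv.
have sm : \int[mu]_x (U x * (f x ^+ 2 + g x ^+ 2)) <= del * (4 * M * inner1 v v).
  rewrite eU; apply: le_trans (lerD s1 s2) _; rewrite -mulrDr ler_pM2l//.
  by rewrite -mulrA; lra.
have sK := ler_wpM2l K0 sm.
have dk : K * (del * (4 * M * inner1 v v)) <= k / 2 * inner1 v v.
  have -> : K * (del * (4 * M * inner1 v v)) = del * (4 * M * K) * inner1 v v by ring.
  apply: ler_wpM2r => //.
  have dE : del * (4 * M * K + 1) = k / 2 by rewrite /del; field; rewrite gt_eqF// MK1.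
  lra.
lra.
Qed.

End Gap.

(** * Spectral decomposition of a form that is nonnegative on a hyperplane *)

Section SpectralDecomposition.
Context {R : realType} {T : lmodType R}.
(** [V] stands for H1 with squared norm [N], [I] for the L2 inner product, and [L] for the
    form to be decomposed; [l] defines the hyperplane. *)
Variables (V : set T) (N I L : T -> T -> R) (l : T -> R) (a K M C : R).
Implicit Types (u v w p : T).
Hypotheses (sV : subspace V) (sN : symform V N) (pN : psd V N)
  (cN : complete_for V N) (sI : symform V I) (pI : psd V I)
  (I_le_N : forall v, V v -> I v v <= N v v)
  (N_null : forall v, V v -> I v v = 0 -> N v v = 0)
  (sL : symform V L) (a0 : 0 < a) (K0 : 0 <= K)
  (L_garding : forall v, V v -> a * N v v - K * I v v <= L v v)
  (L_bound : forall v, V v -> L v v <= M * N v v)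
  (l_linear : linear_on V l) (l_bound : forall v, V v -> l v ^+ 2 <= C * N v v)
  (L_hyperplane : forall v, V v -> l v = 0 -> 0 <= L v v).

Lemma I_gt0 v : V v -> 0 < N v v -> 0 < I v v.
Proof.
move=> Vv n0; rewrite lt_neqAle pI// andbT eq_sym.
by apply/eqP => /(N_null Vv) e; rewrite e ltxx in n0.
Qed.

Lemma L_shift_symform (lam : R) : symform V (fun u v => L u v - lam * I u v).
Proof.
split=> [u v Vu Vv|w Vw s u v Vu Vv]; first by rewrite (sL.1 u v)// (sI.1 u v).
by rewrite (sL.2 w Vw)// (sI.2 w Vw)//; ring.
Qed.

(** The lowest eigenvalue is attained: the form minus its infimum is
    nonnegative and coercive on the hyperplane [l = 0], but not coercive, so it
    has a null vector. *)
Lemma lowest_eigenvector e : V e -> L e e < 0 -> exists (lam : R) (chi : T),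
  [/\ lam < 0, V chi, 0 < I chi chi &
      forall w, V w -> L chi w = lam * I chi w].
Proof.
move=> Ve Le0.
have I0e : 0 < I e e.
  rewrite lt_neqAle pI// andbT eq_sym; apply/eqP => ie.
  by have := L_garding Ve; rewrite ie (N_null Ve ie) !mulr0 subrr leNgt Le0.
pose S := [set r | exists v, [/\ V v, I v v = 1 & r = L v v]].
have nrm v : V v -> 0 < I v v -> S (L v v / I v v).
  move=> Vv i0; exists ((Num.sqrt (I v v))^-1 *: v).
  have q : ((Num.sqrt (I v v))^-1) ^+ 2 = (I v v)^-1 by rewrite exprVn sqr_sqrtr// ltW.
  rewrite (symformZ _ sV sI Vv) (symformZ _ sV sL Vv) q; split; first exact: subspaceZ.
    by rewrite mulVf// gt_eqF.
  by rewrite mulrC.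
have lbS : lbound S (- K).
  move=> r [v [Vv i1 ->]]; apply: le_trans (L_garding Vv); rewrite i1 mulr1.
  by rewrite lerDr; exact: mulr_ge0 (ltW a0) (pN Vv).
have hS : has_inf S by split; [exists (L e e / I e e); exact: nrm|exists (- K)].
have [lam [lam_le lam_inf]] : exists lam : R, (forall v, V v -> lam * I v v <= L v v) /\
    forall k, (forall v, V v -> I v v = 1 -> lam + k <= L v v) -> k <= 0.
  exists (inf S); split=> [v Vv|k hk].
    have := pI Vv; rewrite le_eqVlt => /orP[/eqP i0|i0].
      rewrite -i0 mulr0; have := L_garding Vv.
      by rewrite -i0 (N_null Vv (esym i0)) !mulr0 subrr.
    rewrite -ler_pdivlMr//; apply: (ge_inf hS.2); exact: nrm.
  have : inf S + k <= inf S.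
    by apply: lb_le_inf => //; [exact: hS.1|move=> r [v [Vv i1 ->]]; exact: hk].
  by rewrite gerDl.
have lam0 : lam < 0.
  have h := lam_le e Ve; rewrite ltNge; apply/negP => n.
  by have := mulr_ge0 n (ltW I0e); lra.
pose B u v := L u v - lam * I u v.
have sB : symform V B by exact: L_shift_symform.
have pB : psd V B by move=> v Vv; rewrite /B subr_ge0 lam_le.
have [] := @null_vector_or_coercive R T [:: l] V N B (M - lam) C sV sN pN sB pB cN.
- move=> v Vv; rewrite /B mulrBl; have := L_bound Vv.
  have : - lam * I v v <= - lam * N v v by rewrite ler_pM2l ?oppr_gt0// I_le_N.
  by rewrite !mulNr; lra.
- by move=> [|//] _; split.
(* The convex combination of the two lower bounds in which the terms in [I] cancel
   against [- lam * I]. *)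
- pose t := - lam / (K - lam).
  have Kl : 0 < K - lam by rewrite subr_gt0 (lt_le_trans lam0).
  have t0 : 0 < t by rewrite divr_gt0// oppr_gt0.
  have t1 : 0 <= 1 - t by rewrite subr_ge0 ler_pdivrMr// mul1r lerDr.
  have tE : t * (K - lam) = - lam by rewrite /t divfK// gt_eqF.
  exists (t * a); first by rewrite mulr_gt0.
  move=> v [Vv /(_ 0%N isT)/= lv].
  have h1 := L_garding Vv; have h2 := L_hyperplane Vv lv; rewrite /B.
  have h3 := ler_wpM2l (ltW t0) h1; have h4 := mulr_ge0 t1 h2.
  have h5 : t * K * I v v = (- lam + t * lam) * I v v by rewrite -tE; ring.
  have h6 : 0 <= t * - lam * I v v.
    by apply: mulr_ge0 (pI Vv); apply: mulr_ge0; [exact: ltW|rewrite oppr_ge0 ltW].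
  lra.
- move=> [k k0 hk]; exfalso; suff : k <= 0 by rewrite leNgt k0.
  apply: lam_inf => v Vv i1; have := hk v Vv; rewrite /B i1 mulr1.
  have := I_le_N Vv; rewrite i1 => n1.
  by have := ler_wpM2l (ltW k0) n1; lra.
move=> [chi [Vc n0 B0]]; exists lam, chi; split=> //; first exact: I_gt0.
move=> w Vw; have := psd_cauchy_schwarz sV sB pB Vc Vw.
rewrite B0 mul0r => h; apply/eqP; rewrite -subr_eq0 -sqrf_eq0.
by rewrite eq_le sqr_ge0 andbT.
Qed.

Section below_hyperplane.
Variables (lam : R) (chi : T).
Hypotheses (lam0 : lam < 0) (Vc : V chi) (Ic : 0 < I chi chi)
  (eig : forall w, V w -> L chi w = lam * I chi w).

Lemma chi_transversal : l chi != 0.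
Proof.
apply/eqP => /(L_hyperplane Vc); rewrite eig// leNgt.
by rewrite nmulr_rlt0 ?Ic.
Qed.

Let part v := v - (l v / l chi) *: chi.

Let V_part v : V v -> V (part v).
Proof. by move=> Vv; apply: subspaceB => //; exact: subspaceZ. Qed.

Let l_part v : V v -> l (part v) = 0.
Proof.
move=> Vv; have Vs := subspaceZ (l v / l chi) sV Vc.
rewrite /part (linear_onB l_linear Vv Vs) (linear_onZ _ sV l_linear Vc).
by rewrite divfK ?subrr ?chi_transversal.
Qed.

Let L_part v : V v -> L (part v) (part v) =
  L v v - 2 * (l v / l chi) * (lam * I chi v) + (l v / l chi) ^+ 2 * (lam * I chi chi).
Proof.
move=> Vv; rewrite /part addrC -scaleNr (symform_sq _ sV sL Vc Vv) !eig// sqrrN; ring.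
Qed.

(** Subtracting a multiple of [chi] moves any eigenvector into the hyperplane, where a
    negative value of the form is impossible. *)
Lemma eigenvector_simple v : V v -> (forall w, V w -> L v w = lam * I v w) ->
  exists s, I (v - s *: chi) (v - s *: chi) = 0.
Proof.
move=> Vv ev; exists (l v / l chi); have Vp := V_part Vv.
have := L_hyperplane Vp (l_part Vv).
have -> : L (part v) (part v) = lam * I (part v) (part v).
  have -> : I (part v) (part v) = I v v - 2 * (l v / l chi) * I chi v + (l v / l chi) ^+ 2 * I chi chi.
    rewrite /part addrC -scaleNr (symform_sq _ sV sI Vc Vv) sqrrN; ring.
  rewrite (L_part Vv) ev//; ring.
rewrite nmulr_rge0// => h; apply/eqP; rewrite eq_le h/=; exact: pI.
Qed.

(** An eigenvector for another eigenvalue is orthogonal to [chi], and the form is negative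
    on the plane that both span; but this plane meets the hyperplane. *)
Lemma eigenvalue_unique nu v : nu < 0 -> V v -> (forall w, V w -> L v w = nu * I v w) ->
  0 < I v v -> nu = lam.
Proof.
move=> nu0 Vv ev i0; apply/eqP/negPn/negP => ne.
have o : I chi v = 0.
  have : lam * I chi v = nu * I chi v by rewrite -eig// (sL.1 chi)// ev// (sI.1 v).
  by move=> /eqP; rewrite -subr_eq0 -mulrBl mulf_eq0 subr_eq0 eq_sym (negbTE ne) => /eqP.
have := L_hyperplane (V_part Vv) (l_part Vv); rewrite (L_part Vv) o !mulr0 subr0 ev//.
have h1 : nu * I v v < 0 by rewrite nmulr_rlt0.
have h2 : (l v / l chi) ^+ 2 * (lam * I chi chi) <= 0.
  by apply: mulr_ge0_le0; [exact: sqr_ge0|rewrite nmulr_rle0//; exact: ltW].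
lra.
Qed.

(** For [v] orthogonal to [chi] the form only decreases on the way to the hyperplane
    along [chi]. *)
Lemma L_orthogonal_ge0 v : V v -> I v chi = 0 -> 0 <= L v v.
Proof.
move=> Vv; rewrite (sI.1 v)// => o.
have := L_hyperplane (V_part Vv) (l_part Vv); rewrite (L_part Vv) o !mulr0 subr0.
have h2 : (l v / l chi) ^+ 2 * (lam * I chi chi) <= 0.
  by apply: mulr_ge0_le0; [exact: sqr_ge0|rewrite nmulr_rle0//; exact: ltW].
lra.
Qed.

Let V1 := V `&` [set v | I v chi = 0].

Let sV1 : subspace V1.
Proof.
split; first by split; [exact: sV.1|rewrite /= (sI.1 0) ?(symformr0 sV sI)//; exact: sV.1].
move=> s u v [Vu ou] [Vv ov]; split; first exact: sV.2.
by rewrite /= (sI.2 chi Vc)// ou ov mulr0 addr0.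
Qed.

(** Cauchy-Schwarz on the orthogonal complement of [chi]: null vectors of the
    form are in its kernel. *)
Lemma L_null_kernel v w : V v -> I v chi = 0 -> L v v = 0 -> V w -> L v w = 0.
Proof.
move=> Vv o z Vw.
have sL1 : symform V1 L.
  split=> [x y [Vx _] [Vy _]|y [Vy _] s x x' [Vx _] [Vx' _]]; first exact: sL.1.
  exact: (sL.2 y Vy).
have pL1 : psd V1 L by move=> x [Vx ox]; exact: L_orthogonal_ge0.
pose s := I w chi / I chi chi.
have Vs := subspaceZ s sV Vc.
have V1w : V1 (w - s *: chi).
  split; first exact: subspaceB.
  by rewrite /= (linear_onB (sI.2 chi Vc) Vw Vs) (linear_onZ s sV (sI.2 chi Vc) Vc) divfK ?subrr// gt_eqF.
have := psd_cauchy_schwarz sV1 sL1 pL1 (conj Vv o : V1 v) V1w; rewrite z mul0r => h.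
have z1 : L (w - s *: chi) v = 0.
  have Vws := V1w.1; rewrite (sL.1 _ _ Vws Vv); apply/eqP; rewrite -sqrf_eq0 eq_le h; exact: sqr_ge0.
move: z1; rewrite (linear_onB (sL.2 v Vv) Vw Vs) (linear_onZ s sV (sL.2 v Vv) Vc) eig//.
by rewrite (sI.1 chi)// o !mulr0 subr0 => <-; exact: sL.1.
Qed.

Variables (k1 k2 : T).
Hypotheses (Vk1 : V k1) (Vk2 : V k2)
  (ker1 : forall w, V w -> L k1 w = 0) (ker2 : forall w, V w -> L k2 w = 0)
  (kerE : forall v, V v -> (forall w, V w -> L v w = 0) ->
     exists s1 s2 : R, I (v - (s1 *: k1 + s2 *: k2)) (v - (s1 *: k1 + s2 *: k2)) = 0).

Definition positive_space : set T :=
  [set v | [/\ V v, I v chi = 0, I v k1 = 0 & I v k2 = 0]].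

Lemma positive_subspace : subspace positive_space.
Proof.
have V0 := sV.1; have z w : V w -> I 0 w = 0 by move=> Vw; rewrite (sI.1 0)// (symformr0 sV sI).
split; first by split=> //; exact: z.
move=> s u v [Vu u1 u2 u3] [Vv v1 v2 v3]; split; first exact: sV.2.
- by rewrite (sI.2 chi)// u1 v1 mulr0 addr0.
- by rewrite (sI.2 k1)// u2 v2 mulr0 addr0.
- by rewrite (sI.2 k2)// u3 v3 mulr0 addr0.
Qed.

Lemma I_limit0 (u : nat -> T) v w : (forall n, V (u n)) -> V v -> V w ->
  (forall n, I (u n) w = 0) -> seq_cvg N u v -> I v w = 0.
Proof.
move=> Vu Vv Vw uw cv; apply: (@small_cvg _ _ (I w w)) => e e0.
have [n hn] := cv e e0; have Vn := Vu n; have Vd := subspaceB sV Vn Vv.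
have := psd_cauchy_schwarz sV sI pI Vd Vw.
rewrite (linear_onB (sI.2 w Vw) Vn Vv) uw sub0r sqrrN => h; apply: (le_trans h).
rewrite mulrC ler_wpM2l ?pI//; exact: le_trans (I_le_N Vd) (hn n (leqnn n)).
Qed.

Lemma positive_complete : complete_for positive_space N.
Proof.
move=> u Pu cu; have Vu n : V (u n) by case: (Pu n).
have [v Vv cv] := cN Vu cu; exists v => //.
by split=> //; apply: (I_limit0 Vu) cv => // n; case: (Pu n).
Qed.

(** A null vector would be in the kernel, to which [p] is orthogonal. *)
Lemma L_positive p : positive_space p -> 0 < N p p -> 0 < L p p.
Proof.
move=> [Vp o1 o2 o3] n0; rewrite lt_neqAle L_orthogonal_ge0// andbT.
apply/eqP => /esym z.
have [s1 [s2 e]] := kerE Vp (fun w => L_null_kernel Vp o1 z (w:=w)).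
have Vz : V (s1 *: k1 + s2 *: k2).
  by apply: subspaceD => //; exact: subspaceZ.
have oz : I p (s1 *: k1 + s2 *: k2) = 0.
  rewrite (sI.1 p)//; have Vs2 := subspaceZ s2 sV Vk2.
  rewrite (sI.2 p Vp) // (linear_onZ s2 sV (sI.2 p Vp) Vk2).
  by rewrite (sI.1 k1)// (sI.1 k2)// o2 o3 !mulr0 addr0.
have := symform_sqB sV sI Vp Vz; rewrite e oz mulr0 subr0 => h.
have := I_gt0 Vp n0; have := pI Vz; lra.
Qed.

(** Positivity rules out the null vector in the alternative. *)
Lemma L_coercive (ls : seq (T -> R)) (C' : R) :
  (forall j, (j < size ls)%N -> linear_on V (nth (fun=> 0) ls j) /\
     forall v, V v -> nth (fun=> 0) ls j v ^+ 2 <= C' * N v v) ->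
  coercive (V `&` [set v | forall j, (j < size ls)%N -> nth (fun=> 0) ls j v = 0]) N L ->
  coercive positive_space N L.
Proof.
move=> hls [k k0 hk].
have PV v : positive_space v -> V v by case.
have sub (F : T -> T -> R) : symform V F -> symform positive_space F.
  move=> [h1 h2]; split=> [u v /PV Vu /PV Vv|w /PV Vw s u v /PV Vu /PV Vv]; first exact: h1.
  exact: (h2 w Vw).
have [] // := @null_vector_or_coercive R T ls positive_space N L M C' positive_subspace
  (sub N sN) _ (sub L sL) _ positive_complete.
- by move=> v /PV; exact: pN.
- by move=> v [Vv o _ _]; exact: L_orthogonal_ge0.
- by move=> v /PV; exact: L_bound.
- move=> j /hls[h1 h2]; split=> [s u v /PV Vu /PV Vv|v /PV]; last exact: h2.
  exact: h1.
- by exists k => // v [/PV Vv h]; apply: hk.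
move=> [v [Pv n0 z]]; have := L_positive Pv n0; by rewrite z ltxx.
Qed.

(** If [u] is a null vector the quotient is zero by convention, and orthogonality holds by
    Cauchy-Schwarz. *)
Lemma I_project u v : V u -> V v -> I (v - (I v u / I u u) *: u) u = 0.
Proof.
move=> Vu Vv; have Vs := subspaceZ (I v u / I u u) sV Vu.
rewrite (linear_onB (sI.2 u Vu) Vv Vs) (linear_onZ _ sV (sI.2 u Vu) Vu).
have [u0|u0] := eqVneq (I u u) 0; last by rewrite divfK ?subrr.
have := psd_cauchy_schwarz sV sI pI Vv Vu; rewrite u0 mulr0 => h.
by apply/eqP; rewrite mulr0 subr0 -sqrf_eq0 eq_le h; exact: sqr_ge0.
Qed.

Lemma kernel_orthogonal k : V k -> (forall w, V w -> L k w = 0) -> I chi k = 0.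
Proof.
move=> Vk hk; have := eig Vk; rewrite (sL.1 chi)// hk// => /esym/eqP.
by rewrite mulf_eq0 (lt_eqF lam0) => /eqP.
Qed.

(** Orthogonal projection, after a Gram-Schmidt step on the kernel elements, which need not
    be orthogonal to each other. *)
Lemma decomposition v : V v -> exists s s1 s2 : R,
  positive_space (v - (s *: chi + (s1 *: k1 + s2 *: k2))).
Proof.
move=> Vv; have o1 := kernel_orthogonal Vk1 ker1; have o2 := kernel_orthogonal Vk2 ker2.
pose r := I k2 k1 / I k1 k1; pose k3 := k2 - r *: k1.
have Vr := subspaceZ r sV Vk1; have Vk3 : V k3 by exact: subspaceB.
have o31 : I k3 k1 = 0 by exact: I_project.
pose s := I v chi / I chi chi; pose s1 := I v k1 / I k1 k1; pose s3 := I v k3 / I k3 k3.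
have E : s *: chi + ((s1 - s3 * r) *: k1 + s3 *: k2) = s *: chi + (s1 *: k1 + s3 *: k3).
  by rewrite /k3 scalerBr scalerA scalerBl -!addrA; congr (_ + (_ + _)); rewrite addrC.
exists s, (s1 - s3 * r), s3; rewrite E.
have Vsc := subspaceZ s sV Vc; have Vs1 := subspaceZ s1 sV Vk1; have Vs3 := subspaceZ s3 sV Vk3.
have V13 : V (s1 *: k1 + s3 *: k3) by exact: subspaceD.
have Va : V (s *: chi + (s1 *: k1 + s3 *: k3)) by exact: subspaceD.
have ev w : V w -> I (v - (s *: chi + (s1 *: k1 + s3 *: k3))) w =
    I v w - (s * I chi w + (s1 * I k1 w + s3 * I k3 w)).
  move=> Vw; rewrite (linear_onB (sI.2 w Vw) Vv Va).
  by rewrite (sI.2 w Vw)// (sI.2 w Vw)// (linear_onZ _ sV (sI.2 w Vw) Vk3).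
have pr u : V u -> I v u - (I v u / I u u) * I u u = 0.
  move=> Vu; have := I_project Vu Vv; have Vu' := subspaceZ (I v u / I u u) sV Vu.
  by rewrite (linear_onB (sI.2 u Vu) Vv Vu') (linear_onZ _ sV (sI.2 u Vu) Vu).
have o3 : I chi k3 = 0.
  rewrite (sI.1 chi)// (linear_onB (sI.2 chi Vc) Vk2 Vr) (linear_onZ _ sV (sI.2 chi Vc) Vk1).
  by rewrite !(sI.1 _ chi)// o1 o2 mulr0 subr0.
have p1 : I (v - (s *: chi + (s1 *: k1 + s3 *: k3))) k1 = 0.
  by rewrite ev// o1 o31 !mulr0 add0r addr0 pr.
have p3 : I (v - (s *: chi + (s1 *: k1 + s3 *: k3))) k3 = 0.
  have o13 : I k1 k3 = 0 by rewrite (sI.1 k1).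
  by rewrite ev// o3 o13 !mulr0 !add0r; exact: pr.
split=> //; first exact: subspaceB.
  have o1' : I k1 chi = 0 by rewrite (sI.1 k1).
  have o3' : I k3 chi = 0 by rewrite (sI.1 k3).
  by rewrite ev// o1' o3' !mulr0 !addr0; exact: pr.
move: p3; set z := v - _ in p1 *; have Vz : V z by exact: subspaceB.
rewrite (sI.1 z)// (linear_onB (sI.2 z Vz) Vk2 Vr) (linear_onZ _ sV (sI.2 z Vz) Vk1).
by rewrite (sI.1 k1)// p1 mulr0 subr0 (sI.1 k2).
Qed.

End below_hyperplane.

End SpectralDecomposition.

(** * Equality almost everywhere, spans and eigenspaces *)

Section AlmostEverywhereSpans.
Context {R : realType}.
Local Notation mu := (@lebesgue_measure R).
Local Notation RT := (measurableTypeR R).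
Local Notation C := (Rcomplex R).
Implicit Types (u v w : R -> C).

Lemma H1B v w : H1 v -> H1 w -> H1 (v - w).
Proof. exact: subspaceB H1_is_subspace. Qed.

Lemma ae_refl w : {ae mu, forall x : RT, w x = w x}.
Proof. exact: aeW. Qed.

Lemma inner_ae0 v w : H1 v -> H1 w -> ae_equal v (fun=> 0) -> inner v w = 0.
Proof.
move=> Hv Hw e; have L0 := H1_L2 (H1_0 (R := R)); have Lw := H1_L2 Hw.
rewrite (inner_ae (H1_L2 Hv) L0 Lw Lw e (ae_refl w)).
by rewrite innerC (symformr0 H1_is_subspace inner_symform Hw).
Qed.

Lemma inner1_null v : H1 v -> inner v v = 0 -> inner1 v v = 0.
Proof.
move=> Hv v0; have e := inner_eq0 (H1_L2 Hv) v0; have H0 := H1_0 (R := R).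
have D := Dx_ae Hv H0 e.
have := symformr0 H1_is_subspace inner1_symform H0; rewrite /inner1 v0 => Z.
have L0 := Dx_L2 H0; have Lv := Dx_L2 Hv.
rewrite (inner_ae Lv L0 Lv L0 D D); move: Z.
by rewrite (symformr0 H1_is_subspace inner_symform H0).
Qed.

Lemma inner_sub_ae v w : H1 v -> H1 w -> inner (v - w) (v - w) = 0 -> ae_equal v w.
Proof.
move=> Hv Hw /(inner_eq0 (H1_L2 (H1B Hv Hw))) e.
by apply: aeS e => x /eqP; rewrite subr_eq0 => /eqP.
Qed.

Lemma ae_inner_sub v w : H1 v -> H1 w -> ae_equal v w -> inner (v - w) (v - w) = 0.
Proof.
move=> Hv Hw e; apply: inner_ae0; [exact: H1B|exact: H1B|].
by apply: aeS e => x E; apply/eqP; rewrite subr_eq0; apply/eqP.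
Qed.

Lemma inner_congr v v' w : H1 v -> H1 v' -> H1 w -> ae_equal v v' -> inner v w = inner v' w.
Proof.
move=> /H1_L2 Lv /H1_L2 Lv' /H1_L2 Lw e.
exact: (inner_ae Lv Lv' Lw Lw e (ae_refl w)).
Qed.

Lemma rspan1 u v : rspan [:: u : R -> R[i]] v <-> H1 v /\ exists a : R, ae_equal v (a *: u).
Proof.
split=> -[Hv [a e]]; split=> //.
  exists (a 0%N); apply: aeS e => x ->; rewrite big_ord_recl big_ord0 addr0 /=.
  by rewrite -scaleC.
exists (fun=> a); apply: aeS e => x ->; rewrite big_ord_recl big_ord0 addr0 /=.
by rewrite -scaleC.
Qed.

Lemma rspan2 u w v : rspan [:: u : R -> R[i]; w] v <->
  H1 v /\ exists a a' : R, ae_equal v (a *: u + a' *: w).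
Proof.
split=> -[Hv].
  move=> [a e]; split=> //; exists (a 0%N), (a 1%N); apply: aeS e => x ->.
  by rewrite !big_ord_recl big_ord0 addr0 /= -!scaleC.
move=> [a [a' e]]; split=> //; exists (fun j => if j == 0%N then a else a').
apply: aeS e => x ->.
by rewrite !big_ord_recl big_ord0 addr0 /= -!scaleC.
Qed.

Lemma real_combE (a : R) u v : (fun x => a%:C * (u x : R[i]) + v x) = a *: u + v.
Proof. by apply/funext => x; rewrite -scaleC. Qed.

Lemma eigenspace_H1_subspace (L : (R -> C) -> (R -> C) -> R) (lam : R) :
  symform (H1 : set (R -> C)) L ->
  (forall v w u, H1 v -> H1 w -> H1 u -> ae_equal v w -> L v u = L w u) ->
  H1_subspace (weak_eigenspace L lam).
Proof.
move=> sL Lae; have H0 := H1_0 (R := R); split.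
- by move=> v [].
- split=> // w Hw; rewrite (sL.1 _ _ H0 Hw) (symformr0 H1_is_subspace sL Hw).
  by rewrite innerC (symformr0 H1_is_subspace inner_symform Hw) mulr0.
- move=> a u v [Hu eu] [Hv ev]; rewrite real_combE; split; first exact: H1_subspace_lin.
  move=> w Hw; rewrite (sL.2 w Hw a u v Hu Hv) (inner_symform.2 w Hw a u v Hu Hv).
  by rewrite eu// ev//; ring.
- move=> u v [Hu eu] Hv e; split=> // w Hw.
  by rewrite -(Lae u v)// -(inner_congr Hu Hv Hw e) eu.
Qed.

Lemma positive_space_H1_subspace (chi k1 k2 : R -> C) : H1 chi -> H1 k1 -> H1 k2 ->
  H1_subspace (positive_space (H1 : set (R -> C)) inner chi k1 k2).
Proof.
move=> Hc H1' H2; have [P0 Pl] := positive_subspace H1_is_subspace inner_symform Hc H1' H2.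
split; [by move=> v []|exact: P0|by move=> a u v Pu Pv; rewrite real_combE; exact: Pl|].
move=> u v [Hu u1 u2 u3] Hv e; split=> //.
- by rewrite -(inner_congr Hu Hv Hc e).
- by rewrite -(inner_congr Hu Hv H1' e).
- by rewrite -(inner_congr Hu Hv H2 e).
Qed.

End AlmostEverywhereSpans.

(** * The decomposition *)

Section Decomposition.
Context {R : realType}.
Local Notation C := (Rcomplex R).
Variables (b omega c : R) (D D1 : R -> R) (eps : R).
Hypothesis pr : profile (4 * omega - c ^+ 2) c (gamma b) D D1 eps.
Hypothesis PhiE : forall x, Phi b omega c x = Pf D x.
Implicit Types (v w : R -> C).

Local Notation P := (Pf D).
Local Notation P2 := (P2f (4 * omega - c ^+ 2) c (gamma b) D).
Local Notation th := (phase b omega c).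
Local Notation th1 := (th1f c D).
Local Notation LL := (Lop b omega c).
Local Notation ph := (phi b omega c : R -> C).
Local Notation iph := ((fun x => 'i * phi b omega c x) : R -> C).
Local Notation dph := (cderiv (phi b omega c) : R -> C).
Local Notation nplus := (nplus b omega c D D1 : R -> C).
Let sH := @H1_is_subspace R.
Let sL := Lop_symform pr PhiE.
Let Hph : H1 ph := (phi_polar pr PhiE).1.
Let Hiph : H1 iph := (iphi_polar pr PhiE).1.
Let Hdph : H1 dph := (dphi_polar pr PhiE).1.
Let Hn : H1 nplus := (nplus_polar pr PhiE).1.

Lemma P2P_lt0 : P2 0 * P 0 < 0.
Proof. by rewrite nmulr_rlt0 ?(P_gt0 pr)// (P2_0_lt0 pr). Qed.

Lemma Lop_nplus_phi : LL nplus ph = - (P2 0 * P 0).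
Proof. by rewrite (Lop_nplus pr PhiE Hph) (amp_phi pr PhiE). Qed.

(** The truncated kernel element [nplus] is a null vector that pairs nontrivially with
    [phi], so along [t *: nplus + phi] the form is affine in [t] and not constant. *)
Lemma Lop_negative : exists2 v, H1 v & LL v v < 0.
Proof.
have nn : LL nplus nplus = 0.
  by rewrite (Lop_nplus pr PhiE Hn) (amp_nplus0 pr PhiE) mulr0 oppr0.
(* The value of [t] at which the form is [LL ph ph - `|LL ph ph| - 1]. *)
pose t := (`|LL ph ph| + 1) / (2 * (P2 0 * P 0)).
exists (t *: nplus + ph); first exact: H1_subspace_lin.
rewrite (symform_sq t sH sL Hn Hph) nn mulr0 add0r Lop_nplus_phi.
have -> : 2 * t * - (P2 0 * P 0) = - (`|LL ph ph| + 1).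
  have n0 : P2 0 * P 0 != 0 by rewrite lt_eqF// P2P_lt0.
  by rewrite /t; move: n0; move: (P2 0 * P 0) => z n0; field.
by have := ler_norm (LL ph ph); lra.
Qed.

(** A kernel element pairs to zero with [nplus], hence its amplitude vanishes at
    the origin and it is a null vector of the nonnegative form; its jump
    coefficient is killed by pairing with [phi]. *)
Lemma Lop_kernel v : H1 v -> (forall w, H1 w -> LL v w = 0) ->
  exists s1 s2 : R, ae_equal v (s1 *: iph + s2 *: dph).
Proof.
move=> Hv kv.
have a0 : amp th th1 v 0 = 0.
  have := kv _ Hn; rewrite (sL.1 _ _ Hv Hn) (Lop_nplus pr PhiE Hv) => /eqP.
  by rewrite oppr_eq0 mulf_eq0 (lt_eqF (P2_0_lt0 pr)) => /eqP.
have [a [s [be e]]] := Lop_null pr PhiE Hv a0 (kv _ Hv).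
have Hbe := subspaceZ be sH Hn.
have Hs : H1 (s *: iph + be *: nplus) by exact: H1_subspace_lin.
have Ha : H1 (a *: dph + (s *: iph + be *: nplus)) by exact: H1_subspace_lin.
have := kv _ Hph; rewrite (Lop_ae pr PhiE Hv Ha Hph e).
rewrite (sL.2 ph Hph a _ _ Hdph Hs) (sL.2 ph Hph s _ _ Hiph Hbe).
rewrite (linear_onZ be sH (sL.2 ph Hph) Hn) Lop_nplus_phi.
rewrite (Lop_dphi pr PhiE Hph) (Lop_iphi pr PhiE Hph) !mulr0 !add0r => /eqP.
rewrite mulf_eq0 oppr_eq0 (lt_eqF P2P_lt0) orbF => /eqP be0.
exists s, a; apply: aeS e => x ->.
by rewrite be0 scale0r addr0 addrC.
Qed.

Lemma weak_kernel_rspan : weak_kernel LL = rspan [:: iph; dph].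
Proof.
apply/seteqP; split=> v.
  by move=> [Hv kv]; apply/rspan2; split=> //; exact: Lop_kernel.
move=> /rspan2[Hv [a [a' e]]]; split=> // w Hw.
have Ha' := subspaceZ a' sH Hdph.
have Ha : H1 (a *: iph + a' *: dph) by exact: H1_subspace_lin.
rewrite (Lop_ae pr PhiE Hv Ha Hw e) (sL.2 w Hw a _ _ Hiph Ha').
rewrite (linear_onZ a' sH (sL.2 w Hw) Hdph).
by rewrite (Lop_dphi pr PhiE Hw) (Lop_iphi pr PhiE Hw) !mulr0 addr0.
Qed.

Lemma garding_inner1 : exists K : R, [/\ 0 <= K,
  forall v, H1 v -> 2^-1 * inner1 v v - K * inner v v <= LL v v &
  forall v, H1 v -> LL v v <= (K + 2) * inner1 v v].
Proof.
have [K K0 hK] := garding pr PhiE; exists (K + 2^-1); split; first by rewrite addr_ge0.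
  by move=> v /hK[h _]; rewrite /inner1; lra.
move=> v /hK[_ h]; apply: (le_trans h); rewrite /inner1.
have := mulr_ge0 K0 (inner_ge0 (Dx v)); have := inner_ge0 v; have := inner_ge0 (Dx v); lra.
Qed.

Lemma amp0_bound : exists K : R, forall v, H1 v -> amp th th1 v 0 ^+ 2 <= K * inner1 v v.
Proof.
by have [K _ hK] := point_bound pr PhiE; exists K => v Hv; have [] := hK v 0 Hv.
Qed.

End Decomposition.

Theorem proposition1p2 (R : realType) (b omega c : R)
    (hadm : admissible b omega c) :
  exists (lam : R) (chi : R -> R[i]) (P : set (R -> R[i])),
    [/\ lam < 0,
        weak_eigenvector (Lop b omega c) lam chi,
        weak_eigenspace (Lop b omega c) lam = rspan [:: chi] &
        forall nu : R, nu < 0 -> weak_eigenvalue (Lop b omega c) nu -> nu = lam] /\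
    weak_kernel (Lop b omega c) =
      rspan [:: (fun x => 'i * phi b omega c x); cderiv (phi b omega c)] /\
    H1_orthogonal_direct_sum (rspan [:: chi]) (weak_kernel (Lop b omega c)) P /\
    (- 2 * Num.sqrt omega < c -> c < 2 * Num.sqrt omega ->
      exists k : R, 0 < k /\
        forall p, P p -> k * H1norm p ^+ 2 <= Lop b omega c p p) /\
    (c = 2 * Num.sqrt omega ->
      forall p, P p -> ~ ae_equal p (fun=> 0) -> 0 < Lop b omega c p p).
Proof.
have [D [D1 [eps [pr PhiE sub]]]] := soliton_profile hadm.
have o0 : 0 < omega by case: hadm.
pose T : lmodType R := R -> Rcomplex R.
pose LL : T -> T -> R := Lop b omega c; pose V : set T := H1.
pose I : T -> T -> R := @inner R; pose N : T -> T -> R := @inner1 R.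
pose k1 : T := (fun x => 'i * phi b omega c x); pose k2 : T := cderiv (phi b omega c).
pose l : T -> R := fun v => amp (phase b omega c) (th1f c D) v 0.
have sV : subspace V := @H1_is_subspace R.
have sI : symform V I := @inner_symform R.
have sN : symform V N := @inner1_symform R.
have pI : psd V I by move=> v _; exact: inner_ge0.
have pN : psd V N := @inner1_psd R.
have cN : complete_for V N := @H1_complete R.
have IN v : V v -> I v v <= N v v by move=> _; exact: inner_le_inner1.
have Nnull v : V v -> I v v = 0 -> N v v = 0 := @inner1_null R v.
have sL : symform V LL := Lop_symform pr PhiE.
have Lae v w u : V v -> V w -> V u -> ae_equal v w -> LL v u = LL w u := @Lop_ae R b omega c D D1 eps pr PhiE v w u.
have [K [K0 gard Lbd]] := garding_inner1 pr PhiE.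
have ll : linear_on V l by exact: (amp_linear (phase_derive pr PhiE) (th1_bc pr) 0).
have [Kl lbd] := amp0_bound pr PhiE.
have Lhyp v : V v -> l v = 0 -> 0 <= LL v v := @Lop_ge0 R b omega c D D1 eps pr PhiE v.
have [e Ve Le] := Lop_negative pr PhiE.
have h2 : 0 < 2^-1 :> R by rewrite invr_gt0.
have [lam [chi [lam0 Vc Ic eig]]] := lowest_eigenvector sV sN pN cN sI pI IN Nnull sL h2 K0 gard Lbd ll lbd Lhyp Ve Le.
have Vk1 : V k1 := (iphi_polar pr PhiE).1.
have Vk2 : V k2 := (dphi_polar pr PhiE).1.
have ker1 w : V w -> LL k1 w = 0 by exact: (Lop_iphi pr PhiE).
have ker2 w : V w -> LL k2 w = 0 by exact: (Lop_dphi pr PhiE).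
have kerE v : V v -> (forall w, V w -> LL v w = 0) ->
    exists s1 s2 : R, I (v - (s1 *: k1 + s2 *: k2)) (v - (s1 *: k1 + s2 *: k2)) = 0.
  move=> Vv kv; have [s1 [s2 h]] := Lop_kernel pr PhiE Vv kv; exists s1, s2.
  by apply: ae_inner_sub => //; apply: H1_subspace_lin => //; exact: subspaceZ.
pose Pos : set T := positive_space V I chi k1 k2.
have kernelE : weak_kernel (Lop b omega c) = rspan [:: k1 : R -> R[i]; k2 : R -> R[i]].
  exact: (weak_kernel_rspan pr PhiE).
have eigE : weak_eigenspace (Lop b omega c) lam = rspan [:: chi : R -> R[i]].
  apply/seteqP; split=> v.
    move=> [Vv ev]; apply/rspan1; split=> //.
    have [s hs] := eigenvector_simple sV sI pI sL ll Lhyp lam0 Vc Ic eig Vv ev.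
    by exists s; apply: inner_sub_ae => //; exact: subspaceZ.
  move=> /rspan1[Vv [s hs]]; split=> // w Vw; have Vs := subspaceZ s sV Vc.
  rewrite [LHS](Lae v _ w Vv Vs Vw hs) (linear_onZ s sV (sL.2 w Vw) Vc) eig//.
  have -> : inner v w = s * I chi w.
    by rewrite (inner_congr Vv Vs Vw hs); exact: (linear_onZ s sV (sI.2 w Vw) Vc).
  by ring.
exists lam, chi, Pos; split.
  split=> //.
    split; first by split.
    by move=> e0; move: Ic; rewrite /I (inner_ae0 Vc Vc e0) ltxx.
  move=> nu nu0 [v [[Vv ev] v0]].
  apply: (eigenvalue_unique sV sI sL ll Lhyp lam0 Vc Ic eig nu0 Vv ev).
  rewrite lt_neqAle pI// andbT; apply/eqP => z.
  by apply: v0; exact: (inner_eq0 (H1_L2 Vv) (esym z)).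
split; first exact: kernelE.
split; last split.
- split; last split.
  + rewrite -eigE; split.
    * exact: (eigenspace_H1_subspace lam sL Lae).
    * have -> : weak_kernel (Lop b omega c) = weak_eigenspace LL 0.
        by apply/seteqP; split=> v [Vv kv]; split=> // w Vw; have := kv w Vw; rewrite mul0r.
      exact: (eigenspace_H1_subspace 0 sL Lae).
    * exact: (positive_space_H1_subspace Vc Vk1 Vk2).
  + split.
    * rewrite -eigE => v w [Vv ev] [Vw kw].
      have := ev w Vw; rewrite -[X in X = _]/(LL v w) (sL.1 _ _ Vv Vw).
      have -> : LL w v = 0 by exact: kw.
      move=> /esym/eqP.
      by rewrite mulf_eq0 (lt_eqF lam0) => /eqP.
    * move=> v w /rspan1[Vv [s hs]] [Vw o1 _ _]; have Vs := subspaceZ s sV Vc.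
      rewrite (inner_congr Vv Vs Vw hs).
      by rewrite -[LHS]/(I (s *: chi) w) (linear_onZ s sV (sI.2 w Vw) Vc) (sI.1 _ _ Vc Vw) o1 mulr0.
    * rewrite kernelE => v w /rspan2[Vv [s1 [s2 hs]]] [Vw _ o1 o2].
      have Vs2 := subspaceZ s2 sV Vk2.
      have Vs : V (s1 *: k1 + s2 *: k2) by exact: H1_subspace_lin.
      rewrite (inner_congr Vv Vs Vw hs) -[LHS]/(I (s1 *: k1 + s2 *: k2) w).
      rewrite (sI.2 w Vw s1 _ _ Vk1 Vs2).
      rewrite (linear_onZ s2 sV (sI.2 w Vw) Vk2).
      by rewrite (sI.1 _ _ Vk1 Vw) (sI.1 _ _ Vk2 Vw) o1 o2 !mulr0 addr0.
  + move=> v Vv; have [s [s1 [s2 Pp]]] := decomposition sV sI pI sL lam0 Vc eig Vk1 Vk2 ker1 ker2 Vv.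
    have Vs := subspaceZ s sV Vc; have Vs2 := subspaceZ s2 sV Vk2.
    have Vz : V (s1 *: k1 + s2 *: k2) by exact: H1_subspace_lin.
    exists (s *: chi), (s1 *: k1 + s2 *: k2), (v - (s *: chi + (s1 *: k1 + s2 *: k2))); split=> //.
    * by apply/rspan1; split=> //; exists s; exact: aeW.
    * by rewrite kernelE; apply/rspan2; split=> //; exists s1, s2; exact: aeW.
    * have E : s *: chi + (s1 *: k1 + s2 *: k2) + (v - (s *: chi + (s1 *: k1 + s2 *: k2))) = v.
        by rewrite addrC subrK.
      by apply: aeW => x; rewrite -[LHS](congr1 (fun u : T => u x) E).
- move=> _ clt; have [m [n hg]] := gap_on_grid pr PhiE o0 (sub clt).
  have [Kg hKg] := grid_values_bound pr PhiE.
  have [|k k0 hk] := L_coercive sV sN pN cN sI pI IN Nnull sL Lbd ll Lhyp lam0 Vc Ic eig Vk1 Vk2 kerE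
    (ls := grid_values b omega c D m n) (C' := Kg) _ hg.
    move=> j hj; split; first exact: (grid_values_linear pr PhiE hj).
    by move=> v Vv; exact: hKg.
  by exists k; split=> // p Pp; rewrite H1norm_sqr; exact: hk.
- move=> _ p Pp p0; have [Vp _ _ _] := Pp.
  apply: (L_positive sV sI pI Nnull sL ll Lhyp lam0 Vc Ic eig Vk1 Vk2 kerE Pp).
  rewrite lt_neqAle pN// andbT; apply/eqP => z.
  by apply: p0; exact: (inner1_eq0 Vp (esym z)).
Qed.
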